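(* Work over $\overline{\mathbb{Q}}$. (1) The map $\mathbb{A}^1\setminus\{0\}\to\mathcal{M}_4$, $k\mapsto\left[\frac{z^4+1}{kz^3}\right]$, is one-to-one. The locus $\mathcal{A}_4(C_4)$ is an irreducible curve of genus zero with one singular point. (2) The map $\mathbb{A}^1\setminus\{\pm1\}\to\mathcal{M}_4$, $k\mapsto\left[\frac{z^4+kz}{kz^3+1}\right]$, is one-to-one. The locus $\mathcal{A}_4(D_3)$ is an irreducible curve of genus zero with one singular point. (3) The map $\mathbb{A}^2\setminus\{k_1k_2=1\}\to\mathcal{M}_4$, $(k_1,k_2)\mapsto\left[\frac{z^4+k_1z}{k_2z^3+1}\right]$, is two-to-one. The locus $\mathcal{A}_4(C_3)$ is a singular irreducible surface. (4) The map $\mathbb{A}^3\setminus\{k_2^2+k_3^2=k_1k_2k_3\}\to\mathcal{M}_4$, $(k_1,k_2,k_3)\mapsto\left[\frac{z^4+k_1z^2+1}{k_2z^3+k_3z}\right]$, is generically two-to-one.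
   Context: $\mathcal{M}_4=\mathrm{Rat}_4/\mathrm{PGL}_2$ is the moduli space of degree $4$ endomorphisms of $\mathbb{P}^1$ up to conjugation $f^\alpha=\alpha^{-1}\circ f\circ\alpha$, and $[f]$ is the class of $f$. $\mathrm{Aut}(f)=\{\alpha\in\mathrm{PGL}_2(\overline{\mathbb{Q}}): f^\alpha=f\}$, and $\mathcal{A}_4(\Gamma)\subset\mathcal{M}_4$ is the set of classes whose automorphism group contains a subgroup isomorphic to $\Gamma$; $C_n$ is cyclic of order $n$ and $D_n$ dihedral of order $2n$. The families in (1), (2), (3) are exactly the families whose classes make up $\mathcal{A}_4(C_4)$, $\mathcal{A}_4(D_3)$, $\mathcal{A}_4(C_3)$ respectively. ''Two-to-one'' means that a generic nonempty fibre has exactly two points; ''one-to-one'' means injective. Fixed point multiplier invariants: for $f$ of degree $4$, the five fixed points (with multiplicity) have multipliers $f'(Q)$ (in an affine coordinate), and $\sigma^{(1)}_i$ ($1\le i\le5$) is the $i$-th elementary symmetric function of these multipliers; these are functions on $\mathcal{M}_4$. The geometric assertions (irreducible, genus, singular) refer to the variety in affine space that is the Zariski closure of the image of the family under $(\sigma^{(1)}_1,\dots,\sigma^{(1)}_4)\in\mathbb{A}^4$ in (1) and (2), and under $(\sigma^{(1)}_1,\sigma^{(1)}_2,\sigma^{(1)}_3)\in\mathbb{A}^3$ in (3). ''Genus'' is geometric genus. *)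

(* Defs.v *)
(* Mathematical Components, with multinomials.  The field of algebraic numbers
   is [algC]. *)
From mathcomp Require Import all_boot all_order all_algebra.
From mathcomp Require Import all_fingroup all_solvable all_field.
From mathcomp Require Import mpoly.

Set Implicit Arguments.
Unset Strict Implicit.
Unset Printing Implicit Defensive.

Import GRing.Theory.
Local Open Scope ring_scope.

(** * Degree 4 endomorphisms of the projective line *)

(* The pair (p, q) stands for z |-> p(z) / q(z), equivalently for the pair of
   binary forms of degree 4
     F(X, Y) = \sum_i p_i X^i Y^(4-i),   G(X, Y) = \sum_i q_i X^i Y^(4-i). *)
Definition ratmap : Type := ({poly algC} * {poly algC})%type.

Definition Rat4 (f : ratmap) : Prop :=
  coprimep f.1 f.2 /\ maxn (size f.1) (size f.2) = 5%N.

Definition same_map (f g : ratmap) : Prop := f.1 * g.2 = g.1 * f.2.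

(* The degree 4 form attached to p, evaluated at (X, Y) = (u, v). *)
Definition form4 (p u v : {poly algC}) : {poly algC} :=
  \sum_(i < 5) p`_i *: (u ^+ i * v ^+ (4 - i)).

(* The conjugate alpha^-1 \o f \o alpha, where alpha(z) = (a z + b) / (c z + d)
   for the invertible matrix A = (a, b; c, d).  Scaling A does not change the
   resulting map, so the adjugate of A is used for alpha^-1. *)
Definition conj_map (A : 'M[algC]_2) (f : ratmap) : ratmap :=
  let a := A 0 0 in let b := A 0 1 in
  let c := A 1 0 in let d := A 1 1 in
  let u := a *: 'X + b%:P in
  let v := c *: 'X + d%:P in
  let p := form4 f.1 u v in
  let q := form4 f.2 u v in
  (d *: p - b *: q, a *: q - c *: p).

(* Equality [f] = [g] in the moduli space Rat4 / PGL_2. *)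
Definition conjugate (f g : ratmap) : Prop :=
  exists2 A : 'M[algC]_2, A \in unitmx & same_map (conj_map A f) g.

Definition in_Aut (f : ratmap) (A : 'M[algC]_2) : Prop :=
  A \in unitmx /\ same_map (conj_map A f) f.

Definition proj_eq (A B : 'M[algC]_2) : Prop :=
  exists2 c : algC, c != 0 & A = c *: B.

(* Aut(f), as a subgroup of PGL_2, contains a subgroup isomorphic to gT: there
   is an injective group morphism from gT to PGL_2 with values in Aut(f), given
   here through matrix representatives. *)
Definition Aut_contains (gT : finGroupType) (f : ratmap) : Prop :=
  exists phi : gT -> 'M[algC]_2,
    [/\ forall x, in_Aut f (phi x),
        forall x y, proj_eq (phi (x * y)%g) (phi x *m phi y)
      & forall x y, proj_eq (phi x) (phi y) -> x = y].

(* The degree 4 maps whose class lies in A_4(gT). *)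
Definition autlocus (gT : finGroupType) (f : ratmap) : Prop :=
  Rat4 f /\ Aut_contains gT f.

(* The dihedral group of order 6; note that 'D_m has order m in the library. *)
Definition D3 : finGroupType := dihedral_gtype 6.

(** * Families of classes in the moduli space *)

Definition maps_to_M4 (T : Type) (D : T -> Prop) (F : T -> ratmap) : Prop :=
  forall k, D k -> Rat4 (F k).

Definition one_to_one (T : Type) (D : T -> Prop) (F : T -> ratmap) : Prop :=
  maps_to_M4 D F /\
  forall k k', D k -> D k' -> conjugate (F k) (F k') -> k = k'.

(* A generic nonempty fibre has exactly two points.  D is meant to be a nonempty
   Zariski open subset of affine n-space; "generic" refers to a nonempty open
   subset of D, and every such subset contains a nonempty one of the form
   {g <> 0}. *)
Definition two_to_one n (D : 'rV[algC]_n -> Prop) (F : 'rV[algC]_n -> ratmap)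
    : Prop :=
  maps_to_M4 D F /\
  exists g : {mpoly algC[n]},
    (exists2 k, D k & g.@[k ord0] != 0) /\
    forall k, D k -> g.@[k ord0] != 0 ->
      exists k', [/\ D k', k' <> k &
        forall l, (D l /\ conjugate (F k) (F l)) <-> (l = k \/ l = k')].

(** * Fixed point multiplier invariants *)

(* Derivative of f.1 / f.2 at a finite point z which is not a pole. *)
Definition deriv_at (f : ratmap) (z : algC) : algC :=
  (f.1^`() * f.2 - f.1 * f.2^`()).[z] / f.2.[z] ^+ 2.

(* f in the coordinate w = 1/z, that is w |-> 1 / f(1/w). *)
Definition rev4 (p : {poly algC}) : {poly algC} := \poly_(i < 5) p`_(4 - i).
Definition flip (f : ratmap) : ratmap := (rev4 f.2, rev4 f.1).

(* Points of the projective line: None is the point at infinity. *)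
Definition multiplier (f : ratmap) (Q : option algC) : algC :=
  if Q is Some z then deriv_at f z else deriv_at (flip f) 0.

(* The roots of p, with multiplicity. *)
Definition poly_roots (p : {poly algC}) : seq algC :=
  sval (closed_field_poly_normal p).

(* The five zeros, with multiplicity, of the degree 5 form Y F - X G. *)
Definition fixed_points (f : ratmap) : seq (option algC) :=
  let r := poly_roots (f.1 - 'X * f.2) in
  [seq Some z | z <- r] ++ nseq (5 - size r) None.

Definition multipliers (f : ratmap) : seq algC :=
  [seq multiplier f Q | Q <- fixed_points f].

Definition sigma1 (i : nat) (f : ratmap) : algC :=
  (mesym 5 algC i).@[fun j => (multipliers f)`_j].

Definition sigma_vec (n : nat) (f : ratmap) : 'rV[algC]_n :=
  \row_(i < n) sigma1 i.+1 f.

(** * Affine varieties in affine n-space *)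

Section Affine.
Variable n : nat.
Implicit Types (S V W : 'rV[algC]_n -> Prop) (P : {mpoly algC[n]}).

Definition incl S W : Prop := forall x, S x -> W x.

(* P belongs to the ideal I(S). *)
Definition vanishes_on S P : Prop := forall x, S x -> P.@[x ord0] = 0.

Definition zclosure S : 'rV[algC]_n -> Prop :=
  fun x => forall P, vanishes_on S P -> P.@[x ord0] = 0.

Definition zclosed V : Prop :=
  exists I : {mpoly algC[n]} -> Prop,
    forall x, V x <-> (forall P, I P -> P.@[x ord0] = 0).

Definition zirreducible V : Prop :=
  (exists x, V x) /\
  forall V1 V2, zclosed V1 -> zclosed V2 ->
    (forall x, V x -> V1 x \/ V2 x) -> incl V V1 \/ incl V V2.

(* A chain W_0 < W_1 < ... < W_d of irreducible closed subsets of V. *)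
Definition has_chain V (d : nat) : Prop :=
  exists W : nat -> 'rV[algC]_n -> Prop,
    [/\ forall i, (i <= d)%N -> zclosed (W i) /\ zirreducible (W i),
        forall i, (i < d)%N -> incl (W i) (W i.+1) /\ ~ incl (W i.+1) (W i)
      & incl (W d) V].

Definition has_dim V (d : nat) : Prop := has_chain V d /\ ~ has_chain V d.+1.

(* w lies in the Zariski tangent space of V at x. *)
Definition tangent V (x w : 'rV[algC]_n) : Prop :=
  forall P, vanishes_on V P ->
    \sum_(i < n) (mderiv i P).@[x ord0] * w ord0 i = 0.

(* For V irreducible: x is singular when its tangent space contains more than
   dim V independent vectors. *)
Definition singular_point V (x : 'rV[algC]_n) : Prop :=
  V x /\
  exists d, has_dim V d /\
    exists2 W : 'M[algC]_(d.+1, n),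
      row_free W & forall i, tangent V x (row i W).

Definition irreducible_of_dim (d : nat) V : Prop :=
  [/\ zclosed V, zirreducible V & has_dim V d].

(* (L, iota, t) is the function field of the irreducible variety V, t being the
   coordinate functions: the kernel of P |-> P(t) is I(V), and L is the field of
   fractions of its image. *)
Definition is_function_field V (L : fieldType) (iota : {rmorphism algC -> L})
    (t : 'I_n -> L) : Prop :=
  (forall P, mmap iota t P = 0 <-> vanishes_on V P) /\
  (forall y : L, exists P Q,
     mmap iota t Q != 0 /\ y = mmap iota t P / mmap iota t Q).

End Affine.

(* The Zariski closure in affine n-space of the image of A_4(gT) under
   (sigma_1, ..., sigma_n). *)
Definition locus_variety (gT : finGroupType) (n : nat) : 'rV[algC]_n -> Prop :=
  zclosure (fun x => exists2 f, autlocus gT f & x = sigma_vec n f).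
Arguments locus_variety gT n _ : clear implicits.

(** * Genus of a function field of one variable over algC *)

Section Genus.
Variables (L : fieldType) (iota : {rmorphism algC -> L}).

(* Places of L / algC, as normalized discrete valuations.  The valuation of 0 is
   infinite; the value v 0 = 0 is a convention making v unique. *)
Definition place (v : L -> int) : Prop :=
  [/\ v 0 = 0,
      forall x y, x != 0 -> y != 0 -> v (x * y) = v x + v y,
      forall x y, x != 0 -> y != 0 -> x + y != 0 ->
        Num.min (v x) (v y) <= v (x + y),
      forall c : algC, c != 0 -> v (iota c) = 0
    & exists2 x, x != 0 & v x = 1].

(* The divisor \sum_(i < m) D i * v i, the v i being distinct places. *)
Definition distinct_places m (v : 'I_m -> L -> int) : Prop :=
  (forall i, place (v i)) /\ (forall i j, v i =1 v j -> i = j).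

(* Its degree: all residue fields are algC. *)
Definition ddeg m (D : 'I_m -> int) : int := \sum_(i < m) D i.

(* Its Riemann-Roch space {x | x = 0 or div(x) + D >= 0}. *)
Definition RRspace m (v : 'I_m -> L -> int) (D : 'I_m -> int) (x : L) : Prop :=
  x = 0 \/
  ((forall i, - D i <= v i x) /\
   (forall w, place w -> (forall i, ~ w =1 v i) -> 0 <= w x)).

Definition has_Kdim (S : L -> Prop) (d : nat) : Prop :=
  exists e : 'I_d -> L,
    [/\ forall i, S (e i),
        forall c : 'I_d -> algC,
          \sum_(i < d) iota (c i) * e i = 0 -> forall i, c i = 0
      & forall x, S x ->
          exists c : 'I_d -> algC, x = \sum_(i < d) iota (c i) * e i].

(* g is the maximum, over all divisors D, of deg D - l(D) + 1. *)
Definition field_genus (g : nat) : Prop :=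
  (forall m (v : 'I_m -> L -> int) (D : 'I_m -> int) (l : nat),
     distinct_places v -> has_Kdim (RRspace v D) l ->
     ddeg D - l%:Z + 1 <= g%:Z) /\
  (exists m (v : 'I_m -> L -> int) (D : 'I_m -> int) (l : nat),
     [/\ distinct_places v, has_Kdim (RRspace v D) l
       & ddeg D - l%:Z + 1 = g%:Z]).

End Genus.

(* The geometric genus of an irreducible curve is the genus of its function
   field, which is unique up to isomorphism. *)
Definition has_genus n (V : 'rV[algC]_n -> Prop) (g : nat) : Prop :=
  exists (L : fieldType) (iota : {rmorphism algC -> L}) (t : 'I_n -> L),
    is_function_field V iota t /\ field_genus iota g.

(* Main.v *)
(* Multipliers and fixed points are invariants of binary forms, hence of conjugacy
   classes.  A map with an automorphism of order 3 or 4, diagonalized, is one of the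
   families, and its five multipliers are (k, m, m, m, m), (k, k, m, m, m) or
   (k1, k2, m, m, m); the repeated one determines the others up to order, which gives
   the fibres in (1)-(3).  In (4) a conjugacy not fixing infinity would produce three
   fixed points with equal multipliers, which is excluded generically.
   Both curves are isomorphic to the cuspidal cubic a^2 b = (a + b)^2, parametrized by
   s <> 0 through a = (s + 1)^2 / s and b = a / s: the cusp s = -1 is the only
   singular point and s = a / b generates the function field, which has genus 0.
   The surface is the closure of the image of the plane under a polynomial map with a
   cuspidal edge. *)
Require Import Defs.
From mathcomp Require Import all_boot all_order all_algebra.
From mathcomp Require Import all_fingroup all_solvable all_field.
From mathcomp Require Import mpoly.
From mathcomp Require Import ring zify.
From Stdlib Require Import Classical FunctionalExtensionality PropExtensionality.
(* Again, because fingroup also has a [conjugate]. *)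
Require Import Defs.

Set Implicit Arguments.
Unset Strict Implicit.
Unset Printing Implicit Defensive.

Import Order.TTheory GRing.Theory Num.Theory.
Local Open Scope ring_scope.

(** * Quartic forms and conjugation *)

(** The relation [sum of 1 / (1 - l) = 1] over the five multipliers [l] (when none is 1) lies behind
    the formulas: it yields the repeated multiplier and shows where the singularities sit. Five
    equal multipliers must all be -4, which is the cusp [s = -1] of both curves; the cuspidal edge
    of the surface is where four multipliers agree. All varieties are closures of images, and no
    generators of an ideal are computed for the surface. A polynomial vanishing on the variety is
    pulled back along the parametrization, where it becomes a polynomial or Laurent polynomial that
    is identically zero; tangent vectors are then found by comparing orders of vanishing along arcs.
    Upper bounds for the dimension concern arbitrary chains of closed sets. On the curves a proper
    closed subset is finite; on the surface a chain of length 3 would give three algebraically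
    independent polynomials in two variables. The genus quantifies over all divisors, so the places
    of the rational function field have to be classified. *)

Lemma poly_eq0_horner (p : {poly algC}) : (forall x, p.[x] = 0) -> p = 0.
Proof.
move=> p0; apply/eqP/negPn/negP=> np.
pose s : seq algC := [seq i%:R | i <- iota 0 (size p)].
have us : uniq s.
  by rewrite map_inj_uniq ?iota_uniq // => i j /eqP; rewrite eqr_nat => /eqP.
suff: (size s < size p)%N by rewrite size_map size_iota ltnn.
by apply: max_poly_roots => //; apply/allP=> x _; apply/rootP.
Qed.

(** With values of the binary form, conjugation is a linear substitution and infinity, the point
    [(1, 0)], is like any other; through [hform_inj] identities between conjugates become [ring]
    goals. *)
Definition hform (p : {poly algC}) (u v : algC) : algC :=
  \sum_(i < 5) p`_i * (u ^+ i * v ^+ (4 - i)).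

Lemma hformE p u v : hform p u v =
  p`_0 * v ^+ 4 + p`_1 * (u * v ^+ 3) + p`_2 * (u ^+ 2 * v ^+ 2)
  + p`_3 * (u ^+ 3 * v) + p`_4 * u ^+ 4.
Proof. by rewrite /hform !big_ord_recr big_ord0 /= !subSS !subn0; ring. Qed.

Lemma hform1 (p : {poly algC}) x : (size p <= 5)%N -> hform p x 1 = p.[x].
Proof.
move=> sp; rewrite /hform (horner_coef_wide _ sp).
by apply: eq_bigr => i _; rewrite expr1n mulr1.
Qed.

Definition quartic (c0 c1 c2 c3 c4 : algC) : {poly algC} :=
  Poly [:: c0; c1; c2; c3; c4].

Lemma quarticE c0 c1 c2 c3 c4 : quartic c0 c1 c2 c3 c4 =
  c0%:P + c1%:P * 'X + c2%:P * 'X ^+ 2 + c3%:P * 'X ^+ 3 + c4%:P * 'X ^+ 4.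
Proof. by rewrite /quartic /= !cons_poly_def; ring. Qed.

Lemma coef_quartic c0 c1 c2 c3 c4 i :
  (quartic c0 c1 c2 c3 c4)`_i = [:: c0; c1; c2; c3; c4]`_i.
Proof. by rewrite coef_Poly. Qed.

Lemma form4_linear (p : {poly algC}) a b c d :
  form4 p (a *: 'X + b%:P) (c *: 'X + d%:P) =
  quartic
   (p`_0 * d ^+ 4 + p`_1 * b * d ^+ 3 + p`_2 * b ^+ 2 * d ^+ 2
    + p`_3 * b ^+ 3 * d + p`_4 * b ^+ 4)
   (4 * p`_0 * c * d ^+ 3 + p`_1 * (a * d ^+ 3 + 3 * b * c * d ^+ 2)
    + p`_2 * (2 * a * b * d ^+ 2 + 2 * b ^+ 2 * c * d)
    + p`_3 * (3 * a * b ^+ 2 * d + b ^+ 3 * c) + 4 * p`_4 * a * b ^+ 3)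
   (6 * p`_0 * c ^+ 2 * d ^+ 2
    + p`_1 * (3 * a * c * d ^+ 2 + 3 * b * c ^+ 2 * d)
    + p`_2 * (a ^+ 2 * d ^+ 2 + 4 * a * b * c * d + b ^+ 2 * c ^+ 2)
    + p`_3 * (3 * a ^+ 2 * b * d + 3 * a * b ^+ 2 * c)
    + 6 * p`_4 * a ^+ 2 * b ^+ 2)
   (4 * p`_0 * c ^+ 3 * d + p`_1 * (3 * a * c ^+ 2 * d + b * c ^+ 3)
    + p`_2 * (2 * a ^+ 2 * c * d + 2 * a * b * c ^+ 2)
    + p`_3 * (a ^+ 3 * d + 3 * a ^+ 2 * b * c) + 4 * p`_4 * a ^+ 3 * b)
   (p`_0 * c ^+ 4 + p`_1 * a * c ^+ 3 + p`_2 * a ^+ 2 * c ^+ 2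
    + p`_3 * a ^+ 3 * c + p`_4 * a ^+ 4).
Proof.
rewrite quarticE /form4 !big_ord_recr big_ord0 /= !subSS !subn0 -!mul_polyC.
by ring.
Qed.

Lemma size_form4 p a b c d :
  (size (form4 p (a *: 'X + b%:P) (c *: 'X + d%:P)) <= 5)%N.
Proof. by rewrite form4_linear; apply: (leq_trans (size_Poly _)). Qed.

Lemma hform_form4 p a b c d u v :
  hform (form4 p (a *: 'X + b%:P) (c *: 'X + d%:P)) u v =
  hform p (a * u + b * v) (c * u + d * v).
Proof. by rewrite form4_linear !hformE !coef_quartic /=; ring. Qed.

Lemma hformZ c p u v : hform (c *: p) u v = c * hform p u v.
Proof. by rewrite !hformE !coefZ; ring. Qed.

Lemma hformB p q u v : hform (p - q) u v = hform p u v - hform q u v.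
Proof. by rewrite !hformE !coefB; ring. Qed.

Lemma hform_scale p t u v : hform p (t * u) (t * v) = t ^+ 4 * hform p u v.
Proof. by rewrite !hformE; ring. Qed.

Lemma hform_inj (p q : {poly algC}) : (size p <= 5)%N -> (size q <= 5)%N ->
  (forall u v, hform p u v = hform q u v) -> p = q.
Proof.
move=> sp sq e; apply/eqP; rewrite -subr_eq0; apply/eqP.
by apply: poly_eq0_horner => x; rewrite hornerD hornerN -!hform1 // e subrr.
Qed.

Definition det2 (A : 'M[algC]_2) := A 0 0 * A 1 1 - A 0 1 * A 1 0.

Lemma det2E A : \det A = det2 A.
Proof.
rewrite (expand_det_row _ ord0) !big_ord_recl big_ord0 /cofactor !det_mx11 !mxE /=.
rewrite /det2 !expr0 /bump /= expr1 mul1r mulN1r mulrN addr0.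
by congr (_ * A _ _ - A _ _ * A _ _); apply: val_inj.
Qed.

Lemma unitmx2E A : (A \in unitmx) = (det2 A != 0).
Proof. by rewrite unitmxE det2E unitfE. Qed.

Lemma mulmx2E (A B : 'M[algC]_2) i j : (A *m B) i j = A i 0 * B 0 j + A i 1 * B 1 j.
Proof. by rewrite mxE !big_ord_recl big_ord0 addr0; congr (_ + A _ _ * B _ _);
  apply: val_inj. Qed.

Lemma matrix2P (A B : 'M[algC]_2) :
  A 0 0 = B 0 0 -> A 0 1 = B 0 1 -> A 1 0 = B 1 0 -> A 1 1 = B 1 1 -> A = B.
Proof.
move=> e00 e01 e10 e11; apply/matrixP=> i j.
have I2 (k : 'I_2) : k = 0 \/ k = 1.
  by case: k => [[|[|k]] lk]; [left|right|]; try exact: val_inj.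
by case: (I2 i) => ->; case: (I2 j) => ->.
Qed.

Definition mx2 (a b c d : algC) : 'M[algC]_2 :=
  \matrix_(i, j) if i == 0 then (if j == 0 then a else b)
                 else (if j == 0 then c else d).

Lemma mx2E a b c d : (mx2 a b c d 0 0 = a) * (mx2 a b c d 0 1 = b) *
  (mx2 a b c d 1 0 = c) * (mx2 a b c d 1 1 = d).
Proof. by rewrite !mxE. Qed.

Lemma hform_conj1 A f u v : hform (conj_map A f).1 u v =
  A 1 1 * hform f.1 (A 0 0 * u + A 0 1 * v) (A 1 0 * u + A 1 1 * v)
  - A 0 1 * hform f.2 (A 0 0 * u + A 0 1 * v) (A 1 0 * u + A 1 1 * v).
Proof. by rewrite /conj_map /= hformB !hformZ !hform_form4. Qed.

Lemma hform_conj2 A f u v : hform (conj_map A f).2 u v =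
  A 0 0 * hform f.2 (A 0 0 * u + A 0 1 * v) (A 1 0 * u + A 1 1 * v)
  - A 1 0 * hform f.1 (A 0 0 * u + A 0 1 * v) (A 1 0 * u + A 1 1 * v).
Proof. by rewrite /conj_map /= hformB !hformZ !hform_form4. Qed.

Lemma size_lin_comb4 (a b : algC) (p q : {poly algC}) :
  (size p <= 5)%N -> (size q <= 5)%N -> (size (a *: p - b *: q)%R <= 5)%N.
Proof.
move=> sp sq; apply: (leq_trans (size_polyD _ _)); rewrite size_polyN geq_max.
by rewrite !(leq_trans (size_scale_leq _ _)).
Qed.

Lemma size_conj A f :
  (size (conj_map A f).1 <= 5)%N /\ (size (conj_map A f).2 <= 5)%N.
Proof. by split; apply: size_lin_comb4; apply: size_form4. Qed.

Lemma hform_infinity p u : hform p u 0 = p`_4 * u ^+ 4.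
Proof. by rewrite hformE; ring. Qed.

Lemma size_le4 (p : {poly algC}) : (size p <= 5)%N -> p`_4 = 0 -> (size p <= 4)%N.
Proof.
move=> sp p4; apply/leq_sizeP => j; rewrite leq_eqVlt => /orP[/eqP <- //|lj].
by rewrite nth_default // (leq_trans sp).
Qed.

(** Coprimality excludes common zeros with [v != 0] and the degree condition excludes the one at
    infinity, so both merge into a condition on forms that every invertible substitution
    preserves. *)
Lemma Rat4P f : Rat4 f <->
  [/\ (size f.1 <= 5)%N, (size f.2 <= 5)%N
    & forall u v, hform f.1 u v = 0 -> hform f.2 u v = 0 -> u = 0 /\ v = 0].
Proof.
split=> [[co mx]|[s1 s2 nz]].
  have s1 : (size f.1 <= 5)%N by rewrite -mx leq_maxl.
  have s2 : (size f.2 <= 5)%N by rewrite -mx leq_maxr.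
  split=> // u v; have [->|nv] := eqVneq v 0.
    rewrite !hform_infinity => /eqP + /eqP; rewrite !(expf_eq0, mulf_eq0) /=.
    case: (eqVneq u 0) => //= _; rewrite !orbF => /eqP e1 /eqP e2.
    have : (maxn (size f.1) (size f.2) <= 4)%N by rewrite geq_max !size_le4.
    by rewrite mx.
  have -> : u = v * (u / v) by rewrite mulrC divfK.
  rewrite -[X in hform _ _ X]mulr1 -[X in hform f.2 _ X]mulr1 !hform_scale !hform1 //.
  move=> /eqP + /eqP; rewrite !(expf_eq0, mulf_eq0) (negPf nv) /= => r1 r2.
  have : root (gcdp f.1 f.2) (u / v) by rewrite root_gcd /root r1 r2.
  move: co; rewrite /coprimep size_poly_eq1 => /eqp_root ->.
  by rewrite /root hornerC oner_eq0.
have co : coprimep f.1 f.2.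
  apply/negPn/negP => nco.
  have [x] : exists x, root (gcdp f.1 f.2) x.
    by apply/closed_rootP; rewrite /coprimep in nco.
  rewrite root_gcd => /andP[/rootP r1 /rootP r2].
  have [] := nz x 1; rewrite ?hform1 // => _ /eqP.
  by rewrite oner_eq0.
split=> //; apply/eqP; rewrite eqn_leq geq_max s1 s2 /= leqNgt; apply/negP.
rewrite gtn_max !ltnS => /andP[l1 l2].
have [] := nz 1 0; rewrite ?hform_infinity ?nth_default ?mul0r // => /eqP.
by rewrite oner_eq0.
Qed.

Lemma unitmx2_eq0 (A : 'M[algC]_2) u v : A \in unitmx ->
  A 0 0 * u + A 0 1 * v = 0 -> A 1 0 * u + A 1 1 * v = 0 -> u = 0 /\ v = 0.
Proof.
rewrite unitmx2E => nA e1 e2.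
have eu : det2 A * u = A 1 1 * (A 0 0 * u + A 0 1 * v) - A 0 1 * (A 1 0 * u + A 1 1 * v).
  by rewrite /det2; ring.
have ev : det2 A * v = A 0 0 * (A 1 0 * u + A 1 1 * v) - A 1 0 * (A 0 0 * u + A 0 1 * v).
  by rewrite /det2; ring.
move: eu ev; rewrite e1 e2 !mulr0 subrr => /eqP + /eqP.
by rewrite !mulf_eq0 (negPf nA) /= => /eqP-> /eqP->.
Qed.

Lemma Rat4_conj A f : A \in unitmx -> Rat4 f -> Rat4 (conj_map A f).
Proof.
move=> uA /Rat4P[s1 s2 nz]; have [t1 t2] := size_conj A f.
apply/Rat4P; split=> // u v; rewrite hform_conj1 hform_conj2.
set F := hform f.1 _ _; set G := hform f.2 _ _ => e1 e2.
have nA := uA; rewrite unitmx2E in nA.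
have eF : det2 A * F = A 0 0 * (A 1 1 * F - A 0 1 * G) + A 0 1 * (A 0 0 * G - A 1 0 * F).
  by rewrite /det2; ring.
have eG : det2 A * G = A 1 0 * (A 1 1 * F - A 0 1 * G) + A 1 1 * (A 0 0 * G - A 1 0 * F).
  by rewrite /det2; ring.
move: eF eG; rewrite e1 e2 !mulr0 addr0 => /eqP + /eqP.
rewrite !mulf_eq0 (negPf nA) /= => /eqP F0 /eqP G0.
by have [] := nz _ _ F0 G0; apply: unitmx2_eq0.
Qed.

(** By coprimality each numerator divides the other, hence they differ by a constant. *)
Lemma same_map_scale f g : Rat4 f -> Rat4 g -> same_map f g ->
  exists2 c, c != 0 & g.1 = c *: f.1 /\ g.2 = c *: f.2.
Proof.
move=> Rf Rg fg; have [cf mf] := Rf; have [cg mg] := Rg.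
have nf1 : f.1 != 0.
  apply: contra_eq_neq mf => f10; move: cf; rewrite f10 coprime0p -size_poly_eq1.
  by rewrite size_poly0 max0n => /eqP ->.
have nf2 h : Rat4 h -> h.1 != 0 -> h.2 != 0.
  case=> ch mh _; apply: contra_eq_neq mh => h20; move: ch.
  by rewrite h20 coprimep0 -size_poly_eq1 size_poly0 maxn0 => /eqP ->.
have d1 : f.1 %| g.1.
  by rewrite -(Gauss_dvdpl _ cf) -fg dvdp_mulr.
have d2 : g.1 %| f.1.
  by rewrite -(Gauss_dvdpl _ cg) fg dvdp_mulr.
have /eqpP[[c1 c2] /= /andP[n1 n2] e] : f.1 %= g.1 by rewrite /eqp d1 d2.
have e1 : g.1 = (c1 / c2) *: f.1.
  by rewrite mulrC -scalerA e scalerA mulVf // scale1r.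
exists (c1 / c2); first by rewrite mulf_neq0 ?invr_neq0.
split=> //; apply: (mulfI nf1); rewrite fg e1.
by rewrite -scalerAl -scalerAr.
Qed.

Lemma same_map_of_scale f g c : g.1 = c *: f.1 -> g.2 = c *: f.2 -> same_map f g.
Proof. by rewrite /same_map => -> ->; rewrite -scalerAl -scalerAr. Qed.

Lemma conj_mapM A B f : conj_map (A *m B) f = conj_map B (conj_map A f).
Proof.
have [s1 s2] := size_conj (A *m B) f; have [t1 t2] := size_conj B (conj_map A f).
rewrite [LHS]surjective_pairing [RHS]surjective_pairing; congr pair;
  apply: hform_inj => // u v.
  rewrite !(hform_conj1, hform_conj2) !mulmx2E.
  rewrite (_ : _ * u + _ * v = A 0 0 * (B 0 0 * u + B 0 1 * v) + A 0 1 * (B 1 0 * u + B 1 1 *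
    v)); last by ring.
  rewrite (_ : (A 1 0 * B 0 0 + A 1 1 * B 1 0) * u + _ * v = A 1 0 * (B 0 0 * u + B 0 1 * v) +
    A 1 1 * (B 1 0 * u + B 1 1 * v)); last by ring.
  by ring.
rewrite !(hform_conj1, hform_conj2) !mulmx2E.
rewrite (_ : _ * u + _ * v = A 0 0 * (B 0 0 * u + B 0 1 * v) + A 0 1 * (B 1 0 * u + B 1 1 *
  v)); last by ring.
rewrite (_ : (A 1 0 * B 0 0 + A 1 1 * B 1 0) * u + _ * v = A 1 0 * (B 0 0 * u + B 0 1 * v) + A
  1 1 * (B 1 0 * u + B 1 1 * v)); last by ring.
by ring.
Qed.

(** * Fixed points and multipliers *)

(* The trace of the differential of the lift [(F, G)].  At a fixed point it is
   [(l + 4) m], where [m] is the eigenvalue on the fixed line and [l] the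
   multiplier, since the differential is [4 m] on that line (Euler). *)
Definition tform (f : ratmap) (u v : algC) : algC :=
  f.1`_1 * v ^+ 3 + 2 * f.1`_2 * u * v ^+ 2 + 3 * f.1`_3 * u ^+ 2 * v
  + 4 * f.1`_4 * u ^+ 3
  + (4 * f.2`_0 * v ^+ 3 + 3 * f.2`_1 * u * v ^+ 2 + 2 * f.2`_2 * u ^+ 2 * v
     + f.2`_3 * u ^+ 3).

(** The lift of the conjugate is the adjugate of [A] after [(F, G)] after [A]; as the adjugate is
    [det2 A] times the inverse, the traces of the differentials agree up to that factor. *)
Lemma tform_conj A f u v : tform (conj_map A f) u v =
  det2 A * tform f (A 0 0 * u + A 0 1 * v) (A 1 0 * u + A 1 1 * v).
Proof.
rewrite /tform /conj_map /= !coefB !coefZ !form4_linear !coef_quartic /= /det2.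
by ring.
Qed.

Lemma tform_scale_map (k : algC) f g u v : g.1 = k *: f.1 -> g.2 = k *: f.2 ->
  tform g u v = k * tform f u v.
Proof. by rewrite /tform => -> ->; rewrite !coefZ; ring. Qed.

(** [m] is the factor by which the lift stretches the fixed vector [(u, v)]. Only homogeneous data
    enter, so infinity is not special and multipliers pass through a conjugacy without the chain
    rule. *)
Definition has_mult (f : ratmap) (u v l : algC) : Prop :=
  exists m, [/\ m != 0, hform f.1 u v = m * u, hform f.2 u v = m * v
              & tform f u v = (l + 4) * m].

Lemma has_mult_uniq f u v l l' : (u != 0) || (v != 0) ->
  has_mult f u v l -> has_mult f u v l' -> l = l'.
Proof.
move=> nz [m [nm F G T]] [m' [nm' F' G' T']].
have e : m = m'.
  by case/orP: nz => nz; apply: (mulIf nz); rewrite -?F -?F' -?G -?G'.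
apply: (addIr 4); apply: (mulIf nm).
by rewrite -T T' e.
Qed.

Lemma has_mult_scale f u v l t : t != 0 ->
  has_mult f u v l -> has_mult f (t * u) (t * v) l.
Proof.
move=> nt [m [nm F G T]]; exists (t ^+ 3 * m); split.
- by rewrite mulf_neq0 ?expf_neq0.
- by rewrite hform_scale F; ring.
- by rewrite hform_scale G; ring.
by rewrite mulrCA -T /tform; ring.
Qed.

Lemma has_mult_conj A f g k u v l : A \in unitmx -> k != 0 ->
  g.1 = k *: (conj_map A f).1 -> g.2 = k *: (conj_map A f).2 ->
  has_mult f (A 0 0 * u + A 0 1 * v) (A 1 0 * u + A 1 1 * v) l ->
  has_mult g u v l.
Proof.
rewrite unitmx2E => nA nk e1 e2 [m [nm F G T]]; exists (k * det2 A * m); split.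
- by rewrite !mulf_neq0.
- by rewrite e1 hformZ hform_conj1 F G /det2; ring.
- by rewrite e2 hformZ hform_conj2 F G /det2; ring.
by rewrite (tform_scale_map _ _ e1 e2) tform_conj T; ring.
Qed.

Definition fixform (f : ratmap) (u v : algC) : algC :=
  v * hform f.1 u v - u * hform f.2 u v.

Lemma fixform_conj A f g k u v :
  g.1 = k *: (conj_map A f).1 -> g.2 = k *: (conj_map A f).2 ->
  fixform g u v = k * fixform f (A 0 0 * u + A 0 1 * v) (A 1 0 * u + A 1 1 * v).
Proof.
rewrite /fixform => -> ->; rewrite !hformZ hform_conj1 hform_conj2; ring.
Qed.

Definition pt1 (Q : option algC) : algC := if Q is Some z then z else 1.
Definition pt2 (Q : option algC) : algC := if Q is Some _ then 1 else 0.
Definition lin (Q : option algC) (u v : algC) : algC :=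
  if Q is Some z then u - z * v else v.

Lemma multiplierP f Q : Rat4 f -> fixform f (pt1 Q) (pt2 Q) = 0 ->
  has_mult f (pt1 Q) (pt2 Q) (multiplier f Q).
Proof.
move=> /Rat4P[s1 s2 nz]; case: Q => [z|] /=; rewrite /fixform.
  rewrite !hform1 // mul1r => /eqP; rewrite subr_eq0 => /eqP e.
  have n2 : f.2.[z] != 0.
    apply/negP=> /eqP z2; have [] := nz z 1; rewrite ?hform1 ?z2 // ?e ?z2 ?mulr0 //.
    by move=> _ /eqP; rewrite oner_eq0.
  exists f.2.[z]; split; rewrite ?hform1 ?mulr1 //; first by rewrite e mulrC.
  (* Euler's identity for the degree 4 form of [f.2] gives its derivative in the second variable at
     [(z, 1)] as [4 q - z q']. *)
  have -> : tform f z 1 = (f.1^`()).[z] + 4 * f.2.[z] - z * (f.2^`()).[z].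
    have sd (p : {poly algC}) : (size p <= 5)%N -> (size p^`() <= 5)%N.
      by move=> sp; apply: leq_trans (size_poly _ _) (leq_trans (leq_pred _) sp).
    rewrite -[f.2.[z]]hform1 // -[(f.1^`()).[z]]hform1 ?sd // -[(f.2^`()).[z]]hform1 ?sd //.
    rewrite !hformE /tform !coef_deriv !(nth_default _ s1) !(nth_default _ s2).
    by ring.
  rewrite /deriv_at !(hornerD, hornerM, hornerN) e.
  by field.
rewrite mul0r sub0r mul1r hform_infinity expr1n mulr1 => /eqP; rewrite oppr_eq0 => /eqP q4.
have n4 : f.1`_4 != 0.
  apply/negP=> /eqP p4; have [] := nz 1 0; rewrite ?hform_infinity ?p4 ?q4 ?mul0r //.
  by move=> /eqP; rewrite oner_eq0.
exists f.1`_4; split; rewrite ?hform_infinity ?q4 //; first by ring.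
  by ring.
rewrite /tform /deriv_at /flip /= !(hornerD, hornerM, hornerN) !horner_coef0.
rewrite !coef_deriv /rev4 !coef_poly /= q4 !subSS !subn0.
by field.
Qed.

(** The point that [A] sends to [Q], as the root of the linear form [lin Q] composed with [A]; if
    the leading coefficient [a] vanishes, this root is infinity. *)
Definition pull (A : 'M[algC]_2) (Q : option algC) : option algC :=
  let a := if Q is Some z then A 0 0 - z * A 1 0 else A 1 0 in
  let b := if Q is Some z then A 0 1 - z * A 1 1 else A 1 1 in
  if a == 0 then None else Some (- b / a).

Lemma lin_pull A Q : A \in unitmx -> exists2 c, c != 0 & forall u v,
  lin Q (A 0 0 * u + A 0 1 * v) (A 1 0 * u + A 1 1 * v) = c * lin (pull A Q) u v.
Proof.
rewrite unitmx2E /pull => nA.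
set a := if Q is Some z then _ else _; set b := if Q is Some z then A 0 1 - _ else _.
have e u v : lin Q (A 0 0 * u + A 0 1 * v) (A 1 0 * u + A 1 1 * v) = a * u + b * v.
  by rewrite /a /b; case: Q {a b} => [z|] /=; ring.
case: ifPn => [/eqP a0|na].
  exists b => [|u v]; last by rewrite e a0 mul0r add0r.
  apply: contraNneq nA => b0; rewrite /det2; move: a0 b0 {e}; rewrite /a /b.
  case: Q {a b} => [z|]; last by move=> -> ->; rewrite !mulr0 subr0.
  by move=> /eqP + /eqP; rewrite !subr_eq0 => /eqP-> /eqP->; apply/eqP; ring.
by exists a => // u v; rewrite e /=; field.
Qed.

Lemma lin_pt Q : lin Q (pt1 Q) (pt2 Q) = 0.
Proof. by case: Q => [z|] //=; rewrite mulr1 subrr. Qed.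

Lemma lin_eq0 Q u v : lin Q u v = 0 -> (u != 0) || (v != 0) ->
  exists2 t, t != 0 & u = t * pt1 Q /\ v = t * pt2 Q.
Proof.
case: Q => [z|] /=.
  move=> /eqP; rewrite subr_eq0 => /eqP -> nz.
  exists v; last by rewrite mulrC mulr1.
  by apply: contraTneq nz => ->; rewrite mulr0 eqxx.
by move=> ->; rewrite eqxx orbF => nu; exists u => //; rewrite mulr1 mulr0.
Qed.

Lemma pt_neq0 Q : (pt1 Q != 0) || (pt2 Q != 0).
Proof. by case: Q => [z|] /=; rewrite oner_eq0 ?orbT. Qed.

Lemma pt_pull A Q : A \in unitmx -> exists2 t, t != 0 &
  A 0 0 * pt1 (pull A Q) + A 0 1 * pt2 (pull A Q) = t * pt1 Q /\
  A 1 0 * pt1 (pull A Q) + A 1 1 * pt2 (pull A Q) = t * pt2 Q.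
Proof.
move=> uA; have [c nc e] := lin_pull Q uA.
apply: lin_eq0; first by rewrite e lin_pt mulr0.
apply: contraT; rewrite negb_or !negbK => /andP[/eqP e1 /eqP e2].
have [z1 z2] := unitmx2_eq0 uA e1 e2.
by have := pt_neq0 (pull A Q); rewrite z1 z2 eqxx.
Qed.

Lemma fix_poly_neq0 f : Rat4 f -> f.1 - 'X * f.2 != 0.
Proof.
move=> [co mx]; rewrite subr_eq0; apply/negP => /eqP e.
move: co mx; rewrite e coprimepMl coprimepp => /andP[_ /eqP s2].
have n2 : f.2 != 0 by rewrite -size_poly_eq0 s2.
by rewrite mulrC size_mulX // s2.
Qed.

Lemma poly_rootsP (p : {poly algC}) :
  p = lead_coef p *: \prod_(z <- poly_roots p) ('X - z%:P).
Proof. by rewrite /poly_roots; case: closed_field_poly_normal. Qed.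

Lemma size_fix_poly f : Rat4 f -> (size (f.1 - 'X * f.2)%R <= 6)%N.
Proof.
move=> /Rat4P[s1 s2 _]; apply: (leq_trans (size_polyD _ _)).
rewrite size_polyN geq_max (leq_trans s1) //=.
by apply: (leq_trans (size_polyMleq _ _)); rewrite size_polyX.
Qed.

Lemma size_poly_roots (p : {poly algC}) : p != 0 -> size p = (size (poly_roots p)).+1.
Proof.
by move=> np; rewrite {1}(poly_rootsP p) size_scale ?lead_coef_eq0 // size_prod_XsubC.
Qed.

Lemma size_fixed_points f : Rat4 f -> size (fixed_points f) = 5%N.
Proof.
move=> Rf; rewrite size_cat size_map size_nseq subnKC //.
by rewrite -ltnS -size_poly_roots ?fix_poly_neq0 ?size_fix_poly.
Qed.

(** The factorization of [f.1 - 'X * f.2] is homogenized to degree 5: each missing degree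
    contributes a factor [v], the linear form of the point [None]. *)
Lemma fixform_factor f : Rat4 f -> exists2 c, c != 0 & forall u v,
  fixform f u v = c * \prod_(Q <- fixed_points f) lin Q u v.
Proof.
move=> Rf; have np := fix_poly_neq0 Rf; have sp := size_fix_poly Rf.
have sr := size_poly_roots np; have pr := poly_rootsP (f.1 - 'X * f.2).
have /Rat4P[s1 s2 _] := Rf.
rewrite /fixed_points; set p := _ - _ in np sp sr pr *.
exists (lead_coef p) => [|u v]; first by rewrite lead_coef_eq0.
rewrite big_cat big_map big_nseq iter_mulr_1 /=.
set r := poly_roots p in sr pr *.
have [->|nv] := eqVneq v 0.
  rewrite /fixform !hform_infinity mul0r sub0r.
  rewrite (eq_bigr (fun=> u)) => [|z _]; last by rewrite mulr0 subr0.
  rewrite big_const_seq count_predT iter_mulr_1.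
  have p5 : p`_5 = - f.2`_4 by rewrite coefB coefXM /= (nth_default _ s1) sub0r.
  move: sp; rewrite sr leq_eqVlt => /orP[/eqP[e]|l].
    by rewrite lead_coefE sr e /= p5 subnn expr0; ring.
  rewrite -(opprK f.2`_4) -p5 nth_default ?sr // oppr0 mul0r mulr0 oppr0.
  by rewrite expr0n subn_eq0 leqNgt -ltnS l !mulr0.
rewrite (_ : fixform f u v = v ^+ 5 * p.[u / v]).
  rewrite [in LHS]pr hornerZ horner_prod mulrCA; congr (_ * _).
  have lr : (size r <= 5)%N by rewrite -ltnS -sr.
  rewrite -[in LHS](subnKC lr) exprD mulrAC; congr (_ * _).
  elim: (r) => [|z l IH]; first by rewrite !big_nil expr0 mulr1.
  rewrite !big_cons -IH /= exprS hornerXsubC.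
  have -> : u - z * v = v * (u / v - z) by rewrite mulrBr mulrCA divff // mulr1 mulrC.
  by rewrite !mulrA; congr (_ * _); ring.
rewrite /p hornerD hornerN hornerM hornerX /fixform.
have : u = v * (u / v) by rewrite mulrC divfK.
move: (u / v) => x eu; rewrite [in LHS]eu.
rewrite -[X in hform _ _ X]mulr1 -[X in hform f.2 _ X]mulr1 !hform_scale !hform1 //.
by ring.
Qed.

Lemma perm_option (T : eqType) (s : seq (option T)) :
  perm_eq s ([seq Some z | z <- pmap id s] ++ nseq (size s - size (pmap id s)) None).
Proof.
elim: s => //= [[x|] s IH] /=; first by rewrite perm_cons subSS.
have l : (size (pmap id s) <= size s)%N by rewrite size_pmap count_size.
rewrite subSn //= perm_sym -cat1s perm_catCA perm_sym.
by rewrite perm_cons.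
Qed.

(** Setting [v = 1] recovers the factorization into linear polynomials, hence the finite points with
    multiplicity; the total of five fixes the number of points at infinity. Fixed points of the
    families are found by exhibiting such a factorization. *)
Lemma fixed_points_uniq f s c : Rat4 f -> size s = 5%N -> c != 0 ->
  (forall u v, fixform f u v = c * \prod_(Q <- s) lin Q u v) ->
  perm_eq (fixed_points f) s.
Proof.
move=> Rf s5 nc e; have /Rat4P[s1 s2 _] := Rf.
have ep : f.1 - 'X * f.2 = c *: \prod_(z <- pmap id s) ('X - z%:P).
  apply/eqP; rewrite -subr_eq0; apply/eqP; apply: poly_eq0_horner => x.
  rewrite hornerD hornerN [X in X - _](_ : _ = fixform f x 1).
    rewrite e hornerZ -mulrBr horner_prod big_pmap.
    rewrite (eq_bigr (fun Q => oapp (fun z => ('X - z%:P).[x]) 1 Q)) ?subrr ?mulr0 //.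
    by case=> [z|] _ //=; rewrite hornerXsubC mulr1.
  by rewrite /fixform !hform1 // mul1r hornerD hornerN hornerM hornerX.
have pe : perm_eq (poly_roots (f.1 - 'X * f.2)) (pmap id s).
  have := poly_rootsP (f.1 - 'X * f.2); rewrite {1}ep.
  have -> : lead_coef (f.1 - 'X * f.2) = c.
    by rewrite ep lead_coefZ (monicP (monic_prod_XsubC _ _ _)) mulr1.
  by move/(scalerI nc)/prod_XsubC_eq; rewrite perm_sym.
rewrite perm_sym (perm_trans (perm_option s)) // perm_sym /fixed_points s5.
by rewrite (perm_size pe) perm_cat2r perm_map.
Qed.

(** Substituting [A] into the factored fixed point form of [f] factors that of [g], with every point
    pulled back; uniqueness of the factorization takes care of multiplicities. *)
Lemma perm_multipliers f g A : Rat4 f -> Rat4 g -> A \in unitmx ->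
  same_map (conj_map A f) g -> perm_eq (multipliers g) (multipliers f).
Proof.
move=> Rf Rg uA fg.
have [k nk [e1 e2]] := same_map_scale (Rat4_conj uA Rf) Rg fg.
have [c nc ec] := fixform_factor Rf.
have [d nd ed] : exists2 d, d != 0 & forall u v,
    \prod_(Q <- fixed_points f) lin Q (A 0 0 * u + A 0 1 * v) (A 1 0 * u + A 1 1 * v)
    = d * \prod_(Q <- fixed_points f) lin (pull A Q) u v.
  elim: (fixed_points f) => [|Q s [d nd IH]].
    by exists 1 => [|u v]; rewrite ?oner_eq0 // !big_nil mulr1.
  have [t nt et] := lin_pull Q uA.
  by exists (t * d) => [|u v]; rewrite ?mulf_neq0 // !big_cons IH et mulrACA.
have pf : perm_eq (fixed_points g) (map (pull A) (fixed_points f)).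
  apply: (@fixed_points_uniq _ _ (k * c * d)) => [//|||u v].
  - by rewrite size_map size_fixed_points.
  - by rewrite !mulf_neq0.
  by rewrite (fixform_conj _ _ e1 e2) ec ed big_map !mulrA.
rewrite /multipliers (perm_trans (perm_map _ pf)) // -map_comp.
rewrite (@eq_in_map _ _ _ (multiplier f) _).1 ?perm_refl // => Q Qf /=.
have fQ : fixform f (pt1 Q) (pt2 Q) = 0.
  by rewrite ec (big_rem _ Qf) /= lin_pt mul0r mulr0.
have [t nt [t1 t2]] := pt_pull Q uA.
apply: (has_mult_uniq (pt_neq0 (pull A Q))); last first.
  apply: (has_mult_conj uA nk e1 e2); rewrite t1 t2.
  exact: has_mult_scale nt (multiplierP Rf fQ).
apply: multiplierP => //; rewrite (fixform_conj _ _ e1 e2) t1 t2 /fixform.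
rewrite !hform_scale; move: fQ; rewrite /fixform => fQ.
by transitivity (k * t ^+ 5 * (pt2 Q * hform f.1 (pt1 Q) (pt2 Q) - pt1 Q * hform f.2 (pt1 Q)
  (pt2 Q))); [ring|rewrite fQ mulr0].
Qed.

(** * Multipliers of the families *)

Local Arguments multiplier : simpl never.

Lemma sigma1_perm f s i : size s = 5%N -> perm_eq (multipliers f) s -> (i <= 5)%N ->
  sigma1 i f = (-1) ^+ i * (\prod_(l <- s) ('X - l%:P))`_(5 - i).
Proof.
move=> s5 ps li; have m5 : size (multipliers f) == 5%N by rewrite (perm_size ps) s5.
rewrite -(perm_big _ ps) /=.
have := @mroots_coeff _ 5 (Tuple m5) (Ordinal (li : (i < 6)%N)).
rewrite /= => ->; rewrite mulrA -exprMn mulrNN mulr1 expr1n mul1r /sigma1.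
by apply: meval_eq => j; rewrite (tnth_nth 0).
Qed.

Definition esym5 (a b c d e : algC) (i : nat) : algC :=
  [:: 1; a + b + c + d + e;
    a * b + a * c + a * d + a * e + b * c + b * d + b * e + c * d + c * e + d * e;
    a * b * c + a * b * d + a * b * e + a * c * d + a * c * e + a * d * e
    + b * c * d + b * c * e + b * d * e + c * d * e;
    a * b * c * d + a * b * c * e + a * b * d * e + a * c * d * e + b * c * d * e;
    a * b * c * d * e]`_i.

Lemma sigma1_esym5 f a b c d e i : perm_eq (multipliers f) [:: a; b; c; d; e] ->
  (i <= 5)%N -> sigma1 i f = esym5 a b c d e i.
Proof.
move=> ps li; rewrite (sigma1_perm _ ps) //.
have -> : \prod_(l <- [:: a; b; c; d; e]) ('X - l%:P) =
    Poly [:: - esym5 a b c d e 5; esym5 a b c d e 4; - esym5 a b c d e 3;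
             esym5 a b c d e 2; - esym5 a b c d e 1; 1].
  by rewrite !big_cons big_nil /= !cons_poly_def /esym5 /=; ring.
rewrite coef_Poly; case: i li => [|[|[|[|[|[|]]]]]] //= _;
  rewrite ?subn0 ?subnn ?subSS /esym5 /=; ring.
Qed.

Definition fam1 (k : algC) : ratmap := ('X^4 + 1, k *: 'X^3).
Definition fam3 (k1 k2 : algC) : ratmap := ('X^4 + k1 *: 'X, k2 *: 'X^3 + 1).
Definition fam4 (k1 k2 k3 : algC) : ratmap :=
  ('X^4 + k1 *: 'X^2 + 1, k2 *: 'X^3 + k3 *: 'X).

Lemma size_quartic (c0 c1 c2 c3 c4 : algC) : (size (quartic c0 c1 c2 c3 c4) <= 5)%N.
Proof. exact: size_Poly. Qed.

Lemma hform_quartic c0 c1 c2 c3 c4 u v : hform (quartic c0 c1 c2 c3 c4) u v =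
  c0 * v ^+ 4 + c1 * (u * v ^+ 3) + c2 * (u ^+ 2 * v ^+ 2) + c3 * (u ^+ 3 * v) + c4 * u ^+ 4.
Proof. by rewrite hformE !coef_quartic. Qed.

Lemma fam1E k : fam1 k = (quartic 1 0 0 0 1, quartic 0 0 0 k 0).
Proof. by rewrite /fam1 !quarticE -!mul_polyC; congr pair; ring. Qed.

Lemma fam3E k1 k2 : fam3 k1 k2 = (quartic 0 k1 0 0 1, quartic 1 0 0 k2 0).
Proof. by rewrite /fam3 !quarticE -!mul_polyC; congr pair; ring. Qed.

Lemma fam4E k1 k2 k3 :
  fam4 k1 k2 k3 = (quartic 1 0 k1 0 1, quartic 0 k3 0 k2 0).
Proof. by rewrite /fam4 !quarticE -!mul_polyC; congr pair; ring. Qed.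

Lemma expf4_eq0 (x : algC) : x ^+ 4 = 0 -> x = 0.
Proof. by move/eqP; rewrite expf_eq0 => /eqP. Qed.

Lemma Rat4_fam1 k : k != 0 -> Rat4 (fam1 k).
Proof.
move=> nk; rewrite fam1E; apply/Rat4P; rewrite /= !size_quartic; split=> // u v.
rewrite !hform_quartic => e1 e2.
have /eqP : k * (u ^+ 3 * v) = 0 by rewrite -[RHS]e2; ring.
rewrite mulf_eq0 (negPf nk) /= mulf_eq0 expf_eq0 /= => /orP[/eqP u0|/eqP v0].
  by split=> //; apply: expf4_eq0; rewrite -[RHS]e1 u0; ring.
by split=> //; apply: expf4_eq0; rewrite -[RHS]e1 v0; ring.
Qed.

Lemma Rat4_fam3 k1 k2 : k1 * k2 != 1 -> Rat4 (fam3 k1 k2).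
Proof.
move=> nk; rewrite fam3E; apply/Rat4P; rewrite /= !size_quartic; split=> // u v.
rewrite !hform_quartic => e1 e2.
have [u0|nu] := eqVneq u 0.
  by split=> //; apply: expf4_eq0; rewrite -[RHS]e2 u0; ring.
have [v0|nv] := eqVneq v 0.
  by split=> //; apply: expf4_eq0; rewrite -[RHS]e1 v0; ring.
have /eqP : (1 - k1 * k2) * (u ^+ 4 * v ^+ 4) = 0.
  transitivity ((0 * v ^+ 4 + k1 * (u * v ^+ 3) + 0 * (u ^+ 2 * v ^+ 2) + 0 * (u ^+ 3 * v) + 1
    * u ^+ 4) * v ^+ 4 - k1 * u * v ^+ 3 * (1 * v ^+ 4 + 0 * (u * v ^+ 3) + 0 * (u ^+ 2 * v ^+
    2) + k2 * (u ^+ 3 * v) + 0 * u ^+ 4)).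
    by ring.
  by rewrite e1 e2 !mulr0 mul0r subr0.
rewrite mulf_eq0 subr_eq0 eq_sym (negPf nk) /= mulf_eq0 !expf_eq0 /=.
by rewrite (negPf nu) (negPf nv).
Qed.

Lemma Rat4_fam4 k1 k2 k3 : k2 ^+ 2 + k3 ^+ 2 != k1 * k2 * k3 -> Rat4 (fam4 k1 k2 k3).
Proof.
move=> nk; rewrite fam4E; apply/Rat4P; rewrite /= !size_quartic; split=> // u v.
rewrite !hform_quartic => e1 e2.
have [u0|nu] := eqVneq u 0.
  by split=> //; apply: expf4_eq0; rewrite -[RHS]e1 u0; ring.
have [v0|nv] := eqVneq v 0.
  by split=> //; apply: expf4_eq0; rewrite -[RHS]e1 v0; ring.
have e3 : k2 * u ^+ 2 + k3 * v ^+ 2 = 0.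
  by apply: (mulfI (mulf_neq0 nu nv)); rewrite mulr0 -[RHS]e2; ring.
have /eqP : (k2 ^+ 2 + k3 ^+ 2 - k1 * k2 * k3) * v ^+ 4 = 0.
  transitivity (k2 ^+ 2 * (1 * v ^+ 4 + 0 * (u * v ^+ 3) + k1 * (u ^+ 2 * v ^+ 2) + 0 * (u ^+
    3 * v) + 1 * u ^+ 4) - (k2 * u ^+ 2 + k3 * v ^+ 2) * (k2 * u ^+ 2 - k3 * v ^+ 2 + k1 * k2
    * v ^+ 2)).
    by ring.
  by rewrite e1 e3 mul0r mulr0 subr0.
by rewrite mulf_eq0 subr_eq0 (negPf nk) /= expf_eq0 (negPf nv).
Qed.

Lemma fixform_mult f Q l : Rat4 f -> has_mult f (pt1 Q) (pt2 Q) l -> multiplier f Q = l.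
Proof.
move=> Rf h; apply: (has_mult_uniq (pt_neq0 Q)) (h); apply: multiplierP => //.
by case: h => m [_ F G _]; rewrite /fixform F G; ring.
Qed.

(** The solution [m] of [1/(1-k1) + 1/(1-k2) + 3/(1-m) = 1], the fixed point formula. Written this
    way it also makes sense when [k1] or [k2] is 1, where it gives 1. Likewise [mult1] solves
    [1/(1-k) + 4/(1-m) = 1]. *)
Definition mult3 (k1 k2 : algC) : algC := 1 + 3 * (1 - k1) * (1 - k2) / (1 - k1 * k2).
Definition mult1 (k : algC) : algC := 4 / k - 3.

Lemma has_mult_fam3 k1 k2 u v l m : m != 0 -> 
  k1 * (u * v ^+ 3) + u ^+ 4 = m * u -> v ^+ 4 + k2 * (u ^+ 3 * v) = m * v ->
  k1 * v ^+ 3 + 4 * u ^+ 3 + 4 * v ^+ 3 + k2 * u ^+ 3 = (l + 4) * m ->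
  has_mult (fam3 k1 k2) u v l.
Proof.
move=> nm F G T; exists m; rewrite fam3E /tform /= !hform_quartic !coef_quartic /=.
by split=> //; rewrite -?F -?G -?T; ring.
Qed.

Lemma omega_exists : exists2 w : algC, 3.-primitive_root w & w ^+ 2 = - w - 1.
Proof.
have [w pw] := C_prim_root_exists (isT : (0 < 3)%N); exists w => //.
have nw : w - 1 != 0.
  by rewrite subr_eq0 -[w]expr1 -(prim_order_dvd pw).
by apply: (mulfI nw); transitivity (w ^+ 3 - w ^+ 2); [ring|rewrite (prim_expr_order pw);
  ring].
Qed.

Lemma multipliers_fam3 k1 k2 : k1 * k2 != 1 ->
  perm_eq (multipliers (fam3 k1 k2)) (k1 :: k2 :: nseq 3 (mult3 k1 k2)).
Proof.
move=> nk; have Rf := Rat4_fam3 nk.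
have nk' : 1 - k1 * k2 != 0 by rewrite subr_eq0 eq_sym.
have m0 : multiplier (fam3 k1 k2) (Some 0) = k1.
  by apply: fixform_mult => //; apply: (@has_mult_fam3 _ _ _ _ _ 1); rewrite ?oner_eq0 //=;
    ring.
have moo : multiplier (fam3 k1 k2) None = k2.
  by apply: fixform_mult => //; apply: (@has_mult_fam3 _ _ _ _ _ 1); rewrite ?oner_eq0 //=;
    ring.
have ff u v : fixform (fam3 k1 k2) u v = u * v * ((1 - k2) * u ^+ 3 - (1 - k1) * v ^+ 3).
  by rewrite /fixform fam3E /= !hform_quartic; ring.
(* For [k2 = 1] the three fixed points other than 0 and infinity merge into infinity. For [k1 = 1]
   they merge into 0, which the general case covers with [r = 0]. *)
have [k21|nk2] := eqVneq k2 1.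
  have pf : perm_eq (fixed_points (fam3 k1 k2)) [:: Some 0; None; None; None; None].
    apply: (@fixed_points_uniq _ _ (k1 - 1)) => [//|//||u v].
      by apply: contraNneq nk => /eqP; rewrite subr_eq0 k21 mulr1.
    by rewrite ff k21 !big_cons big_nil /=; ring.
  rewrite /multipliers (perm_trans (perm_map _ pf)) //= m0 moo.
  by rewrite (_ : mult3 k1 k2 = k2) ?perm_refl // /mult3 k21 subrr mulr0 mul0r addr0.
have nk2' : 1 - k2 != 0 by rewrite subr_eq0 eq_sym.
have [w pw w2] := omega_exists.
pose r := 3.-root ((1 - k1) / (1 - k2));
  have r3 : r ^+ 3 = (1 - k1) / (1 - k2) by rewrite rootCK.
have pf : perm_eq (fixed_points (fam3 k1 k2)) [:: Some 0; None; Some r; Some (w * r);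
  Some (w ^+ 2 * r)].
  apply: (@fixed_points_uniq _ _ (1 - k2)) => // u v.
  rewrite ff !big_cons big_nil /= mul0r subr0 mulr1.
  have -> : 1 - k1 = (1 - k2) * r ^+ 3 by rewrite r3 mulrC divfK.
  rewrite !w2.
  transitivity ((1 - k2) * (u * v) * ((u - r * v) * (u ^+ 2 + u * r * v - (w ^+ 2 + w) * r ^+
    2 * v ^+ 2))); last by ring.
  by rewrite w2; ring.
have mz z : z ^+ 3 = (1 - k1) / (1 - k2) -> multiplier (fam3 k1 k2) (Some z) = mult3 k1 k2.
  move=> z3; have ek1 : k1 = 1 - (1 - k2) * z ^+ 3 by rewrite z3; field.
  have en : 1 - k1 * k2 = (1 - k2) * (1 + k2 * z ^+ 3) by rewrite ek1; ring.
  have nz : 1 + k2 * z ^+ 3 != 0.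
    by apply: contraNneq nk' => z0; rewrite en z0 mulr0.
  apply: fixform_mult => //; apply: (has_mult_fam3 nz) => /=; rewrite ?expr1n ?mulr1.
  - by rewrite {1}ek1; ring.
  - by ring.
  rewrite /mult3 en {1 2}ek1; field.
  by rewrite nz nk2'.
rewrite /multipliers (perm_trans (perm_map _ pf)) //= m0 moo !mz ?perm_refl //.
  by rewrite !exprMn r3 (prim_expr_order pw) !mul1r.
by rewrite exprMn r3 (prim_expr_order pw) mul1r.
Qed.

Lemma multipliers_fam1 k : k != 0 ->
  perm_eq (multipliers (fam1 k)) (k :: nseq 4 (mult1 k)).
Proof.
move=> nk; have Rf := Rat4_fam1 nk.
have hm u v l m : m != 0 -> v ^+ 4 + u ^+ 4 = m * u -> k * (u ^+ 3 * v) = m * v ->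
    4 * u ^+ 3 + k * u ^+ 3 = (l + 4) * m -> has_mult (fam1 k) u v l.
  move=> nm F G T; exists m; rewrite fam1E /tform /= !hform_quartic !coef_quartic /=.
  by split=> //; rewrite -?F -?G -?T; ring.
have moo : multiplier (fam1 k) None = k.
  by apply: fixform_mult => //; apply: (hm _ _ _ 1); rewrite ?oner_eq0 //=; ring.
have ff u v : fixform (fam1 k) u v = v * ((1 - k) * u ^+ 4 + v ^+ 4).
  by rewrite /fixform fam1E /= !hform_quartic; ring.
(* For [k = 1] infinity is a fixed point of multiplicity five; otherwise the finite ones are the
   four fourth roots of [1 / (k - 1)]. *)
have [k1|nk1] := eqVneq k 1.
  have pf : perm_eq (fixed_points (fam1 k)) (nseq 5 None).
    apply: (@fixed_points_uniq _ _ 1) => [//|//||u v]; first exact: oner_neq0.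
    by rewrite ff k1 !big_cons big_nil /=; ring.
  rewrite /multipliers (perm_trans (perm_map _ pf)) //= moo.
  by rewrite (_ : mult1 k = k) ?perm_refl // /mult1 k1; field.
have nk1' : k - 1 != 0 by rewrite subr_eq0.
pose r := 4.-root (1 / (k - 1)); have r4 : r ^+ 4 = 1 / (k - 1) by rewrite rootCK.
have i2 := sqrCi algC.
have i4 : ('i : algC) ^+ 4 = 1 by rewrite (exprM _ 2 2) i2; ring.
have pf : perm_eq (fixed_points (fam1 k)) [:: None; Some r; Some ('i * r); Some (- r);
  Some (- 'i * r)].
  apply: (@fixed_points_uniq _ _ (1 - k)) => [//|//||u v].
    by rewrite subr_eq0 eq_sym.
  rewrite ff !big_cons big_nil /=.
  transitivity ((1 - k) * v * ((u ^+ 2 - r ^+ 2 * v ^+ 2) * (u ^+ 2 - 'i ^+ 2 * (r ^+ 2 * v ^+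
    2)))); last by ring.
  rewrite i2; transitivity (v * ((1 - k) * u ^+ 4 - (1 - k) * r ^+ 4 * v ^+ 4)); last by ring.
  by rewrite r4; field.
have mz z : z ^+ 4 = 1 / (k - 1) -> multiplier (fam1 k) (Some z) = mult1 k.
  move=> z4; have nz : z != 0.
    by apply: contraTneq nk1' => z0; rewrite -invr_eq0 -div1r -z4 z0 expr0n eqxx.
  have ez : (k - 1) * z ^+ 4 = 1 by rewrite z4; field.
  apply: fixform_mult => //; apply: (hm _ _ _ (k * z ^+ 3)) => /=.
  - by rewrite mulf_neq0 ?expf_neq0.
  - by rewrite expr1n -ez; ring.
  - by ring.
  by rewrite /mult1; field.
have mi (e : algC) : e ^+ 4 = 1 -> multiplier (fam1 k) (Some (e * r)) = mult1 k.
  by move=> e4; apply: mz; rewrite exprMn e4 r4; apply: mul1r.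
rewrite /multipliers (perm_trans (perm_map _ pf)) //= moo.
have -> : - r = -1 * r by rewrite mulN1r.
rewrite (mz r r4) (mi 'i i4) (mi (-1)) ?(mi (- 'i)) ?perm_refl //.
  by rewrite -i4; ring.
by ring.
Qed.

(** * Conjugacies between members of a family *)

(** Of five entries only one value can occur three times, so the repeated multiplier is recognizable
    in the unordered list. *)
Lemma perm_nseq3 (T : eqType) (a b m a' b' m' : T) :
  perm_eq (a :: b :: nseq 3 m) (a' :: b' :: nseq 3 m') ->
  m = m' /\ perm_eq [:: a; b] [:: a'; b'].
Proof.
move=> p; have e : m = m'.
  have := seq.permP p (pred1 m); rewrite /= eqxx; case: (eqVneq m' m) => // _.
  by case: (a == m) (b == m) (a' == m) (b' == m) => [] [] [] [].
split=> //; move: p; rewrite e -cat1s -[X in perm_eq _ X]cat1s.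
by rewrite -[b :: _]cat1s -[b' :: _]cat1s !catA perm_cat2r.
Qed.

Lemma perm_pair (T : eqType) (a b a' b' : T) : perm_eq [:: a; b] [:: a'; b'] ->
  (a = a' /\ b = b') \/ (a = b' /\ b = a').
Proof.
move=> p; have : a \in [:: a'; b'] by rewrite -(perm_mem p) inE eqxx.
rewrite !inE => /orP[] /eqP e; move: p; rewrite e.
  by rewrite perm_cons => /perm_mem/(_ b); rewrite !inE eqxx => /esym/eqP; left.
rewrite perm_sym (perm_catC [:: a'] [:: b']) perm_cons perm_sym.
by move=> /perm_mem/(_ b); rewrite !inE eqxx => /esym/eqP; right.
Qed.

Lemma conjugateI (A : 'M[algC]_2) c (f g : ratmap) : A \in unitmx ->
  (size g.1 <= 5)%N -> (size g.2 <= 5)%N ->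
  (forall u v, hform g.1 u v = c *
    (A 1 1 * hform f.1 (A 0 0 * u + A 0 1 * v) (A 1 0 * u + A 1 1 * v)
     - A 0 1 * hform f.2 (A 0 0 * u + A 0 1 * v) (A 1 0 * u + A 1 1 * v))) ->
  (forall u v, hform g.2 u v = c *
    (A 0 0 * hform f.2 (A 0 0 * u + A 0 1 * v) (A 1 0 * u + A 1 1 * v)
     - A 1 0 * hform f.1 (A 0 0 * u + A 0 1 * v) (A 1 0 * u + A 1 1 * v))) ->
  same_map (conj_map A f) g.
Proof.
move=> uA s1 s2 e1 e2; have [t1 t2] := size_conj A f.
by apply: (@same_map_of_scale _ _ c); apply: hform_inj => //;
  rewrite ?(leq_trans (size_scale_leq _ _)) // => u v;
  rewrite hformZ ?hform_conj1 ?hform_conj2.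
Qed.

Lemma conjugate_refl (f : ratmap) : (size f.1 <= 5)%N -> (size f.2 <= 5)%N -> conjugate f f.
Proof.
move=> s1 s2; exists (mx2 1 0 0 1).
  by rewrite unitmx2E /det2 !mx2E mulr1 mulr0 subr0 oner_eq0.
by apply: (@conjugateI _ 1) => [|//|//|u v|u v];
  rewrite ?unitmx2E /det2 !mx2E ?mul1r ?mul0r ?addr0 ?add0r ?subr0 ?oner_eq0.
Qed.

Lemma fam1_one_to_one : one_to_one (fun k => k != 0) fam1.
Proof.
split=> [k|k k' nk nk' [A uA kk']]; first exact: Rat4_fam1.
have := perm_multipliers (Rat4_fam1 nk) (Rat4_fam1 nk') uA kk'.
move=> p; have {}p : perm_eq (k' :: nseq 4 (mult1 k')) (k :: nseq 4 (mult1 k)).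
  by rewrite -(permPl (multipliers_fam1 nk')) (permPl p) multipliers_fam1.
(* Reading [nseq 4 m] as [m :: nseq 3 m], the leftover pairs are [k', m] and [k, m]; even matched
   crosswise they give [k' = k], both being [m]. *)
have [e] := perm_nseq3 p; rewrite e => /perm_pair[[]|[]] // -> ->.
by [].
Qed.

Lemma fam3_conj_perm k1 k2 l1 l2 : k1 * k2 != 1 -> l1 * l2 != 1 ->
  conjugate (fam3 k1 k2) (fam3 l1 l2) -> perm_eq [:: l1; l2] [:: k1; k2].
Proof.
move=> nk nl [A uA kl].
have p := perm_multipliers (Rat4_fam3 nk) (Rat4_fam3 nl) uA kl.
have [] // := @perm_nseq3 _ l1 l2 (mult3 l1 l2) k1 k2 (mult3 k1 k2) _.
by rewrite -(permPl (multipliers_fam3 nl)) (permPl p) multipliers_fam3.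
Qed.

(** Conjugation by [z -> 1 / z] exchanges 0 and infinity and with them the roles of [k1] and
    [k2]. *)
Lemma fam3_conj_swap k1 k2 : conjugate (fam3 k1 k2) (fam3 k2 k1).
Proof.
have uA : mx2 0 1 1 0 \in unitmx.
  by rewrite unitmx2E /det2 !mx2E mulr0 mulr1 sub0r oppr_eq0 oner_eq0.
exists (mx2 0 1 1 0) => //; rewrite !fam3E.
by apply: (@conjugateI _ (-1)); rewrite ?size_quartic // => u v;
  rewrite !hform_quartic !mx2E; ring.
Qed.

Lemma sq_neq1 (k : algC) : k != 1 -> k != -1 -> k * k != 1.
Proof. by move=> n1 n2; rewrite -expr2 sqrf_eq1 (negPf n1) (negPf n2). Qed.

Lemma fam2_one_to_one : one_to_one (fun k => k != 1 /\ k != -1) (fun k => fam3 k k).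
Proof.
split=> [k [n1 n2]|k k' [n1 n2] [n1' n2'] kk'].
  exact: Rat4_fam3 (sq_neq1 n1 n2).
by have := fam3_conj_perm (sq_neq1 n1 n2) (sq_neq1 n1' n2') kk' => /perm_pair[[]|[]].
Qed.

Lemma row2P (T : Type) (k l : 'rV[T]_2) : k 0 0 = l 0 0 -> k 0 1 = l 0 1 -> k = l.
Proof.
move=> e0 e1; apply/rowP => -[[|[|]] // i].
  by rewrite (_ : Ordinal i = 0) //; apply: val_inj.
by rewrite (_ : Ordinal i = 1) //; apply: val_inj.
Qed.

Lemma row3P (T : Type) (k l : 'rV[T]_3) : k 0 0 = l 0 0 -> k 0 1 = l 0 1 ->
  k 0 2 = l 0 2 -> k = l.
Proof.
move=> e0 e1 e2; apply/rowP => -[[|[|[|]]] // i].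
- by rewrite (_ : Ordinal i = 0) //; apply: val_inj.
- by rewrite (_ : Ordinal i = 1) //; apply: val_inj.
by rewrite (_ : Ordinal i = 2) //; apply: val_inj.
Qed.

Lemma fam3_two_to_one :
  two_to_one (fun k : 'rV[algC]_2 => k 0 0 * k 0 1 != 1)
             (fun k : 'rV[algC]_2 => fam3 (k 0 0) (k 0 1)).
Proof.
split=> [k|]; first exact: Rat4_fam3.
have gE (k : 'rV[algC]_2) : ('X_0 - 'X_1 : {mpoly algC[2]}).@[k ord0] = k 0 0 - k 0 1.
  by rewrite mevalB !mevalXU.
(* On the diagonal the two points of the fibre coincide. *)
exists ('X_0 - 'X_1); split.
  exists (\row_j (if j == 0 then 1 else 0)); first by rewrite !mxE mulr0 eq_sym oner_eq0.
  by rewrite gE !mxE subr0 oner_eq0.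
move=> k Dk; rewrite gE subr_eq0 => nk.
exists (\row_j (if j == 0 then k 0 1 else k 0 0)); split.
- by rewrite !mxE /= mulrC.
- by move/rowP/(_ 0); rewrite !mxE /= => e; rewrite e eqxx in nk.
move=> l; split=> [[Dl /(fam3_conj_perm Dk Dl)/perm_pair[[e1 e2]|[e1 e2]]]|[->|->]].
- by left; apply: row2P.
- by right; apply: row2P; rewrite mxE.
- by split=> //; have /Rat4P[s1 s2 _] := Rat4_fam3 Dk; apply: conjugate_refl.
by rewrite !mxE /= mulrC; split=> //; apply: fam3_conj_swap.
Qed.

Lemma has_mult_conj_inv A f g k u v l : A \in unitmx -> k != 0 ->
  g.1 = k *: (conj_map A f).1 -> g.2 = k *: (conj_map A f).2 ->
  has_mult g u v l ->
  has_mult f (A 0 0 * u + A 0 1 * v) (A 1 0 * u + A 1 1 * v) l.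
Proof.
rewrite unitmx2E => nA nk e1 e2 [m [nm]].
rewrite (tform_scale_map _ _ e1 e2) tform_conj e1 e2 !hformZ hform_conj1 hform_conj2.
set x := A 0 0 * u + _; set y := A 1 0 * u + _ => F G T.
have nz : k * det2 A != 0 by rewrite mulf_neq0.
exists (m / (k * det2 A)); split.
- by rewrite mulf_neq0 ?invr_neq0.
- apply: (mulfI nz); rewrite mulrA [_ * (m / _)]mulrC divfK //.
  transitivity (A 0 0 * (m * u) + A 0 1 * (m * v)); [by rewrite -F -G /det2;
    ring|by rewrite /x; ring].
- apply: (mulfI nz); rewrite mulrA [_ * (m / _)]mulrC divfK //.
  transitivity (A 1 0 * (m * u) + A 1 1 * (m * v)); [by rewrite -F -G /det2;
    ring|by rewrite /y; ring].
apply: (mulfI nz); rewrite mulrCA [_ * (m / _)]mulrC divfK //.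
by rewrite -T mulrA.
Qed.

(** * The odd family: maps commuting with z -> -z *)

Section OddFamily.
Variables k1 k2 k3 : algC.
Let f := fam4 k1 k2 k3.

Lemma hform_fam41 u v : hform f.1 u v = u ^+ 4 + k1 * (u ^+ 2 * v ^+ 2) + v ^+ 4.
Proof. by rewrite /f fam4E hform_quartic; ring. Qed.

Lemma hform_fam42 u v : hform f.2 u v = k2 * (u ^+ 3 * v) + k3 * (u * v ^+ 3).
Proof. by rewrite /f fam4E hform_quartic; ring. Qed.

Lemma tform_fam4 u v : tform f u v =
  2 * k1 * u * v ^+ 2 + 4 * u ^+ 3 + 3 * k3 * u * v ^+ 2 + k2 * u ^+ 3.
Proof. by rewrite /f fam4E /tform !coef_quartic /=; ring. Qed.

Lemma has_mult_odd u v l : has_mult f u v l -> has_mult f (- u) v l.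
Proof.
case=> m [nm]; rewrite hform_fam41 hform_fam42 tform_fam4 => F G T.
exists (- m); split; rewrite ?oppr_eq0 ?hform_fam41 ?hform_fam42 ?tform_fam4 //.
- by rewrite [RHS]mulrNN -F; ring.
- by rewrite [RHS]mulNr -G; ring.
by rewrite [RHS]mulrN -T; ring.
Qed.

Lemma has_mult_fam4_u v l : has_mult f 0 v l -> v = 0.
Proof.
case=> m [_]; rewrite hform_fam41 mulr0 => F _ _.
by apply: expf4_eq0; rewrite -[RHS]F; ring.
Qed.

Lemma has_mult_fam4_infinity u l : u != 0 -> has_mult f u 0 l -> l = k2.
Proof.
move=> nu h; apply: (has_mult_uniq (u := u) (v := 0) _ h); rewrite ?nu //.
exists (u ^+ 3); rewrite hform_fam41 hform_fam42 tform_fam4 expf_neq0 //.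
by split=> //; ring.
Qed.

(* In terms of [w = z^2], the finite fixed points of the odd map [f] are the roots
   of a quadratic polynomial and their multiplier is a homography. *)
Lemma has_mult_fam4_finite u v l : v != 0 -> has_mult f u v l ->
  let w := (u / v) ^+ 2 in
  (1 - k2) * w ^+ 2 + (k1 - k3) * w + 1 = 0 /\ (4 - 3 * k2 - l * k2) * w = l * k3 + k3 - 2 *
    k1.
Proof.
move=> nv h; have nu : u != 0.
  by apply: contraNneq nv => u0; apply/eqP; move: h; rewrite u0; apply: has_mult_fam4_u.
have nt : v^-1 != 0 by rewrite invr_eq0.
have := has_mult_scale nt h; rewrite mulVf // mulrC.
have : u / v != 0 by rewrite mulf_neq0.
move: (u / v) => z nz [m [nm]].
rewrite hform_fam41 hform_fam42 tform_fam4 !expr1n !mulr1 => F G T; split.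
  transitivity (z ^+ 4 + k1 * z ^+ 2 + 1 - (k2 * z ^+ 3 + k3 * z) * z); first by ring.
  by rewrite F G mulrC subrr.
apply: (mulfI nz); apply/eqP; rewrite -subr_eq0; apply/eqP.
transitivity (2 * k1 * z + 4 * z ^+ 3 + 3 * k3 * z + k2 * z ^+ 3 - (l + 4) * (k2 * z ^+ 3 + k3
  * z)); first by ring.
by rewrite T G subrr.
Qed.

End OddFamily.

(* A finite fixed point with the same multiplier as infinity has
   [w = gen4_num / gen4_den]; [gen4_res] is its quadratic equation, and [gen4_det]
   the determinant of the homography giving the multiplier. *)
Definition gen4_num (k1 k2 k3 : algC) := k2 * k3 + k3 - 2 * k1.
Definition gen4_den (k2 : algC) := 4 - 3 * k2 - k2 ^+ 2.
Definition gen4_res (k1 k2 k3 : algC) :=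
  (1 - k2) * gen4_num k1 k2 k3 ^+ 2
  + (k1 - k3) * (gen4_num k1 k2 k3 * gen4_den k2) + gen4_den k2 ^+ 2.
Definition gen4_det (k1 k2 k3 : algC) := (4 - 3 * k2) * k3 - k2 * (2 * k1 - k3).

(** Suppose that [A] sends infinity to a finite [x = a / c]. This is a fixed point of the first map
    with multiplier [l2], and so is [-x] by oddness. Going back through [A], applying the oddness of
    the second map and returning by [A] gives a third such point. If it is infinity, [gen4_res]
    vanishes. If it is finite, it has the same square as [x], because the multiplier is an injective
    function of [z^2] when [gen4_det] is nonzero; then [A] is singular or 0 is the preimage of [-x],
    but 0 is never fixed. *)
Lemma fam4_conj_affine k1 k2 k3 l1 l2 l3 A :
  k2 ^+ 2 + k3 ^+ 2 != k1 * k2 * k3 -> l2 ^+ 2 + l3 ^+ 2 != l1 * l2 * l3 ->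
  gen4_res k1 k2 k3 != 0 -> gen4_det k1 k2 k3 != 0 ->
  A \in unitmx -> same_map (conj_map A (fam4 k1 k2 k3)) (fam4 l1 l2 l3) -> A 1 0 = 0.
Proof.
move=> Dk Dl nres ndet uA kl; apply/eqP/negPn/negP => nc.
have Rf := Rat4_fam4 Dk; have Rg := Rat4_fam4 Dl.
have [s ns [e1 e2]] := same_map_scale (Rat4_conj uA Rf) Rg kl.
have nA : det2 A != 0 by rewrite -unitmx2E.
set a := A 0 0; set b := A 0 1; set c := A 1 0 in nc *; set d := A 1 1.
have infg : has_mult (fam4 l1 l2 l3) 1 0 l2.
  exists 1; rewrite hform_fam41 hform_fam42 tform_fam4 oner_eq0.
  by split=> //; ring.
have h1 : has_mult (fam4 k1 k2 k3) a c l2.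
  by have := has_mult_conj_inv uA ns e1 e2 infg; rewrite !mulr1 !mulr0 !addr0.
have na : a != 0.
  by apply: contraNneq nc => a0; apply/eqP; move: h1; rewrite a0; apply: has_mult_fam4_u.
(* The adjugate of [A] applied to [(- a, c)], that is, the preimage of [- a / c]. *)
have h2 : has_mult (fam4 l1 l2 l3) (- (a * d + b * c)) (2 * a * c) l2.
  apply: (has_mult_conj uA ns e1 e2).
  have := has_mult_scale nA (has_mult_odd h1).
  by congr has_mult; rewrite /det2 -/a -/b -/c -/d; ring.
have n2 : 2 * a * c != 0 by rewrite !mulf_neq0 // pnatr_eq0.
have nx : a * d + b * c != 0.
  apply: contraNneq n2 => x0; apply/eqP; move: h2; rewrite x0 oppr0.
  exact: has_mult_fam4_u.
have h3 : has_mult (fam4 k1 k2 k3) (a * (a * d + 3 * b * c)) (c * (3 * a * d + b * c)) l2.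
  have := has_mult_conj_inv uA ns e1 e2 (has_mult_odd h2).
  by congr has_mult; rewrite -/a -/b -/c -/d; ring.
have [w1 w2] := has_mult_fam4_finite nc h1.
have [q0|nq] := eqVneq (3 * a * d + b * c) 0.
  have el : l2 = k2.
    move: h3; rewrite q0 mulr0; apply: has_mult_fam4_infinity.
    rewrite mulf_neq0 //; apply: contraNneq nA => p0.
    apply/eqP; rewrite /det2 -/a -/b -/c -/d; apply: (mulfI (_ : 2 != 0 :> algC));
      first by rewrite pnatr_eq0.
    by rewrite mulr0 -[RHS](subr0 0) -{1}q0 -p0; ring.
  case/eqP: nres; move: w1 w2; rewrite el; set w := (a / c) ^+ 2 => w1 w2.
  transitivity (gen4_den k2 ^+ 2 * ((1 - k2) * w ^+ 2 + (k1 - k3) * w + 1));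
    last by rewrite w1 mulr0.
  rewrite /gen4_res (_ : gen4_num k1 k2 k3 = gen4_den k2 * w); first by ring.
  by rewrite /gen4_num -w2 /gen4_den; ring.
have ncq : c * (3 * a * d + b * c) != 0 by rewrite mulf_neq0.
have [_ w2'] := has_mult_fam4_finite ncq h3.
move: w2 w2'; set w := (a / c) ^+ 2; set w' := (_ ^+ 2) => w2 w2'.
have : (w - w') * gen4_det k1 k2 k3 = 0.
  have E1 : (4 - 3 * k2) * w + 2 * k1 - k3 = l2 * (k2 * w + k3).
    by apply/eqP; rewrite -subr_eq0; apply/eqP;
      rewrite -(subrr (l2 * k3 + k3 - 2 * k1)) -{1}w2; ring.
  have E2 : (4 - 3 * k2) * w' + 2 * k1 - k3 = l2 * (k2 * w' + k3).
    by apply/eqP; rewrite -subr_eq0; apply/eqP;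
      rewrite -(subrr (l2 * k3 + k3 - 2 * k1)) -{1}w2'; ring.
  transitivity (((4 - 3 * k2) * w + 2 * k1 - k3) * (k2 * w' + k3) - ((4 - 3 * k2) * w' + 2 *
    k1 - k3) * (k2 * w + k3)).
    by rewrite /gen4_det; ring.
  by rewrite E1 E2; ring.
move/eqP; rewrite mulf_eq0 (negPf ndet) orbF /w /w' => /eqP ww.
have : det2 A * (a * d + b * c) = 0.
  have : ((a / c) ^+ 2 - (a * (a * d + 3 * b * c) / (c * (3 * a * d + b * c))) ^+ 2) * (c * (3
    * a * d + b * c)) ^+ 2 = 0 by rewrite ww mul0r.
  have -> : ((a / c) ^+ 2 - (a * (a * d + 3 * b * c) / (c * (3 * a * d + b * c))) ^+ 2) * (c *
    (3 * a * d + b * c)) ^+ 2 = 8 * a ^+ 2 * (det2 A * (a * d + b * c)).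
    by rewrite /det2 -/a -/b -/c -/d; field; rewrite nq nc.
  by move/eqP; rewrite mulf_eq0 mulf_eq0 pnatr_eq0 expf_eq0 (negPf na) => /eqP.
by move/eqP; rewrite mulf_eq0 (negPf nA) (negPf nx).
Qed.

Lemma fam4_conj k1 k2 k3 l1 l2 l3 :
  k2 ^+ 2 + k3 ^+ 2 != k1 * k2 * k3 -> l2 ^+ 2 + l3 ^+ 2 != l1 * l2 * l3 ->
  k2 != 0 -> gen4_res k1 k2 k3 != 0 -> gen4_det k1 k2 k3 != 0 ->
  conjugate (fam4 k1 k2 k3) (fam4 l1 l2 l3) ->
  exists2 e, e = 1 \/ e = -1 & [/\ l1 = e * k1, l2 = k2 & l3 = e * k3].
Proof.
move=> Dk Dl nk2 nres ndet [A uA kl].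
have c0 := fam4_conj_affine Dk Dl nres ndet uA kl.
have [s ns [e1 e2]] := same_map_scale (Rat4_conj uA (Rat4_fam4 Dk)) (Rat4_fam4 Dl) kl.
move: uA; rewrite unitmx2E /det2 c0 mulr0 subr0 mulf_eq0 negb_or => /andP[na nd].
(* The denominators of both members lack [z^2], and a translation part [b] would create that term
   from [k2 z^3]. *)
have b0 : A 0 1 = 0.
  have := congr1 (fun p : {poly algC} => p`_2) e2.
  rewrite !fam4E /= c0 coefZ coefB !coefZ !form4_linear !coef_quartic /= => h.
  have /eqP : 3 * s * A 0 0 ^+ 3 * A 1 1 * k2 * A 0 1 = 0 by rewrite -[RHS]/(0 : algC) h; ring.
  by rewrite !(expf_eq0, mulf_eq0, pnatr_eq0) (negPf ns) (negPf na) (negPf nd) (negPf nk2) =>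
    /eqP.
have C i : (fam4 l1 l2 l3).1`_i = (s *: (conj_map A (fam4 k1 k2 k3)).1)`_i by rewrite e1.
have G i : (fam4 l1 l2 l3).2`_i = (s *: (conj_map A (fam4 k1 k2 k3)).2)`_i by rewrite e2.
have := C 0; have := C 2; have := C 4; have := G 1; have := G 3.
rewrite !fam4E /= c0 b0 !coefZ !coefB !coefZ !form4_linear !coef_quartic /=.
move: (A 0 0) (A 1 1) na nd => a d na nd G3 G1 C4 C2 C0.
have d5 : s * d ^+ 5 = 1 by rewrite C0; ring.
have a4 : s * d * a ^+ 4 = 1 by rewrite C4; ring.
(* The normalized coefficients of [z^0] and [z^4] give [s d^5 = 1] and [s d a^4 = 1], whose product
   is the square of this factor. *)
exists (s * d ^+ 3 * a ^+ 2).
  suff /eqP : (s * d ^+ 3 * a ^+ 2) ^+ 2 = 1 by rewrite sqrf_eq1 => /orP[]/eqP; [left|right].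
  by transitivity ((s * d ^+ 5) * (s * d * a ^+ 4)); [ring|rewrite d5 a4 mulr1].
split; [rewrite C2; ring| |rewrite G1; ring].
by rewrite G3 -[RHS]mul1r -a4; ring.
Qed.

Lemma fam4_conj_i k1 k2 k3 : conjugate (fam4 k1 k2 k3) (fam4 (- k1) k2 (- k3)).
Proof.
have i2 := sqrCi algC.
have uA : mx2 'i 0 0 1 \in unitmx.
  by rewrite unitmx2E /det2 !mx2E mulr1 mulr0 subr0 neq0Ci.
exists (mx2 'i 0 0 1) => //; rewrite !fam4E.
have i3 : ('i : algC) ^+ 3 = - 'i by rewrite exprS i2 mulrN1.
have i4 : ('i : algC) ^+ 4 = 1 by rewrite (exprM _ 2 2) i2; ring.
apply: (@conjugateI _ 1); rewrite ?size_quartic // => u v;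
  rewrite !hform_quartic !mx2E !mul0r !addr0 !add0r !exprMn ?i2 ?i3 ?i4 ?mul1r; ring: i2.
Qed.

Lemma fam4_two_to_one :
  two_to_one (fun k : 'rV[algC]_3 =>
                k 0 1 ^+ 2 + k 0 2 ^+ 2 != k 0 0 * k 0 1 * k 0 2)
             (fun k : 'rV[algC]_3 => fam4 (k 0 0) (k 0 1) (k 0 2)).
Proof.
split=> [k|]; first exact: Rat4_fam4.
pose num : {mpoly algC[3]} := 'X_1 * 'X_2 + 'X_2 - 2%:MP * 'X_0.
pose den : {mpoly algC[3]} := 4%:MP - 3%:MP * 'X_1 - 'X_1 ^+ 2.
pose res := (1 - 'X_1) * num ^+ 2 + ('X_0 - 'X_2) * (num * den) + den ^+ 2.
pose det : {mpoly algC[3]} := (4%:MP - 3%:MP * 'X_1) * 'X_2 - 'X_1 * (2%:MP * 'X_0 - 'X_2).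
(* [res] and [det] make every conjugacy fix infinity, ['X_1] then makes it diagonal, and ['X_0]
   keeps the two points of the fibre apart. *)
pose g := 'X_0 * 'X_1 * (res * det).
have gE (k : 'rV[algC]_3) : g.@[k ord0] = k 0 0 * k 0 1 *
    (gen4_res (k 0 0) (k 0 1) (k 0 2) * gen4_det (k 0 0) (k 0 1) (k 0 2)).
  by rewrite /g /res /det /num /den !(mevalM, mevalD, mevalB, mevalN, mevalXU, mevalC,
    rmorphXn, meval1) /=.
exists g; split.
  exists (\row_j (if j == 0 then 1 else if j == 1 then 2 else 0)).
    by rewrite !mxE /= mulr0 expr0n addr0 expf_eq0 pnatr_eq0.
  rewrite gE !mxE /= /gen4_res /gen4_det /gen4_num /gen4_den.
  (* At [(1, 2, 0)] the factors are [1 * 2], [res = 44] and [det = -4]. *)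
  set x := (X in X != 0); have -> : x = - (2 * 44 * 4)%:R by rewrite /x; ring.
  by rewrite oppr_eq0 pnatr_eq0.
move=> k Dk; rewrite gE !mulf_eq0 !negb_or => /andP[/andP[nk1 nk2] /andP[nres ndet]].
exists (\row_j (if j == 0 then - k 0 0 else if j == 1 then k 0 1 else - k 0 2)); split.
- by rewrite !mxE /= sqrrN mulrN !mulNr opprK.
- move/rowP/(_ 0); rewrite !mxE /= => /eqP; rewrite -subr_eq0 -opprD oppr_eq0.
  by rewrite -mulr2n mulrn_eq0 (negPf nk1).
move=> l; split=> [[Dl /(fam4_conj Dk Dl nk2 nres ndet)[e]]|[->|->]].
- case=> -> [e1 e2 e3]; [left|right]; apply: row3P; rewrite ?mxE /= ?e1 ?e2 ?e3;
  by rewrite ?mul1r ?mulN1r.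
- by split=> //; have /Rat4P[s1 s2 _] := Rat4_fam4 Dk; apply: conjugate_refl.
rewrite !mxE /= sqrrN mulrN !mulNr opprK; split=> //; exact: fam4_conj_i.
Qed.

(** * Maps with automorphisms *)

Lemma neq0_of_exp (x : algC) n : x ^+ n.+1 != 0 -> x != 0.
Proof. by rewrite expf_eq0. Qed.

(** In PGL_2 finite order only makes a power of [A] scalar. Dividing by an [n]-th root of that
    scalar gives a matrix annihilated by [X^n - 1], which has distinct roots, hence a diagonalizable
    one. *)
Lemma diagonalize_root (A : 'M[algC]_2) n (c : algC) : (0 < n)%N -> c != 0 ->
  A ^+ n = c%:M ->
  exists P a d, P \in unitmx /\ A *m P = P *m mx2 a 0 0 d.
Proof.
move=> n0 nc An; pose r := n.-root c; have rn : r ^+ n = c by rewrite rootCK.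
have nr : r != 0.
  by apply: contraNneq nc => r0; rewrite -rn r0 expr0n eqn0Ngt n0.
have [w pw] := C_prim_root_exists n0.
pose A' := r^-1 *: A.
have A'n : A' ^+ n = 1 by rewrite /A' exprZn An exprVn rn scale_scalar_mx mulVf.
have : diagonalizable A'.
  apply/diagonalizableP; exists [seq w ^+ i | i <- iota 0 n].
    rewrite map_inj_in_uniq ?iota_uniq // => i j; rewrite !mem_iota /= !add0n => li lj /eqP.
    by rewrite (eq_prim_root_expr pw) !modn_small // => /eqP.
  have := factor_Xn_sub_1 pw; rewrite /index_iota subn0 big_map => ->.
  by apply: mxminpoly_min; rewrite rmorphB rmorphXn /= horner_mx_X A'n rmorph1 subrr.
case=> P uP /diagonalizable_forPex[D /(simmxP uP) e].
exists (invmx P), (r * D 0 0), (r * D 0 1); split; first by rewrite unitmx_inv.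
have -> : mx2 (r * D 0 0) 0 0 (r * D 0 1) = r *: diag_mx D.
  by apply: matrix2P; rewrite mx2E !mxE /= ?mulr1n ?mulr0n ?mulr0.
have -> : A = r *: A' by rewrite scalerA mulfV // scale1r.
rewrite -scalemxAl -scalemxAr; congr (_ *: _).
by rewrite -[RHS](mulmxK uP) -[invmx P *m _ *m P]mulmxA -e mulKmx.
Qed.

Section AutGroup.
Variables (gT : finGroupType) (f : ratmap) (phi : gT -> 'M[algC]_2).
Hypothesis phi_aut : forall x, in_Aut f (phi x).
Hypothesis phiM : forall x y, proj_eq (phi (x * y)%g) (phi x *m phi y).
Hypothesis phi_inj : forall x y, proj_eq (phi x) (phi y) -> x = y.

Lemma phi_unit x : phi x \in unitmx.
Proof. by case: (phi_aut x). Qed.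

Lemma phi1 : proj_eq (phi 1%g) 1%:M.
Proof.
have [c nc e] := phiM 1 1; exists c^-1; first by rewrite invr_eq0.
apply: (can_inj (mulKmx (phi_unit 1%g))); rewrite -scalemxAr mulmx1.
by apply: (scalerI nc); rewrite -e mulg1 scalerA mulfV // scale1r.
Qed.

Lemma phiX x n : proj_eq (phi (x ^+ n)%g) (phi x ^+ n).
Proof.
elim: n => [|n [c nc IH]]; first by rewrite expg0 expr0; apply: phi1.
have [d nd e] := phiM x (x ^+ n); exists (d * c); first by rewrite mulf_neq0.
by rewrite expgS e IH exprS -scalemxAr scalerA.
Qed.

Lemma phi_neq1 x c : x != 1%g -> phi x <> c%:M.
Proof.
move=> nx e; have [d nd e1] := phi1; case/eqP: nx; apply: phi_inj.
have nc : c != 0.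
  apply: contraTneq (phi_unit x) => c0; rewrite e c0 unitmx2E /det2 !mxE /=.
  by rewrite mulr0n mulr0 subr0 eqxx.
exists (c / d); first by rewrite mulf_neq0 ?invr_neq0.
by rewrite e e1 scalerA divfK // scalemx1.
Qed.

End AutGroup.

Lemma in_Aut_conj P f B : P \in unitmx -> Rat4 f -> in_Aut f B ->
  in_Aut (conj_map P f) (invmx P *m B *m P).
Proof.
move=> uP Rf [uB e]; split; first by rewrite !unitmx_mul unitmx_inv uP uB.
have [c nc [e1 e2]] := same_map_scale (Rat4_conj uB Rf) Rf e.
have h1 u v : hform f.1 u v = c * hform (conj_map B f).1 u v by rewrite -hformZ -e1.
have h2 u v : hform f.2 u v = c * hform (conj_map B f).2 u v by rewrite -hformZ -e2.
rewrite -conj_mapM !mulmxA mulmxV // mul1mx conj_mapM.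
apply: (@same_map_of_scale _ _ c); apply: hform_inj;
  rewrite ?(leq_trans (size_scale_leq _ _)) ?(size_conj _ _).1 ?(size_conj _ _).2 // => u v.
  by rewrite hformZ (hform_conj1 P f) (hform_conj1 P (conj_map B f)) h1 h2; ring.
by rewrite hformZ (hform_conj2 P f) (hform_conj2 P (conj_map B f)) h1 h2; ring.
Qed.

Lemma in_Aut_coef g a b c d : Rat4 g -> in_Aut g (mx2 a b c d) ->
  exists2 s, s != 0 & forall u v,
    s * hform g.1 u v = d * hform g.1 (a * u + b * v) (c * u + d * v)
                        - b * hform g.2 (a * u + b * v) (c * u + d * v) /\
    s * hform g.2 u v = a * hform g.2 (a * u + b * v) (c * u + d * v)
                        - c * hform g.1 (a * u + b * v) (c * u + d * v).
Proof.
move=> Rg [uA e]; have [k nk [e1 e2]] := same_map_scale (Rat4_conj uA Rg) Rg e.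
exists k^-1 => [|u v]; first by rewrite invr_eq0.
rewrite {1}e1 {2}e2 !hformZ hform_conj1 hform_conj2 !mx2E.
by rewrite !mulKf.
Qed.

(** Diagonal matrices act on monomials by weights, so a nonzero coefficient pins the common scalar
    [s] to the weight of its monomial, and monomials of any other weight must be absent. *)
Lemma in_Aut_diag g a d : Rat4 g -> in_Aut g (mx2 a 0 0 d) ->
  exists s, forall i, (i <= 4)%N ->
    s * g.1`_i = d * (a ^+ i * d ^+ (4 - i)) * g.1`_i /\
    s * g.2`_i = a * (a ^+ i * d ^+ (4 - i)) * g.2`_i.
Proof.
move=> Rg [uA e]; have [k nk [e1 e2]] := same_map_scale (Rat4_conj uA Rg) Rg e.
exists k^-1 => i li; rewrite {1}e1 {1}e2 !coefZ !mulKf //.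
rewrite /conj_map !mx2E /= !coefB !coefZ !form4_linear !coef_quartic.
by case: i li => [|[|[|[|[|]]]]] //= _; rewrite ?subn0 ?subSS; split; ring.
Qed.

Lemma conjugate_trans_conj P f g : P \in unitmx -> Rat4 f -> Rat4 g ->
  conjugate (conj_map P f) g -> conjugate f g.
Proof.
move=> uP Rf Rg [A uA e]; exists (P *m A); first by rewrite unitmx_mul uP uA.
by rewrite conj_mapM.
Qed.

(** Here [a / d] is a primitive fourth root of unity. The weights leave [(p0 + p4 z^4) / (q3 z^3)]
    or [p1 z / (q0 + q4 z^4)], according to which of infinity and 0 the map fixes; the coordinate
    change [b / z] turns the second shape into the first. Absence of common zeros makes the
    remaining coefficients nonzero, and the fourth root [b] normalizes them. *)
Lemma in_Aut_C4 g a d : Rat4 g -> in_Aut g (mx2 a 0 0 d) ->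
  a ^+ 2 = - d ^+ 2 -> exists2 k, k != 0 & conjugate g (fam1 k).
Proof.
move=> Rg Ag ad; have [s es] := in_Aut_diag Rg Ag.
have /Rat4P[s1 s2 nz] := Rg.
have nd : d != 0.
  apply: contraTneq Ag.1 => d0; rewrite unitmx2E /det2 !mx2E d0 mulr0 mulr0 subrr.
  by rewrite eqxx.
have na : a != 0.
  by rewrite -sqrf_eq0 ad oppr_eq0 sqrf_eq0.
have two : 2 != 0 :> algC by rewrite pnatr_eq0.
have nad : a - d != 0.
  apply: contraNneq nd => /eqP; rewrite subr_eq0 => /eqP e.
  rewrite -sqrf_eq0 -(mulrI_eq0 _ (mulfI two)); apply/eqP.
  by transitivity (a ^+ 2 + d ^+ 2); [rewrite e; ring|rewrite ad; ring].
have nad' : a + d != 0.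
  apply: contraNneq nd => /eqP; rewrite addr_eq0 => /eqP e.
  rewrite -sqrf_eq0 -(mulrI_eq0 _ (mulfI two)); apply/eqP.
  by transitivity (a ^+ 2 + d ^+ 2); [rewrite e; ring|rewrite ad; ring].
have a3 : a ^+ 3 = - d ^+ 2 * a by rewrite exprSr ad.
have a4 : a ^+ 4 = d ^+ 4 by rewrite (exprM _ 2 2) ad; ring.
have cancel (x y z : algC) : x * z = y * z -> y - x != 0 -> z = 0.
  move=> e nx; apply: (mulfI nx); rewrite mulr0 mulrBl e subrr //.
have n1 : d ^+ 4 * (a - d) != 0 by rewrite mulf_neq0 ?expf_neq0.
have n2 : d ^+ 4 * (a + d) != 0 by rewrite mulf_neq0 ?expf_neq0.
have n3 : 2 * d ^+ 5 != 0 by rewrite mulf_neq0 ?expf_neq0.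
have n4 : 2 * d ^+ 4 * a != 0 by rewrite !mulf_neq0 ?expf_neq0.
have n1' : - (d ^+ 4 * (a - d)) != 0 by rewrite oppr_eq0.
have n2' : - (d ^+ 4 * (a + d)) != 0 by rewrite oppr_eq0.
have n3' : - (2 * d ^+ 5) != 0 by rewrite oppr_eq0.
have n4' : - (2 * d ^+ 4 * a) != 0 by rewrite oppr_eq0.
have [p0 q0] := es 0 isT; have [p1 q1] := es 1 isT; have [p2 q2] := es 2 isT.
have [p3 q3] := es 3 isT; have [p4 q4] := es 4 isT.
have [P4|np4] := eqVneq (g.1`_4) 0.
  have nq4 : g.2`_4 != 0.
    apply/negP=> /eqP Q4; have [] := nz 1 0; rewrite ?hform_infinity ?P4 ?Q4 ?mul0r //.
    by move=> /eqP; rewrite oner_eq0.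
  have es' : s = d ^+ 4 * a by apply: (mulIf nq4); rewrite q4; ring: a4.
  have P0 : g.1`_0 = 0 by apply: (cancel _ _ _ p0);
    rewrite es' (_ : _ - _ = - (d ^+ 4 * (a - d))) //; ring.
  have P2 : g.1`_2 = 0 by apply: (cancel _ _ _ p2);
    rewrite es' (_ : _ - _ = - (d ^+ 4 * (a + d))) //; ring: ad.
  have P3 : g.1`_3 = 0 by apply: (cancel _ _ _ p3);
    rewrite es' (_ : _ - _ = - (2 * d ^+ 4 * a)) //; ring: a3.
  have Q1 : g.2`_1 = 0 by apply: (cancel _ _ _ q1);
    rewrite es' (_ : _ - _ = - (d ^+ 4 * (a + d))) //; ring: ad.
  have Q2 : g.2`_2 = 0 by apply: (cancel _ _ _ q2);
    rewrite es' (_ : _ - _ = - (2 * d ^+ 4 * a)) //; ring: a3.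
  have Q3 : g.2`_3 = 0 by apply: (cancel _ _ _ q3);
    rewrite es' (_ : _ - _ = - (d ^+ 4 * (a - d))) //; ring: a4.
  have nq0 : g.2`_0 != 0.
    apply/negP=> /eqP Q0; have [] := nz 0 1;
      rewrite ?hformE ?P0 ?P2 ?P3 ?P4 ?Q0 ?Q1 ?Q2 ?Q3 ?expr0n /=; try ring.
    by move=> _ /eqP; rewrite oner_eq0.
  have np1 : g.1`_1 != 0.
    apply/negP=> /eqP P1; pose r := 4.-root (- g.2`_0 / g.2`_4).
    have r4 : r ^+ 4 = - g.2`_0 / g.2`_4 by rewrite rootCK.
    have [] := nz r 1; rewrite ?hformE ?P0 ?P1 ?P2 ?P3 ?P4 ?Q1 ?Q2 ?Q3 /=; try ring.
      by rewrite r4; field.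
    by move=> _ /eqP; rewrite oner_eq0.
  pose b := 4.-root (g.2`_0 / g.2`_4).
  have b4 : b ^+ 4 = g.2`_0 / g.2`_4 by rewrite rootCK.
  have nb : b != 0.
    by apply: (@neq0_of_exp _ 3); rewrite b4 mulf_neq0 ?invr_neq0.
  exists (g.1`_1 / g.2`_0); first by rewrite mulf_neq0 ?invr_neq0.
  have uA : mx2 0 b 1 0 \in unitmx.
    by rewrite unitmx2E /det2 !mx2E mulr0 mulr1 sub0r oppr_eq0.
  exists (mx2 0 b 1 0) => //; rewrite fam1E.
  apply: (@conjugateI _ (- (b * g.2`_0)^-1)); rewrite ?size_quartic // => u v;
    rewrite hform_quartic !mx2E !hformE P0 P2 P3 P4 Q1 Q2 Q3.
    transitivity ((b * g.2`_0)^-1 * (b * (g.2`_0 * u ^+ 4 + g.2`_4 * b ^+ 4 * v ^+ 4)));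
      last by ring.
    by rewrite b4; field; rewrite nb nq0 nq4.
  by field; rewrite nb nq0.
have es' : s = d ^+ 5 by apply: (mulIf np4); rewrite p4; ring: a4.
have P1 : g.1`_1 = 0 by apply: (cancel _ _ _ p1);
  rewrite es' (_ : _ - _ = d ^+ 4 * (a - d)) //; ring.
have P2 : g.1`_2 = 0 by apply: (cancel _ _ _ p2); rewrite es' (_ : _ - _ = - (2 * d ^+ 5)) //;
  ring: ad.
have P3 : g.1`_3 = 0 by apply: (cancel _ _ _ p3);
  rewrite es' (_ : _ - _ = - (d ^+ 4 * (a + d))) //; ring: a3.
have Q0 : g.2`_0 = 0 by apply: (cancel _ _ _ q0);
  rewrite es' (_ : _ - _ = d ^+ 4 * (a - d)) //; ring.
have Q1 : g.2`_1 = 0 by apply: (cancel _ _ _ q1); rewrite es' (_ : _ - _ = - (2 * d ^+ 5)) //;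
  ring: ad.
have Q2 : g.2`_2 = 0 by apply: (cancel _ _ _ q2);
  rewrite es' (_ : _ - _ = - (d ^+ 4 * (a + d))) //; ring: a3.
have Q4 : g.2`_4 = 0 by apply: (cancel _ _ _ q4);
  rewrite es' (_ : _ - _ = d ^+ 4 * (a - d)) //; ring: a4.
have np0 : g.1`_0 != 0.
  apply/negP=> /eqP P0; have [] := nz 0 1;
    rewrite ?hformE ?P0 ?P1 ?P2 ?P3 ?Q0 ?Q1 ?Q2 ?Q4 ?expr0n /=; try ring.
  by move=> _ /eqP; rewrite oner_eq0.
have nq3 : g.2`_3 != 0.
  apply/negP=> /eqP Q3; pose r := 4.-root (- g.1`_0 / g.1`_4).
  have r4 : r ^+ 4 = - g.1`_0 / g.1`_4 by rewrite rootCK.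
  have [] := nz r 1; rewrite ?hformE ?P1 ?P2 ?P3 ?Q0 ?Q1 ?Q2 ?Q3 ?Q4 /=; try ring.
    by rewrite r4; field.
  by move=> _ /eqP; rewrite oner_eq0.
pose b := 4.-root (g.1`_0 / g.1`_4).
have b4 : b ^+ 4 = g.1`_0 / g.1`_4 by rewrite rootCK.
have nb : b != 0 by apply: (@neq0_of_exp _ 3); rewrite b4 mulf_neq0 ?invr_neq0.
exists (g.2`_3 / g.1`_4); first by rewrite mulf_neq0 ?invr_neq0.
have uA : mx2 b 0 0 1 \in unitmx.
  by rewrite unitmx2E /det2 !mx2E mulr0 mulr1 subr0.
exists (mx2 b 0 0 1) => //; rewrite fam1E.
apply: (@conjugateI _ ((g.1`_0)^-1)); rewrite ?size_quartic // => u v;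
  rewrite hform_quartic !mx2E !hformE P1 P2 P3 Q0 Q1 Q2 Q4.
  transitivity ((g.1`_0)^-1 * (g.1`_0 * v ^+ 4 + g.1`_4 * b ^+ 4 * u ^+ 4)); last by ring.
  by rewrite b4; field; rewrite ?np0 ?np4 ?nb.
transitivity ((g.1`_0)^-1 * (g.2`_3 * b ^+ 4 * u ^+ 3 * v)); last by ring.
by rewrite b4; field; rewrite ?np0 ?np4 ?nb.
Qed.

Lemma in_Aut_C3_coef g a d : Rat4 g -> in_Aut g (mx2 a 0 0 d) ->
  a ^+ 3 = d ^+ 3 -> a != d -> exists p1 p4 q0 q3,
   [/\ g = (quartic 0 p1 0 0 p4, quartic q0 0 0 q3 0), p4 != 0 & q0 != 0].
Proof.
move=> Rg Ag a3 nad; have [s es] := in_Aut_diag Rg Ag.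
have /Rat4P[s1 s2 nz] := Rg.
have /[!unitmx2E] uA := Ag.1; rewrite /det2 !mx2E mulr0 subr0 mulf_eq0 negb_or in uA.
case/andP: uA => na nd.
have a4 : a ^+ 4 = d ^+ 3 * a by rewrite exprSr a3.
have cancel (x y z : algC) : x * z = y * z -> y - x != 0 -> z = 0.
  by move=> e nx; apply: (mulfI nx); rewrite mulr0 mulrBl e subrr.
have nad' : a - d != 0 by rewrite subr_eq0.
have n1 : d ^+ 3 * d * (a - d) != 0 by rewrite !mulf_neq0 ?expf_neq0.
have n2 : d ^+ 3 * a * (a - d) != 0 by rewrite !mulf_neq0 ?expf_neq0.
have nad2 : a + d != 0.
  apply: contraNneq nd => /eqP; rewrite addr_eq0 => /eqP e.
  have /eqP : 2 * d ^+ 3 = 0.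
    by transitivity (d ^+ 3 - a ^+ 3); [rewrite e; ring|rewrite a3 subrr].
  by rewrite mulf_eq0 pnatr_eq0 expf_eq0.
have n3 : d ^+ 3 * (a + d) * (a - d) != 0 by rewrite !mulf_neq0 ?expf_neq0.
have n1' : - (d ^+ 3 * d * (a - d)) != 0 by rewrite oppr_eq0.
have n2' : - (d ^+ 3 * a * (a - d)) != 0 by rewrite oppr_eq0.
have n3' : - (d ^+ 3 * (a + d) * (a - d)) != 0 by rewrite oppr_eq0.
have [p0 q0] := es 0 isT; have [p1 q1] := es 1 isT; have [p2 q2] := es 2 isT.
have [p3 q3] := es 3 isT; have [p4 q4] := es 4 isT.
(* Otherwise [q4] is nonzero, and its weight excludes both [p0] and [q0], leaving 0 as a common
   zero. *)
have np4 : g.1`_4 != 0.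
  apply/negP => /eqP P4.
  have nq4 : g.2`_4 != 0.
    apply/negP=> /eqP Q4; have [] := nz 1 0; rewrite ?hform_infinity ?P4 ?Q4 ?mul0r //.
    by move=> /eqP; rewrite oner_eq0.
  have es' : s = d ^+ 3 * a ^+ 2 by apply: (mulIf nq4); rewrite q4; ring: a4.
  have P0 : g.1`_0 = 0 by apply: (cancel _ _ _ p0);
    rewrite es' (_ : _ - _ = - (d ^+ 3 * (a + d) * (a - d))) //; ring.
  have Q0 : g.2`_0 = 0 by apply: (cancel _ _ _ q0);
    rewrite es' (_ : _ - _ = - (d ^+ 3 * a * (a - d))) //; ring.
  have [] := nz 0 1; rewrite ?hformE ?P0 ?Q0 ?expr0n /=; try ring.
  by move=> _ /eqP; rewrite oner_eq0.
have es' : s = d ^+ 3 * (a * d) by apply: (mulIf np4); rewrite p4; ring: a4.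
have P0 : g.1`_0 = 0 by apply: (cancel _ _ _ p0);
  rewrite es' (_ : _ - _ = - (d ^+ 3 * d * (a - d))) //; ring.
have P2 : g.1`_2 = 0 by apply: (cancel _ _ _ p2);
  rewrite es' (_ : _ - _ = d ^+ 3 * a * (a - d)) //; ring.
have P3 : g.1`_3 = 0 by apply: (cancel _ _ _ p3);
  rewrite es' (_ : _ - _ = - (d ^+ 3 * d * (a - d))) //; ring: a3.
have Q1 : g.2`_1 = 0 by apply: (cancel _ _ _ q1);
  rewrite es' (_ : _ - _ = d ^+ 3 * a * (a - d)) //; ring.
have Q2 : g.2`_2 = 0 by apply: (cancel _ _ _ q2);
  rewrite es' (_ : _ - _ = - (d ^+ 3 * d * (a - d))) //; ring: a3.
have Q4 : g.2`_4 = 0 by apply: (cancel _ _ _ q4);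
  rewrite es' (_ : _ - _ = d ^+ 3 * a * (a - d)) //; ring: a4.
exists g.1`_1, g.1`_4, g.2`_0, g.2`_3; split=> //.
  rewrite [LHS]surjective_pairing; congr pair; apply: hform_inj;
    rewrite ?size_quartic // => u v;
  by rewrite hform_quartic hformE ?P0 ?P2 ?P3 ?Q1 ?Q2 ?Q4.
apply/negP=> /eqP Q0; have [] := nz 0 1; rewrite ?hformE ?P0 ?Q0 ?expr0n /=; try ring.
by move=> _ /eqP; rewrite oner_eq0.
Qed.

Lemma C3_conj p1 p4 q0 q3 : p4 != 0 -> q0 != 0 ->
  let g := (quartic 0 p1 0 0 p4, quartic q0 0 0 q3 0) in
  Rat4 g ->
  (p1 / q0) * (q3 / p4) != 1 /\ conjugate g (fam3 (p1 / q0) (q3 / p4)).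
Proof.
move=> np4 nq0 g Rg; pose b := 3.-root (q0 / p4).
have b3 : b ^+ 3 = q0 / p4 by rewrite rootCK.
have nb : b != 0 by apply: (@neq0_of_exp _ 2); rewrite b3 mulf_neq0 ?invr_neq0.
split.
  apply/negP=> /eqP e; have /Rat4P[_ _ nz] := Rg.
  (* If the product of the two parameters is 1, that is [p1 q3 = q0 p4], then [r] is a common
     zero. *)
  pose r := 3.-root (- p1 / p4); have r3 : r ^+ 3 = - p1 / p4 by rewrite rootCK.
  have e' : p1 * q3 = q0 * p4.
    by transitivity (p1 / q0 * (q3 / p4) * (q0 * p4)); [field;
      rewrite ?nq0 ?np4|rewrite e mul1r].
  have [] := nz r 1; rewrite ?/g /= ?hform_quartic.
  - by transitivity (r * (p1 + p4 * r ^+ 3)); [ring|rewrite r3; field].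
  - transitivity (q0 + q3 * r ^+ 3); [ring|rewrite r3].
    by transitivity ((q0 * p4 - p1 * q3) / p4); [field|rewrite e' subrr mul0r].
  by move=> _ /eqP; rewrite oner_eq0.
have uA : mx2 b 0 0 1 \in unitmx by rewrite unitmx2E /det2 !mx2E mulr0 mulr1 subr0.
exists (mx2 b 0 0 1) => //; rewrite fam3E.
apply: (@conjugateI _ ((b * q0)^-1)); rewrite ?size_quartic // => u v;
  rewrite /g /= !hform_quartic !mx2E.
  transitivity ((b * q0)^-1 * (b * (p1 * (u * v ^+ 3) + p4 * b ^+ 3 * u ^+ 4))); last by ring.
  by rewrite b3; field; rewrite ?nb ?np4 ?nq0.
transitivity ((b * q0)^-1 * (b * (q0 * v ^+ 4 + q3 * b ^+ 3 * (u ^+ 3 * v)))); last by ring.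
by rewrite b3; field; rewrite ?nb ?nq0 ?np4.
Qed.

(** Such an automorphism exchanges the fixed points 0 and infinity, whose multipliers are [p1 / q0]
    and [q3 / p4]. *)
Lemma in_Aut_antidiag p1 p4 q0 q3 x y : p4 != 0 -> q0 != 0 ->
  let g := (quartic 0 p1 0 0 p4, quartic q0 0 0 q3 0) in
  Rat4 g -> in_Aut g (mx2 0 x y 0) -> p1 / q0 = q3 / p4.
Proof.
move=> np4 nq0 g Rg Ag; have [s ns e] := in_Aut_coef Rg Ag.
have [_ e1] := e 0 1; have [e2 _] := e 1 0; have [e3 e4] := e 1 1.
move: e1 e2 e3 e4; rewrite /g /= !hform_quartic => e1 e2 e3 e4.
have E1 : s * q0 = - (y * x ^+ 4 * p4) by transitivity (s * (q0 * 1 ^+ 4 + 0 * (0 * 1 ^+ 3) +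
  0 * (0 ^+ 2 * 1 ^+ 2) + q3 * (0 ^+ 3 * 1) + 0 * 0 ^+ 4)); [ring|rewrite e1; ring].
have E2 : s * p4 = - (x * y ^+ 4 * q0) by transitivity (s * (0 * 0 ^+ 4 + p1 * (1 * 0 ^+ 3) +
  0 * (1 ^+ 2 * 0 ^+ 2) + 0 * (1 ^+ 3 * 0) + p4 * 1 ^+ 4)); [ring|rewrite e2; ring].
have E3 : s * p1 = - (y * x ^+ 4 * q3).
  transitivity (s * (0 * 1 ^+ 4 + p1 * (1 * 1 ^+ 3) + 0 * (1 ^+ 2 * 1 ^+ 2) + 0 * (1 ^+ 3 * 1)
    + p4 * 1 ^+ 4) - s * p4); first by ring.
  by rewrite e3 E2; ring.
have e0 : s * (p1 * p4 - q0 * q3) = 0.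
  by transitivity (s * p1 * p4 - s * q0 * q3); [ring|rewrite E3 E1; ring].
move/eqP: e0; rewrite mulf_eq0 (negPf ns) subr_eq0 /= => /eqP e0.
by apply: (mulIf nq0); rewrite divfK //; apply: (mulIf np4); rewrite e0; field.
Qed.

Lemma mx2X (a d : algC) n : mx2 a 0 0 d ^+ n = mx2 (a ^+ n) 0 0 (d ^+ n).
Proof.
elim: n => [|n IH].
  by apply: matrix2P; rewrite !mxE.
rewrite !exprS IH; apply: matrix2P; rewrite !mulmx2E !mx2E; ring.
Qed.

Lemma mx2_scalar (a : algC) : mx2 a 0 0 a = a%:M.
Proof. by apply: matrix2P; rewrite !mxE. Qed.

Section AutGroup.
Variables (gT : finGroupType) (f : ratmap) (phi : gT -> 'M[algC]_2).
Hypothesis phi_aut : forall x, in_Aut f (phi x).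
Hypothesis phiM : forall x y, proj_eq (phi (x * y)%g) (phi x *m phi y).
Hypothesis phi_inj : forall x y, proj_eq (phi x) (phi y) -> x = y.

Lemma aut_diagonal x n : (0 < n)%N -> (x ^+ n = 1)%g -> exists P a d,
  [/\ P \in unitmx, phi x *m P = P *m mx2 a 0 0 d, a ^+ n = d ^+ n
    & forall m, (x ^+ m != 1)%g -> a ^+ m != d ^+ m].
Proof.
move=> n0 xn; have [c nc e] := phiX phi_aut phiM x n.
have [c1 nc1 e1] := phi1 phi_aut phiM.
have An : phi x ^+ n = (c1 / c)%:M.
  by apply: (scalerI nc); rewrite -e xn e1 scalemx1 scale_scalar_mx mulrCA mulfV // mulr1.
have [] := diagonalize_root n0 _ An; first by rewrite mulf_neq0 ?invr_neq0.
move=> P [a [d [uP AP]]]; exists P, a, d.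
have APn m : phi x ^+ m *m P = P *m mx2 a 0 0 d ^+ m.
  elim: m => [|m IH]; first by rewrite !expr0 mul1mx mulmx1.
  rewrite !exprSr -[phi x ^+ m * _]/(phi x ^+ m *m phi x) -mulmxA AP mulmxA IH.
  by rewrite -mulmxA.
split=> // [|m nxm].
  have : P *m (c1 / c)%:M = P *m mx2 (a ^+ n) 0 0 (d ^+ n).
    by rewrite -mx2X -APn An scalar_mxC.
  move/(can_inj (mulKmx uP))/matrixP => ee.
  by move: (ee 0 0) (ee 1 1); rewrite !mx2E !mxE /= => <- <-.
apply/eqP => ad; have := APn m; rewrite mx2X ad mx2_scalar scalar_mxC.
move/(can_inj (mulmxK uP)) => Am; have [k nk ek] := phiX phi_aut phiM x m.
by apply: (phi_neq1 phi_aut phiM phi_inj nxm (c := k * d ^+ m)); rewrite ek Am scale_scalar_mx.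
Qed.

Lemma aut_conj P B x : P \in unitmx -> Rat4 f -> phi x *m P = P *m B ->
  in_Aut (conj_map P f) B.
Proof.
by move=> uP Rf e; have := in_Aut_conj uP Rf (phi_aut x); rewrite -mulmxA e mulKmx.
Qed.

Lemma aut_order3 x : Rat4 f -> (x ^+ 3 = 1)%g -> x != 1%g -> exists P a d p1 p4 q0 q3,
  [/\ P \in unitmx, phi x *m P = P *m mx2 a 0 0 d, a ^+ 3 = d ^+ 3 /\ a != d,
      conj_map P f = (quartic 0 p1 0 0 p4, quartic q0 0 0 q3 0)
    & p4 != 0 /\ q0 != 0].
Proof.
move=> Rf x3 nx; have [P [a [d [uP e a3 am]]]] := aut_diagonal (isT : (0 < 3)%N) x3.
have nad : a != d by rewrite -[a]expr1 -[d]expr1 am // expg1.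
have [p1 [p4 [q0 [q3 [eg n4 n0]]]]] := in_Aut_C3_coef (Rat4_conj uP Rf) (aut_conj uP Rf e) a3
  nad.
by exists P, a, d, p1, p4, q0, q3.
Qed.

End AutGroup.

Lemma autlocus_C4 f : autlocus 'Z_4 f -> exists2 k, k != 0 & conjugate f (fam1 k).
Proof.
case=> Rf [phi [aut M inj]].
have x4 : ((Zp1 : 'Z_4) ^+ 4 = 1)%g by apply: val_inj.
have [P [a [d [uP e a4 am]]]] := aut_diagonal aut M inj (isT : (0 < 4)%N) x4.
have /am na2 : ((Zp1 : 'Z_4) ^+ 2 != 1)%g by [].
have a2 : a ^+ 2 = - d ^+ 2.
  have /eqP : (a ^+ 2 - d ^+ 2) * (a ^+ 2 + d ^+ 2) = 0.
    by transitivity (a ^+ 4 - d ^+ 4); [ring|rewrite a4 subrr].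
  by rewrite mulf_eq0 subr_eq0 (negPf na2) addr_eq0 => /eqP.
have Rg := Rat4_conj uP Rf.
have [k nk ek] := in_Aut_C4 Rg (aut_conj aut uP Rf e) a2.
by exists k => //; apply: (conjugate_trans_conj uP Rf (Rat4_fam1 nk)).
Qed.

Lemma autlocus_C3 f : autlocus 'Z_3 f ->
  exists k1 k2, k1 * k2 != 1 /\ conjugate f (fam3 k1 k2).
Proof.
case=> Rf [phi [aut M inj]].
have x3 : ((Zp1 : 'Z_3) ^+ 3 = 1)%g by apply: val_inj.
have [P [a [d [p1 [p4 [q0 [q3 [uP _ _ eg [n4 n0]]]]]]]]] :=
  aut_order3 aut M inj Rf x3 isT.
have Rg := Rat4_conj uP Rf; rewrite eg in Rg.
have [nk c] := C3_conj n4 n0 Rg.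
exists (p1 / q0), (q3 / p4); split=> //.
by apply: (conjugate_trans_conj uP Rf (Rat4_fam3 nk)); rewrite eg.
Qed.

Lemma D3_generators : exists x y : D3,
  [/\ (x ^+ 3 = 1)%g, (y ^+ 2 = 1)%g, (x ^ y = x^-1)%g
    & [set: D3] = (<[x]> <*> <[y]>)%g].
Proof.
have /isoGrp_hom/existsP[[x y] /eqP[e1 x3 y2 xy]] := @Grp_dihedral 3 isT.
by exists x, y; split.
Qed.

Lemma card_D3 : #|D3| = 6%N.
Proof. by rewrite -cardsT; apply: (@card_dihedral 3). Qed.

Section DihedralElements.
Variables x y : D3.
Hypotheses (x3 : (x ^+ 3 = 1)%g) (y2 : (y ^+ 2 = 1)%g) (xy : (x ^ y = x^-1)%g).
Hypothesis genD : [set: D3] = (<[x]> <*> <[y]>)%g.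

Definition D3elt (p : 'Z_3 * bool) : D3 := (x ^+ p.1 * y ^+ p.2)%g.

Lemma D3_yV : (y^-1 = y)%g.
Proof. by apply: (mulgI y); rewrite mulgV; apply/esym/y2. Qed.

Lemma D3_yx n : (y * x ^+ n = (x ^+ n)^-1 * y)%g.
Proof.
rewrite -expVgn -xy -conjXg conjgE D3_yV -!mulgA (_ : y * y = 1)%g; last exact: y2.
by rewrite mulg1.
Qed.

Lemma D3_surj g : exists p, g = D3elt p.
Proof.
have : g \in [set: D3] by rewrite inE.
rewrite genD norm_joinEr; last first.
  by rewrite cycle_subG; apply/normP; rewrite -cycleJ xy cycleV.
case/mulsgP=> _ _ /cycleP[i ->] /cycleP[j ->] ->.
exists (inZp i, odd j); rewrite /D3elt /=; congr (_ * _)%g.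
  exact: (esym (expg_mod i x3)).
by rewrite -(expg_mod j y2) modn2.
Qed.

(** Six normal forms cover a group of six elements, so none is hit twice. *)
Lemma D3_inj : injective D3elt.
Proof.
have sur : #|codom D3elt| = #|[set: D3]|.
  rewrite cardsT; apply: eq_card => g; rewrite inE; have [p ->] := D3_surj g.
  exact: codom_f.
by apply/injectiveP; apply/card_uniqP;
  rewrite size_map -cardE card_prod card_bool card_ord sur cardsT card_D3.
Qed.

End DihedralElements.

Lemma D3elt_neq1 (x y : D3) : injective (D3elt x y) -> x != 1%g.
Proof.
move=> inj; apply/eqP => x1; have := inj (0, false) (1, false).
by rewrite /D3elt /= x1 !expg1n => /(_ erefl)/(congr1 fst).
Qed.

Lemma mx2_eta (A : 'M[algC]_2) : A = mx2 (A 0 0) (A 0 1) (A 1 0) (A 1 1).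
Proof. by apply: matrix2P; rewrite mx2E. Qed.

(** Diagonalize the rotation [x] and let [B] be the reflection [y] in that basis. The relation
    [x y = y x^2], valid up to a scalar [kap], makes [B] antidiagonal because [a / d] has order 3;
    hence the two parameters of the order 3 normal form agree. *)
Lemma autlocus_D3 f : autlocus D3 f ->
  exists k, [/\ k != 1, k != -1 & conjugate f (fam3 k k)].
Proof.
case=> Rf [phi [aut M inj]].
have [x [y [x3 y2 xy gen]]] := D3_generators.
have nx := D3elt_neq1 (D3_inj x3 y2 xy gen).
have [P [a [d [p1 [p4 [q0 [q3 [uP e [a3 nad] eg [n4 n0]]]]]]]]] :=
  aut_order3 aut M inj Rf x3 nx.
have Rg := Rat4_conj uP Rf; rewrite eg in Rg.
have [nk c] := C3_conj n4 n0 Rg.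
pose B := invmx P *m phi y *m P.
have eB : phi y *m P = P *m B by rewrite /B -mulmxA mulKVmx.
have AB := aut_conj aut uP Rf eB.
have xyx : (x * y = y * x ^+ 2)%g.
  have -> : (x ^+ 2 = x^-1)%g by apply: (mulgI x); rewrite mulgV -expgS.
  by rewrite -xy conjgE mulKVg.
have [kap nkap eDB] : exists2 kap, kap != 0 &
    mx2 a 0 0 d *m B = kap *: (B *m mx2 (a ^+ 2) 0 0 (d ^+ 2)).
  have [c1 nc1 e1] := M x y; have [c2 nc2 e2] := M y (x ^+ 2)%g.
  have [c3 nc3 e3] := phiX aut M x 2.
  have exy : phi x *m phi y *m P = P *m (mx2 a 0 0 d *m B).
    by rewrite -mulmxA eB mulmxA e -mulmxA.
  have ex2 : phi x ^+ 2 *m P = P *m mx2 (a ^+ 2) 0 0 (d ^+ 2).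
    by rewrite -mx2X !expr2 -[_ *m P]mulmxA e mulmxA e -mulmxA.
  have eyx : phi y *m phi x ^+ 2 *m P = P *m (B *m mx2 (a ^+ 2) 0 0 (d ^+ 2)).
    by rewrite -mulmxA ex2 mulmxA eB -mulmxA.
  exists (c2 * c3 / c1); first by rewrite !mulf_neq0 ?invr_neq0.
  apply: (scalerI nc1); apply: (can_inj (mulKmx uP)).
  rewrite scalerA mulrCA mulfV // mulr1 -!scalemxAr -exy -eyx !(scalemxAl _ (_ *m _)) -e1 xyx
    e2 e3.
  by rewrite -scalemxAr scalerA.
have [w00 w01 w10 w11] : [/\ a * B 0 0 = kap * (B 0 0 * a ^+ 2),
    a * B 0 1 = kap * (B 0 1 * d ^+ 2), d * B 1 0 = kap * (B 1 0 * a ^+ 2)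
  & d * B 1 1 = kap * (B 1 1 * d ^+ 2)].
  have h i j : (mx2 a 0 0 d *m B) i j = kap * (B *m mx2 (a ^+ 2) 0 0 (d ^+ 2)) i j.
    by rewrite eDB [LHS]mxE.
  move: (h 0 0) (h 0 1) (h 1 0) (h 1 1).
  by rewrite !mulmx2E !mx2E !(mul0r, mulr0, addr0, add0r).
have uB := AB.1; rewrite unitmx2E /det2 in uB.
have [na nd] : a != 0 /\ d != 0.
  have := (aut_conj aut uP Rf e).1.
  by rewrite unitmx2E /det2 !mx2E mulr0 subr0 mulf_eq0 negb_or => /andP.
(* A nonzero diagonal entry makes [kap] the inverse of [a] or of [d]; invertibility of [B] then
   supplies another nonzero entry, and this forces [a = d]. *)
have [b00|n00] := eqVneq (B 0 0) 0; last first.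
  have ka : kap * a = 1.
    by apply: (mulfI (mulf_neq0 na n00)); rewrite mulr1 [RHS]w00; ring.
  have [b11|n11] := eqVneq (B 1 1) 0; last first.
    have kd : kap * d = 1.
      by apply: (mulfI (mulf_neq0 nd n11)); rewrite mulr1 [RHS]w11; ring.
    by case/eqP: nad; apply: (mulfI nkap); rewrite ka.
  have n01 : B 0 1 != 0 by apply: contraNneq uB => b01; rewrite b11 b01 mulr0 mul0r subrr.
  have ad : a ^+ 2 = d ^+ 2.
    apply: (mulfI (mulf_neq0 nkap n01)); transitivity (kap * a * (a * B 0 1)); first by ring.
    by rewrite ka w01; ring.
  case/eqP: nad; apply: (mulfI (expf_neq0 2 na)).
  by rewrite {2}ad -!exprSr a3.
have b11 : B 1 1 = 0.
  apply/eqP/negPn/negP => n11.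
  have kd : kap * d = 1.
    by apply: (mulfI (mulf_neq0 nd n11)); rewrite mulr1 [RHS]w11; ring.
  have n01 : B 0 1 != 0 by apply: contraNneq uB => b01; rewrite b00 b01 !mul0r subrr.
  case/eqP: nad; apply: (mulIf n01); rewrite w01; transitivity (kap * d * (B 0 1 * d));
    first by ring.
  by rewrite kd; ring.
have ek : p1 / q0 = q3 / p4.
  apply: (in_Aut_antidiag n4 n0 Rg (x := B 0 1) (y := B 1 0)).
  by move: AB; rewrite eg {1}(mx2_eta B) b00 b11.
rewrite -ek in nk c; exists (p1 / q0); split.
- by apply: contraNneq nk => ->; rewrite mulr1.
- by apply: contraNneq nk => ->; rewrite mulrNN mulr1.
by apply: (conjugate_trans_conj uP Rf (Rat4_fam3 nk)); rewrite eg.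
Qed.

Lemma in_AutI (A : 'M[algC]_2) c (g : ratmap) : A \in unitmx ->
  (size g.1 <= 5)%N -> (size g.2 <= 5)%N ->
  (forall u v, hform g.1 u v = c *
    (A 1 1 * hform g.1 (A 0 0 * u + A 0 1 * v) (A 1 0 * u + A 1 1 * v)
     - A 0 1 * hform g.2 (A 0 0 * u + A 0 1 * v) (A 1 0 * u + A 1 1 * v))) ->
  (forall u v, hform g.2 u v = c *
    (A 0 0 * hform g.2 (A 0 0 * u + A 0 1 * v) (A 1 0 * u + A 1 1 * v)
     - A 1 0 * hform g.1 (A 0 0 * u + A 0 1 * v) (A 1 0 * u + A 1 1 * v))) ->
  in_Aut g A.
Proof. by move=> uA s1 s2 e1 e2; split=> //; apply: (conjugateI uA s1 s2 e1 e2). Qed.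

Lemma unit_diag (r : algC) : r != 0 -> mx2 r 0 0 1 \in unitmx.
Proof. by rewrite unitmx2E /det2 !mx2E mulr0 subr0 mulr1. Qed.

Lemma unit_anti (r : algC) : r != 0 -> mx2 0 r 1 0 \in unitmx.
Proof. by rewrite unitmx2E /det2 !mx2E mul0r sub0r mulr1 oppr_eq0. Qed.

Lemma in_Aut_fam1 k r : r ^+ 4 = 1 -> in_Aut (fam1 k) (mx2 r 0 0 1).
Proof.
move=> r4; have nr : r != 0 by apply: (@neq0_of_exp _ 3); rewrite r4 oner_eq0.
rewrite fam1E; apply: (@in_AutI _ 1); rewrite ?size_quartic ?unit_diag // => u v;
  rewrite /= !hform_quartic !mx2E.
  transitivity (v ^+ 4 + r ^+ 4 * u ^+ 4); [by rewrite r4; ring|by ring].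
by transitivity (r ^+ 4 * (k * u ^+ 3 * v)); [rewrite r4; ring|ring].
Qed.

Lemma in_Aut_fam3 k1 k2 r : r ^+ 3 = 1 -> in_Aut (fam3 k1 k2) (mx2 r 0 0 1).
Proof.
move=> r3; have nr : r != 0 by apply: (@neq0_of_exp _ 2); rewrite r3 oner_eq0.
rewrite fam3E; apply: (@in_AutI _ r^-1); rewrite ?size_quartic ?unit_diag // => u v;
  rewrite /= !hform_quartic !mx2E; apply: (mulfI nr); rewrite !mulrA mulfV // mul1r.
  transitivity (r * (k1 * u * v ^+ 3 + r ^+ 3 * u ^+ 4)); [by rewrite r3; ring|by ring].
by transitivity (r * (v ^+ 4 + k2 * (r ^+ 3 * u ^+ 3 * v))); [rewrite r3; ring|ring].
Qed.

Lemma in_Aut_fam2 k r : r ^+ 3 = 1 -> in_Aut (fam3 k k) (mx2 0 r 1 0).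
Proof.
move=> r3; have nr : r != 0 by apply: (@neq0_of_exp _ 2); rewrite r3 oner_eq0.
rewrite fam3E; apply: (@in_AutI _ (- r^-1)); rewrite ?size_quartic ?unit_anti // => u v;
  rewrite /= !hform_quartic !mx2E; apply: (mulfI nr); rewrite [RHS]mulrA mulrN mulfV // mulN1r.
  by transitivity (r * (k * r ^+ 3 * u * v ^+ 3 + u ^+ 4)); [rewrite r3; ring|ring].
transitivity (r * (r ^+ 3 * v ^+ 4 + k * (u ^+ 3 * v))); [by rewrite r3; ring|by ring].
Qed.

Lemma proj_eq_refl (A : 'M[algC]_2) : proj_eq A A.
Proof. by exists 1; rewrite ?oner_eq0 // scale1r. Qed.

Lemma cyclic_autlocus n f : Rat4 f ->
  (forall r : algC, r ^+ n.+2 = 1 -> in_Aut f (mx2 r 0 0 1)) -> autlocus 'Z_n.+2 f.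
Proof.
move=> Rf aut; split=> //; have [w pw] := C_prim_root_exists (isT : (0 < n.+2)%N).
exists (fun x : 'Z_n.+2 => mx2 (w ^+ x) 0 0 1); split=> [x|x y|x y [c nc e]].
- by apply: aut; rewrite exprAC (prim_expr_order pw) expr1n.
- have -> : mx2 (w ^+ (x * y)%g) 0 0 1 = mx2 (w ^+ x) 0 0 1 *m mx2 (w ^+ y) 0 0 1.
    apply: matrix2P; rewrite mulmx2E !mx2E /= ?(prim_expr_mod pw) ?exprD; ring.
  exact: proj_eq_refl.
have := congr1 (fun N : 'M[algC]_2 => N 1 1) e.
have := congr1 (fun N : 'M[algC]_2 => N 0 0) e.
rewrite /= !mxE /= mulr1 => + c1; rewrite -c1 mul1r => /eqP.
by rewrite (eq_prim_root_expr pw) !modn_small ?ltn_ord // => /eqP /val_inj.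
Qed.

Lemma fam1_autlocus k : k != 0 -> autlocus ('Z_4)%type (fam1 k).
Proof. by move=> nk; apply: cyclic_autlocus (Rat4_fam1 nk) _ => r; apply: in_Aut_fam1. Qed.

Lemma fam3_autlocus k1 k2 : k1 * k2 != 1 -> autlocus ('Z_3)%type (fam3 k1 k2).
Proof. by move=> nk; apply: cyclic_autlocus (Rat4_fam3 nk) _ => r; apply: in_Aut_fam3. Qed.

Definition D3mx (w : algC) (p : 'Z_3 * bool) : 'M[algC]_2 :=
  if p.2 then mx2 0 (w ^+ p.1) 1 0 else mx2 (w ^+ p.1) 0 0 1.

(** The group law on the normal forms [x^i y^b]: a reflection inverts each rotation moved past it.
    [D3mx] realizes these forms as [z -> w^i z] and [z -> w^i / z]. *)
Definition D3mul (p q : 'Z_3 * bool) : 'Z_3 * bool :=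
  (if p.2 then p.1 - q.1 else p.1 + q.1, p.2 (+) q.2).

Lemma D3mxM (w : algC) p q : 3.-primitive_root w ->
  proj_eq (D3mx w (D3mul p q)) (D3mx w p *m D3mx w q).
Proof.
move=> pw; case: p q => [i b] [j c]; rewrite /D3mul /D3mx /=.
have w3 := prim_expr_order pw.
have nw : w != 0 by apply: (@neq0_of_exp _ 2); rewrite w3 oner_eq0.
have ED (k l : 'Z_3) : w ^+ (k + l)%R = w ^+ k * w ^+ l.
  by rewrite /= (prim_expr_mod pw) exprD.
have EB (k l : 'Z_3) : w ^+ (k - l)%R = w ^+ k / w ^+ l.
  by apply: (mulIf (expf_neq0 l nw)); rewrite divfK ?expf_neq0 // -ED subrK.
have nj : w ^+ j != 0 by rewrite expf_neq0.
case: b c => [] [] /=; rewrite ?EB ?ED;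
  [exists (w ^+ j)^-1|exists (w ^+ j)^-1|exists 1|exists 1];
  rewrite ?invr_eq0 ?oner_eq0 //; apply: matrix2P; rewrite [in RHS]mxE mulmx2E !mx2E;
  rewrite ?(mul0r, mulr0, mul1r, mulr1, addr0, add0r) ?mulVf //; by rewrite mulrC.
Qed.

Lemma fam2_autlocus k : k != 1 -> k != -1 -> autlocus D3 (fam3 k k).
Proof.
move=> n1 n2; split; first exact: Rat4_fam3 (sq_neq1 n1 n2).
have [w pw] := C_prim_root_exists (isT : (0 < 3)%N).
have w3 (i : 'Z_3) : (w ^+ i) ^+ 3 = 1 by rewrite exprAC (prim_expr_order pw) expr1n.
have [x [y [x3 y2 xy gen]]] := D3_generators.
have inj := D3_inj x3 y2 xy gen; have sur := D3_surj x3 y2 xy gen.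
have ex g : exists p, D3elt x y p == g by have [p ->] := sur g; exists p.
pose psi g := xchoose (ex g); have psiK g : D3elt x y (psi g) = g.
  exact: eqP (xchooseP (ex g)).
exists (fun g => D3mx w (psi g)); split=> [g|g h|g h [c nc]].
- by rewrite /D3mx; case: ifP => _; [apply: in_Aut_fam2|apply: in_Aut_fam3].
- suff -> : psi (g * h)%g = D3mul (psi g) (psi h) by apply: D3mxM.
  apply: inj; rewrite psiK -{1}(psiK g) -{1}(psiK h); case: (psi g) (psi h) => [i b] [j d].
  rewrite /D3elt /D3mul /=.
  have XD (m l : 'Z_3) : (x ^+ (m + l)%R = x ^+ m * x ^+ l)%g.
    by rewrite -expgD -(expg_mod (m + l) x3).
  have XB (m l : 'Z_3) : (x ^+ (m - l)%R = x ^+ m * (x ^+ l)^-1)%g.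
    by apply: (mulIg (x ^+ l)%g); rewrite mulgKV -XD subrK.
  have yb : (y ^+ b * y ^+ d = y ^+ (b (+) d))%g.
    by case: b d => [] []; rewrite /= ?expg0 ?mul1g ?mulg1 //; apply: y2.
  rewrite -yb; case: b {yb} => /=; last by rewrite expg0 mulg1 mul1g XD mulgA.
  by rewrite expg1 XB -!mulgA (mulgA y) (D3_yx y2 xy) !mulgA.
move=> e; rewrite -[g]psiK -[h]psiK; congr (D3elt _ _ _).
move: e; case: (psi g) (psi h) => [i b] [j d]; rewrite /D3mx /= => e.
have ee s t := congr1 (fun N : 'M[algC]_2 => N s t) e.
case: b d e ee => [] [] e ee.
- move: (ee 0 1) (ee 1 0); rewrite /= !mxE /= mulr1 => + c1; rewrite -c1 mul1r => /eqP.
  by rewrite (eq_prim_root_expr pw) !modn_small ?ltn_ord // => /eqP /val_inj ->.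
- by move: (ee 1 0); rewrite /= !mxE /= mulr0 => /eqP; rewrite oner_eq0.
- by move: (ee 1 1); rewrite /= !mxE /= mulr0 => /eqP; rewrite oner_eq0.
move: (ee 0 0) (ee 1 1); rewrite /= !mxE /= mulr1 => + c1; rewrite -c1 mul1r => /eqP.
by rewrite (eq_prim_root_expr pw) !modn_small ?ltn_ord // => /eqP /val_inj ->.
Qed.

(** * Irreducibility and dimension *)

Lemma mpoly_ring_ind n (R : comNzRingType) (K : {mpoly R[n]} -> Prop) :
  (forall c, K c%:MP) -> (forall i, K 'X_i) ->
  (forall p q, K p -> K q -> K (p + q)) -> (forall p q, K p -> K q -> K (p * q)) ->
  forall p, K p.
Proof.
move=> KC KX KD KM; apply: mpolyind => [|c m p _ _ Kp]; first by rewrite -mpolyC0.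
apply: (KD) => //; rewrite -mul_mpolyC mpolyXE_id; apply: (KM) => //.
elim/big_rec: _ => [|i x _ Kx]; first by rewrite -mpolyC1.
apply: (KM) => //; elim: (m i) => [|j IH]; first by rewrite expr0 -mpolyC1.
by rewrite exprS; apply: (KM).
Qed.

Section Zariski.
Variable n : nat.
Implicit Types (S V W : 'rV[algC]_n -> Prop) (P Q : {mpoly algC[n]}).

Lemma vanishesS S S' P : incl S S' -> vanishes_on S' P -> vanishes_on S P.
Proof. by move=> SS vP x Sx; apply/vP/SS. Qed.

Lemma incl_zclosure S : incl S (zclosure S).
Proof. by move=> x Sx P; apply. Qed.

Lemma vanishes_zclosure S P : vanishes_on (zclosure S) P <-> vanishes_on S P.
Proof.
split; first exact: vanishesS (@incl_zclosure S).
by move=> vP x /(_ P vP).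
Qed.

Lemma zclosed_zclosure S : zclosed (zclosure S).
Proof. by exists (vanishes_on S). Qed.

Lemma zclosure_min S V : zclosed V -> incl S V -> incl (zclosure S) V.
Proof. by move=> [I VI] SV x Sx; apply/VI => P IP; apply: Sx => y /SV/VI; apply. Qed.

Lemma zclosed_zero P : zclosed (fun x => P.@[x ord0] = 0).
Proof. by exists (fun Q => Q = P) => x; split=> [e Q ->|]; [|apply]. Qed.

Lemma not_incl V V' : zclosed V' -> ~ incl V V' ->
  exists2 P, vanishes_on V' P & ~ vanishes_on V P.
Proof.
move=> [I VI] nVV; apply: NNPP => nP; apply: nVV => x Vx; apply/VI => P IP.
apply: NNPP => nPx; apply: nP; exists P; first by move=> y /VI; apply.
by move/(_ x Vx).
Qed.

Definition zprime S := forall P Q, vanishes_on S (P * Q) ->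
  vanishes_on S P \/ vanishes_on S Q.

Lemma zclosure_irreducible S : (exists x, S x) -> zprime S -> zirreducible (zclosure S).
Proof.
move=> [x Sx] prS; split; first by exists x; apply: incl_zclosure.
move=> V1 V2 c1 c2 cov.
have [|n1] := classic (incl (zclosure S) V1); first by left.
have [|n2] := classic (incl (zclosure S) V2); first by right.
have [P1 v1] := not_incl c1 n1; have [P2 v2] := not_incl c2 n2.
rewrite !vanishes_zclosure => nP2 nP1.
have : vanishes_on S (P1 * P2).
  move=> y /incl_zclosure/cov[/v1|/v2]; rewrite mevalM => ->; by rewrite ?mul0r ?mulr0.
by case/prS.
Qed.

Lemma zirreducible_prime V : zirreducible V -> zprime V.
Proof.
move=> [_ irr] P Q vPQ.
have [x Vx|h|h] := irr _ _ (zclosed_zero P) (zclosed_zero Q); [|by left|by right].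
by have /eqP := vPQ x Vx; rewrite mevalM mulf_eq0 => /orP[]/eqP; [left|right].
Qed.

Definition pt_set (x : 'rV[algC]_n) : 'rV[algC]_n -> Prop := fun y => y = x.

Lemma zclosed_point x : zclosed (pt_set x).
Proof.
exists (fun P => exists i : 'I_n, P = 'X_i - (x ord0 i)%:MP) => y; split=> [->|h].
  by move=> _ [i ->]; rewrite mevalB mevalXU mevalC subrr.
apply/rowP => i; have /eqP := h _ (ex_intro _ i erefl).
by rewrite mevalB mevalXU mevalC subr_eq0 => /eqP.
Qed.

Lemma zclosed_union V1 V2 : zclosed V1 -> zclosed V2 -> zclosed (fun x => V1 x \/ V2 x).
Proof.
move=> [I1 h1] [I2 h2].
exists (fun P => exists P1 P2, [/\ I1 P1, I2 P2 & P = P1 * P2]) => x; split.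
  by case=> [/h1|/h2] h _ [P1 [P2 [i1 i2 ->]]]; rewrite mevalM;
    [rewrite (h P1 i1) mul0r|rewrite (h P2 i2) mulr0].
move=> h; have [|n1] := classic (V1 x); [by left|right].
apply/h2 => Q IQ; apply: NNPP => nQ; apply: n1; apply/h1 => P IP.
have /eqP := h (P * Q) (ex_intro _ P (ex_intro _ Q (And3 IP IQ erefl))).
by rewrite mevalM mulf_eq0 => /orP[]/eqP.
Qed.

Lemma zirreducible_point x : zirreducible (pt_set x).
Proof.
split; first by exists x.
by move=> V1 V2 _ _ /(_ x erefl)[h|h]; [left|right] => y ->.
Qed.

Lemma zclosed_seq (l : seq 'rV[algC]_n) : zclosed (fun x => x \in l).
Proof.
elim: l => [|a l IH].
  exists (fun P => P = 1) => x; split=> // /(_ 1 erefl) /eqP.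
  by rewrite meval1 oner_eq0.
have [I h] := zclosed_union (zclosed_point a) IH.
exists I => x; rewrite -h inE; split=> [/orP[/eqP|]|[->|->]]; rewrite ?eqxx ?orbT //;
  by [left|right].
Qed.

Lemma zirreducible_finite W (l : seq 'rV[algC]_n) : zirreducible W ->
  (forall x, W x -> x \in l) -> exists x, incl W (pt_set x).
Proof.
move=> [[x0 Wx0] irr]; elim: l => [/(_ _ Wx0)//|a l IH sub].
have [x /sub|h|/IH //] := irr _ _ (zclosed_point a) (zclosed_seq l).
  by rewrite inE => /orP[/eqP|]; [left|right].
by exists a.
Qed.

Lemma has_chainS V d : has_chain V d.+1 -> has_chain V d.
Proof.
move=> [W [h1 h2 h3]]; exists W; split=> [i li|i li|x Wx].
- by apply: h1; apply: leqW.
- by apply: h2; apply: leqW.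
by apply: h3; case: (h2 d (ltnSn d)) => + _; apply.
Qed.

Lemma has_chain_leq V d d' : (d <= d')%N -> has_chain V d' -> has_chain V d.
Proof.
move=> /subnK <-; elim: (d' - d)%N => [|k IH]; first by rewrite add0n.
by rewrite addSn => /has_chainS.
Qed.

Lemma has_dim_uniq V d d' : has_dim V d -> has_dim V d' -> d = d'.
Proof.
move=> [c n1] [c' n2]; apply/eqP; rewrite eqn_leq.
apply/andP; split; rewrite leqNgt; apply/negP => l; [apply: n2|apply: n1];
  exact: has_chain_leq l _.
Qed.

Lemma singular_pointE V d x : has_dim V d -> singular_point V x <->
  V x /\ exists2 W : 'M[algC]_(d.+1, n), row_free W & forall i, tangent V x (row i W).
Proof.
move=> hd; split=> [[Vx [d' [hd' [W rW tW]]]]|[Vx [W rW tW]]].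
  by split=> //; move: W rW tW; rewrite -(has_dim_uniq hd hd') => W rW tW; exists W.
by split=> //; exists d; split=> //; exists W.
Qed.

End Zariski.

(** * Dimension and algebraic independence *)

Section Independence.
Variable n : nat.
Implicit Types (V W : 'rV[algC]_n -> Prop).

(** [A] is meant as an iterated polynomial ring and [ev] as the substitution of chosen polynomials
    for its variables; these are then algebraically independent as functions on [V]. [ev_next] adds
    one variable. *)
Definition indep (A : comNzRingType) (ev : A -> {mpoly algC[n]}) V : Prop :=
  forall R, vanishes_on V (ev R) -> R = 0.

Definition ev_next (A : comNzRingType) (ev : {rmorphism A -> {mpoly algC[n]}})
    (P : {mpoly algC[n]}) : {rmorphism {poly A} -> {mpoly algC[n]}} :=
  (horner_eval P \o map_poly ev : {rmorphism {poly A} -> {mpoly algC[n]}}).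

Lemma ev_nextE (A : comNzRingType) (ev : {rmorphism A -> {mpoly algC[n]}}) P (R : {poly A}) :
  ev_next ev P R = (map_poly ev R).[P].
Proof. by []. Qed.

(* Krull dimension via transcendence degree: a polynomial vanishing on [W] but
   not on the larger irreducible set [W'] is a new independent element. *)
Lemma indep_next (A : comNzRingType) (ev : {rmorphism A -> {mpoly algC[n]}}) P W W' :
  indep ev W -> zprime W' -> incl W W' -> vanishes_on W P -> ~ vanishes_on W' P ->
  indep (ev_next ev P) W'.
Proof.
move=> iW pW' WW' vP nP; apply: poly_ind => [//|R c IH].
rewrite ev_nextE rmorphD rmorphM /= map_polyX map_polyC hornerD hornerMX hornerC => v.
have c0 : c = 0.
  apply: iW => x Wx; move: (v x (WW' x Wx)); rewrite mevalD mevalM (vP x Wx) mulr0 add0r.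
  by [].
have R0 : R = 0.
  by apply: IH; move: v; rewrite c0 raddf0 addr0 => /pW'[|/nP].
by rewrite R0 c0 mul0r add0r polyC0.
Qed.

Definition ev0 : {rmorphism algC -> {mpoly algC[n]}} := @mpolyC n algC.

(** Every strict inclusion supplies a function independent of the earlier ones, starting from the
    constants on the smallest member, which is nonempty. *)
Lemma chain3_indep V : has_chain V 3 -> exists P1 P2 P3,
  indep (ev_next (ev_next (ev_next ev0 P1) P2) P3) V.
Proof.
move=> [W [irr inc WV]].
have cl i : (i <= 3)%N -> zclosed (W i) by move=> /irr[].
have pr i : (i <= 3)%N -> zprime (W i) by move=> /irr[_ /zirreducible_prime].
have step i : (i < 3)%N -> exists2 P, vanishes_on (W i) P & ~ vanishes_on (W i.+1) P.
  by move=> li; apply: not_incl; [apply: cl; apply: ltnW|have [] := inc i li].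
have [P1 v1 n1] := step 0%N isT; have [P2 v2 n2] := step 1%N isT;
  have [P3 v3 n3] := step 2%N isT.
have [i01 _] := inc 0%N isT; have [i12 _] := inc 1%N isT; have [i23 _] := inc 2%N isT.
have I0 : indep ev0 (W 0%N).
  move=> c v; have [_ [[x Wx] _]] := irr 0%N isT.
  by have := v x Wx; rewrite /= mevalC.
have I1 := indep_next I0 (pr 1%N isT) i01 v1 n1.
have I2 := indep_next I1 (pr 2%N isT) i12 v2 n2.
have I3 := indep_next I2 (pr 3%N isT) i23 v3 n3.
by exists P1, P2, P3 => R v; apply: I3 => x Wx; apply/v/WV.
Qed.

End Independence.

Lemma lin_dep (E D : finType) (F : E -> D -> algC) : (#|D| < #|E|)%N ->
  exists2 c : E -> algC, (exists e, c e != 0) & forall d, \sum_e c e * F e d = 0.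
Proof.
move=> lDE; pose M : 'M[algC]_(#|E|, #|D|) := \matrix_(i, j) F (enum_val i) (enum_val j).
have nk : kermx M != 0.
  rewrite -mxrank_eq0 mxrank_ker subn_eq0 -ltnNge.
  exact: leq_ltn_trans (rank_leq_col M) lDE.
have [i ni] : exists i, row i (kermx M) != 0.
  apply/existsP; apply: contraNT nk; rewrite negb_exists => /forallP h.
  by apply/eqP/row_matrixP => i; rewrite row0; apply/eqP; have := h i; rewrite negbK.
have [j nj] : exists j, kermx M i j != 0.
  apply/existsP; apply: contraNT ni; rewrite negb_exists => /forallP h.
  by apply/eqP/rowP => j; rewrite mxE [RHS]mxE; apply/eqP; have := h j; rewrite negbK.
exists (fun e => kermx M i (enum_rank e)).
  by exists (enum_val j); rewrite enum_valK.
move=> d; transitivity ((kermx M *m M) i (enum_rank d)); last first.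
  by rewrite mulmx_ker mxE.
rewrite mxE [RHS](reindex enum_rank) /=; last first.
  by exists enum_val => x _; rewrite ?enum_valK ?enum_rankK.
by apply: eq_bigr => e _; rewrite [M _ _]mxE !enum_rankK.
Qed.

(** * Cuspidal curves *)

Lemma poly_eq0_nonzero (p : {poly algC}) : (forall s, s != 0 -> p.[s] = 0) -> p = 0.
Proof.
move=> h; have : p * 'X = 0.
  apply: poly_eq0_horner => s; rewrite hornerMX; have [->|/h ->] := eqVneq s 0.
    by rewrite mulr0.
  by rewrite mul0r.
by move/eqP; rewrite mulf_eq0 polyX_eq0 orbF => /eqP.
Qed.

(* [f] is a Laurent polynomial in [s] vanishing to order at least [k] at [-1]. *)
Definition Ord (k : nat) (f : algC -> algC) : Prop :=
  exists N (r : {poly algC}), forall s, s != 0 -> s ^+ N * f s = (s + 1) ^+ k * r.[s].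

Lemma Ord_ext k f g : (forall s, s != 0 -> f s = g s) -> Ord k f -> Ord k g.
Proof. by move=> e [N [r h]]; exists N, r => s ns; rewrite -e // h. Qed.

Lemma Ord_const c : Ord 0 (fun=> c).
Proof. by exists 0%N, c%:P => s _; rewrite hornerC !expr0. Qed.

Lemma Ord0 k : Ord k (fun=> 0).
Proof. by exists 0%N, 0 => s _; rewrite horner0 !mulr0. Qed.

Lemma OrdD k f g : Ord k f -> Ord k g -> Ord k (fun s => f s + g s).
Proof.
move=> [N [r hr]] [M [q hq]]; exists (N + M)%N, ('X^M * r + 'X^N * q) => s ns.
rewrite !(hornerD, hornerM, hornerXn) exprD.
transitivity (s ^+ M * (s ^+ N * f s) + s ^+ N * (s ^+ M * g s)); first by ring.
by rewrite hr // hq //; ring.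
Qed.

Lemma OrdM j k f g : Ord j f -> Ord k g -> Ord (j + k) (fun s => f s * g s).
Proof.
move=> [N [r hr]] [M [q hq]]; exists (N + M)%N, (r * q) => s ns.
by rewrite hornerM !exprD mulrACA hr // hq //; ring.
Qed.

Lemma OrdW j k f : (k <= j)%N -> Ord j f -> Ord k f.
Proof.
move=> kj [N [r h]]; exists N, (('X + 1) ^+ (j - k) * r) => s ns.
by rewrite h // hornerM horner_exp hornerD hornerX hornerC [RHS]mulrA -exprD subnKC.
Qed.

Lemma OrdZ k c f : Ord k f -> Ord k (fun s => c * f s).
Proof. by move=> h; apply: (OrdM (Ord_const c) h). Qed.

Lemma OrdN k f : Ord k f -> Ord k (fun s => - f s).
Proof. by move=> h; apply: Ord_ext (OrdZ (-1) h) => s _; rewrite mulN1r. Qed.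

Lemma OrdB k f g : Ord k f -> Ord k g -> Ord k (fun s => f s - g s).
Proof. by move=> hf /OrdN; apply: OrdD. Qed.

Lemma Ord_sum k n (f : 'I_n -> algC -> algC) :
  (forall i, Ord k (f i)) -> Ord k (fun s => \sum_i f i s).
Proof.
move=> h; have : forall l, Ord k (fun s => \sum_(i <- l) f i s).
  elim=> [|i l IH]; first by apply: Ord_ext (Ord0 k) => s _; rewrite big_nil.
  by apply: Ord_ext (OrdD (h i) IH) => s _; rewrite big_cons.
by move=> /(_ (index_enum _)).
Qed.

Lemma Ord_meval n (F : algC -> 'I_n -> algC) (P : {mpoly algC[n]}) :
  (forall i, Ord 0 (fun s => F s i)) -> Ord 0 (fun s => P.@[F s]).
Proof.
move=> hF; elim/mpoly_ring_ind: P => [c|i|p q hp hq|p q hp hq].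
- by apply: Ord_ext (Ord_const c) => s _; rewrite mevalC.
- by apply: Ord_ext (hF i) => s _; rewrite mevalXU.
- by apply: Ord_ext (OrdD hp hq) => s _; rewrite mevalD.
by apply: Ord_ext (OrdM hp hq) => s _; rewrite mevalM.
Qed.

(** The numerator [r] of the Laurent polynomial satisfies [r * e = 0], so finitely many missing
    parameters do not matter. *)
Lemma Ord_eq0 f (e : {poly algC}) : e != 0 -> Ord 0 f ->
  (forall s, s != 0 -> e.[s] != 0 -> f s = 0) -> forall s, s != 0 -> f s = 0.
Proof.
move=> ne [N [r h]] f0 s ns.
have : r * e = 0.
  apply: poly_eq0_nonzero => t nt; rewrite hornerM; have [->|net] := eqVneq e.[t] 0.
    by rewrite mulr0.
  by have := h t nt; rewrite f0 // mulr0 expr0 mul1r => <-; rewrite mul0r.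
move/eqP; rewrite mulf_eq0 (negPf ne) orbF => /eqP r0.
have /eqP := h s ns; rewrite r0 horner0 mulr0 mulf_eq0 expf_eq0 (negPf ns) andbF /=.
by move/eqP.
Qed.

Lemma Ord_mul_eq0 f g : Ord 0 f -> Ord 0 g -> (forall s, s != 0 -> f s * g s = 0) ->
  (forall s, s != 0 -> f s = 0) \/ (forall s, s != 0 -> g s = 0).
Proof.
move=> [N [r hr]] [M [q hq]] fg.
have key (h : algC -> algC) K (p : {poly algC}) : p = 0 ->
    (forall s, s != 0 -> s ^+ K * h s = (s + 1) ^+ 0 * p.[s]) -> forall s, s != 0 -> h s = 0.
  move=> -> hp s ns; have /eqP := hp s ns.
  by rewrite horner0 mulr0 mulf_eq0 expf_eq0 (negPf ns) andbF /= => /eqP.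
have /eqP : r * q = 0.
  apply: poly_eq0_nonzero => s ns; rewrite hornerM.
  transitivity ((s + 1) ^+ 0 * r.[s] * ((s + 1) ^+ 0 * q.[s])); first by rewrite !expr0 !mul1r.
  by rewrite -hr // -hq // mulrACA fg // mulr0.
by rewrite mulf_eq0 => /orP[]/eqP h; [left; apply: key h hr|right; apply: key h hq].
Qed.

Lemma mevalX_deriv n (v : 'I_n -> algC) i j : (('X_j : {mpoly algC[n]})^`M(i)).@[v] = (j ==
  i)%:R.
Proof.
rewrite mderivX mevalZ mnm1E; case: eqP => [->|_]; last by rewrite mul0r.
have -> : (U_(i) - U_(i) = 0)%MM by apply/mnmP => l; rewrite mnmBE subnn mnm0E.
by rewrite mpolyX0 meval1 mulr1.
Qed.

Definition lin_part n (x w : 'I_n -> algC) (P : {mpoly algC[n]}) : algC :=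
  \sum_i (P^`M(i)).@[x] * w i.

Lemma lin_partC n (x w : 'I_n -> algC) c : lin_part x w c%:MP = 0.
Proof. by rewrite /lin_part big1 // => i _; rewrite mderivC meval0 mul0r. Qed.

Lemma lin_partX n (x w : 'I_n -> algC) j : lin_part x w 'X_j = w j.
Proof.
rewrite /lin_part (bigD1 j) //= mevalX_deriv eqxx mul1r big1 ?addr0 // => i nij.
by rewrite mevalX_deriv eq_sym (negPf nij) mul0r.
Qed.

Lemma lin_partD n (x w : 'I_n -> algC) P Q :
  lin_part x w (P + Q) = lin_part x w P + lin_part x w Q.
Proof.
by rewrite /lin_part -big_split; apply: eq_bigr => i _; rewrite mderivD mevalD mulrDl.
Qed.

Lemma lin_partM n (x w : 'I_n -> algC) P Q :
  lin_part x w (P * Q) = P.@[x] * lin_part x w Q + Q.@[x] * lin_part x w P.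
Proof.
rewrite /lin_part !mulr_sumr -big_split; apply: eq_bigr => i _.
by rewrite mderivM mevalD !mevalM /=; ring.
Qed.

Lemma lin_partN n (x w : 'I_n -> algC) P : lin_part x w (- P) = - lin_part x w P.
Proof. by rewrite /lin_part -sumrN; apply: eq_bigr => i _; rewrite mderivN mevalN mulNr. Qed.

Lemma lin_partB n (x w : 'I_n -> algC) P Q :
  lin_part x w (P - Q) = lin_part x w P - lin_part x w Q.
Proof. by rewrite lin_partD lin_partN. Qed.

(** The remainder is at least quadratic in the displacement [F - x], so its order is twice that of
    the displacement. The Leibniz rule carries this through products, by induction on [P]. *)
Lemma taylor_Ord n k (F : algC -> 'I_n -> algC) (x : 'I_n -> algC) (P : {mpoly algC[n]}) :
  (forall i, Ord k (fun s => F s i - x i)) ->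
  Ord (k + k) (fun s => P.@[F s] - P.@[x] - lin_part x (fun i => F s i - x i) P).
Proof.
move=> h; have reg Q : Ord 0 (fun s => Q.@[F s]).
  apply: Ord_meval => i; apply: Ord_ext (OrdD (OrdW (leq0n k) (h i)) (Ord_const (x i))) => s _.
  by rewrite subrK.
have L Q : Ord k (fun s => lin_part x (fun i => F s i - x i) Q).
  by apply: Ord_sum => i; apply: OrdZ.
elim/mpoly_ring_ind: P => [c|i|p q hp hq|p q hp hq].
- by apply: Ord_ext (Ord0 _) => s _; rewrite lin_partC !mevalC !subrr.
- by apply: Ord_ext (Ord0 _) => s _; rewrite lin_partX !mevalXU subrr.
- by apply: Ord_ext (OrdD hp hq) => s _; rewrite lin_partD !mevalD; ring.
have h1 := OrdM hp (reg q); rewrite addn0 in h1.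
have h2 := OrdM (OrdD (Ord_const p.@[x]) (OrdW (leq0n k) (L p))) hq; rewrite add0n in h2.
apply: Ord_ext (OrdD (OrdD h1 h2) (OrdM (L p) (L q))) => s _ /=.
by rewrite lin_partM !mevalM; ring.
Qed.

Definition cusp_a (s : algC) : algC := (s + 1) ^+ 2 / s.
Definition cusp_b (s : algC) : algC := (s + 1) ^+ 2 / s ^+ 2.
Definition cusp_ab (s : algC) (j : 'I_2) : algC := if j == 0 then cusp_a s else cusp_b s.

Lemma Ord_cusp_a : Ord 2 cusp_a.
Proof. by exists 1%N, 1 => s ns; rewrite hornerC /cusp_a; field. Qed.

Lemma Ord_cusp_b : Ord 2 cusp_b.
Proof. by exists 2%N, 1 => s ns; rewrite hornerC /cusp_b; field. Qed.

Lemma Ord_cusp_ab j : Ord 2 (fun s => cusp_ab s j).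
Proof. by rewrite /cusp_ab; case: (j == 0); [apply: Ord_cusp_a|apply: Ord_cusp_b]. Qed.

(* [cusp_a] and [cusp_b] vanish to order 2 and [cusp_a + cusp_b] to order 3. *)
Lemma Ord4_cusp x y : Ord 4 (fun s => x * cusp_a s + y * cusp_b s) -> x = 0 /\ y = 0.
Proof.
move=> [N [r h]].
have nX1 : 'X + 1 != 0 :> {poly algC} by rewrite -size_poly_eq0 -polyC1 size_XaddC.
have e : (x%:P * 'X + y%:P) * 'X^N = ('X + 1) ^+ 2 * 'X^2 * r.
  apply/eqP; rewrite -subr_eq0; apply/eqP.
  have : ('X + 1) ^+ 2 * ((x%:P * 'X + y%:P) * 'X^N - ('X + 1) ^+ 2 * 'X^2 * r) = 0.
    apply: poly_eq0_nonzero => s ns; rewrite !(hornerE, horner_exp, hornerXn) /=.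
    have := h s ns; rewrite /cusp_a /cusp_b => hs.
    transitivity (s ^+ 2 * (s ^+ N * (x * ((s + 1) ^+ 2 / s) + y * ((s + 1) ^+ 2 / s ^+ 2)) -
      (s + 1) ^+ 4 * r.[s])); last by rewrite hs subrr mulr0.
    by move: (s ^+ N) (r.[s]) => S R; field.
  by move/eqP; rewrite mulf_eq0 expf_eq0 (negPf nX1) /= => /eqP.
have nm : (-1 : algC) ^+ N != 0 by rewrite expf_neq0 // oppr_eq0 oner_eq0.
have yx : y = x.
  have := congr1 (fun p : {poly algC} => p.[-1]) e.
  rewrite /= !(hornerE, horner_exp, hornerXn) /= => e1.
  apply/eqP; rewrite -subr_eq0; apply/eqP; apply: (mulIf nm); rewrite mul0r.
  transitivity ((x * -1 + y) * (-1) ^+ N); first by ring.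
  by rewrite e1; ring.
have e2 : x%:P * 'X^N = ('X + 1) * 'X^2 * r.
  apply: (mulfI nX1); transitivity ((x%:P * 'X + y%:P) * 'X^N); first by rewrite yx; ring.
  by rewrite e; ring.
have x0 : x = 0.
  have := congr1 (fun p : {poly algC} => p.[-1]) e2.
  rewrite /= !(hornerE, horner_exp, hornerXn) /= => e1.
  by apply: (mulIf nm); rewrite e1; ring.
by rewrite yx x0.
Qed.

Lemma tangentE n (V : 'rV[algC]_n -> Prop) x w :
  tangent V x w <-> forall P, vanishes_on V P -> lin_part (x ord0) (w ord0) P = 0.
Proof. by []. Qed.

(** * Curves isomorphic to the cuspidal cubic *)

Section CuspidalCurve.
Variables (n : nat) (gam : 'I_n -> {mpoly algC[2]}) (al be : {mpoly algC[n]}).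
Variable (S : algC -> Prop) (e : {poly algC}).

(** [gam] carries the plane cubic into n-space and the polynomials [al], [be] recover [a] and [b],
    so the image is an isomorphic copy. [S] may omit roots of [e]: the closure restores those
    points. *)
Definition cusp_param (s : algC) : 'rV[algC]_n := \row_i (gam i).@[cusp_ab s].
Definition cusp_curve : 'rV[algC]_n -> Prop :=
  zclosure (fun x => exists2 s, S s & x = cusp_param s).

Hypothesis al_param : forall s, s != 0 -> al.@[cusp_param s ord0] = cusp_a s.
Hypothesis be_param : forall s, s != 0 -> be.@[cusp_param s ord0] = cusp_b s.
Hypothesis ne : e != 0.
Hypothesis S_neq0 : forall s, S s -> s != 0.
Hypothesis S_generic : forall s, s != 0 -> e.[s] != 0 -> S s.

Let phi := cusp_param.
Let V := cusp_curve.

Lemma Ord_param i : Ord 0 (fun s => phi s ord0 i).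
Proof.
apply: (@Ord_ext _ (fun s => (gam i).@[cusp_ab s])) => [s _|]; first by rewrite mxE.
by apply: Ord_meval => j; apply: OrdW (Ord_cusp_ab j).
Qed.

Lemma Ord_mparam (P : {mpoly algC[n]}) : Ord 0 (fun s => P.@[phi s ord0]).
Proof. by apply: Ord_meval => i; apply: Ord_param. Qed.

Lemma vanishes_curve P : vanishes_on V P <-> forall s, s != 0 -> P.@[phi s ord0] = 0.
Proof.
rewrite vanishes_zclosure; split=> [v|v _ [s Ss ->]]; last exact: v (S_neq0 Ss).
by apply: (Ord_eq0 ne (Ord_mparam P)) => s ns nes; apply: v; exists s => //; apply: S_generic.
Qed.

Lemma param_in_curve s : s != 0 -> V (phi s).
Proof. by move=> ns P v; have /vanishes_curve/(_ s ns) : vanishes_on V P by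
  apply/vanishes_zclosure. Qed.

Lemma curve_prime : zprime (fun x => exists2 s, S s & x = phi s).
Proof.
have E P : vanishes_on (fun x => exists2 s, S s & x = phi s) P <-> forall s, s != 0 -> P.@[phi
  s ord0] = 0.
  by rewrite -vanishes_curve vanishes_zclosure.
move=> P Q /E v; rewrite !E; apply: Ord_mul_eq0; try exact: Ord_mparam.
by move=> s ns; have := v s ns; rewrite mevalM.
Qed.

Lemma curve_irreducible : zirreducible V.
Proof.
apply: zclosure_irreducible curve_prime.
have [s] : exists s, (e * 'X).[s] != 0.
  apply: NNPP => h; have /eqP : e * 'X = 0.
    apply: poly_eq0_horner => s; apply/eqP/negPn/negP => hs; apply: h; by exists s.
  by rewrite mulf_eq0 (negPf ne) polyX_eq0.
rewrite hornerMX mulf_eq0 negb_or => /andP[nes ns].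
by exists (phi s); exists s => //; apply: S_generic.
Qed.

Definition curve_eq : {mpoly algC[n]} := al ^+ 2 * be - (al + be) ^+ 2.
Definition curve_graph i : {mpoly algC[n]} := 'X_i - (gam i \mPo [tuple al; be]).

Lemma meval_comp2 (P : {mpoly algC[2]}) x :
  (P \mPo [tuple al; be]).@[x] = P.@[fun j => if j == 0 then al.@[x] else be.@[x]].
Proof.
rewrite comp_mpoly_meval; apply: meval_eq => j; rewrite (tnth_nth 0).
by case: j => [[|[|]]].
Qed.

Lemma curve_eq_vanishes : vanishes_on V curve_eq.
Proof.
apply/vanishes_curve => s ns.
rewrite /curve_eq mevalB mevalM !rmorphXn /= mevalD al_param // be_param // /cusp_a /cusp_b.
by field.
Qed.

Lemma curve_graph_vanishes i : vanishes_on V (curve_graph i).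
Proof.
apply/vanishes_curve => s ns; rewrite /curve_graph mevalB mevalXU meval_comp2.
rewrite al_param // be_param // mxE; apply/eqP; rewrite subr_eq0; apply/eqP.
by apply: meval_eq.
Qed.

(** The closure adds nothing beyond the parameters [s != 0]: [curve_graph] determines [x] from its
    values [A] and [B] under [al] and [be], and [A^2 B = (A + B)^2] is solved by [s = A / B], or by
    [s = -1] when [B = 0]. *)
Lemma curve_point x : V x -> exists2 s, s != 0 & x = phi s.
Proof.
move=> Vx; have vx P : vanishes_on V P -> P.@[x ord0] = 0 by move=> /(_ x Vx).
have := vx _ curve_eq_vanishes.
rewrite /curve_eq mevalB mevalM !rmorphXn /= mevalD => /eqP; rewrite subr_eq0 => /eqP.
set A := al.@[_]; set B := be.@[_] => AB.
have xi i : x ord0 i = (gam i).@[fun j => if j == 0 then A else B].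
  have := vx _ (curve_graph_vanishes i).
  by rewrite /curve_graph mevalB mevalXU meval_comp2 => /eqP; rewrite subr_eq0 => /eqP.
have done s : cusp_a s = A -> cusp_b s = B -> x = phi s.
  by move=> ea eb; apply/rowP => i; rewrite xi mxE /cusp_ab ea eb.
have [B0|nB] := eqVneq B 0.
  have A0 : A = 0 by move: AB; rewrite B0 mulr0 addr0 => /esym/eqP; rewrite expf_eq0 => /eqP.
  exists (-1); first by rewrite oppr_eq0 oner_eq0.
  by apply: done; rewrite /cusp_a /cusp_b addNr expr0n mul0r.
have nA : A != 0.
  apply: contraNneq nB => A0; move: AB; rewrite A0 expr0n mul0r add0r => /esym/eqP.
  by rewrite expf_eq0.
have ea : cusp_a (A / B) = A.
  rewrite /cusp_a; transitivity ((A + B) ^+ 2 / (A * B)); first by field; rewrite nA nB.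
  by rewrite -AB; field; rewrite nA nB.
exists (A / B); first by rewrite mulf_neq0 ?invr_eq0.
apply: done => //; rewrite /cusp_b; transitivity (cusp_a (A / B) / (A / B)).
  by rewrite /cusp_a; field; rewrite nA nB.
by rewrite ea; field; rewrite nA nB.
Qed.

Let m1 : (-1 : algC) != 0. Proof. by rewrite oppr_eq0 oner_eq0. Qed.

Lemma cusp_a_m1 : cusp_a (-1) = 0.
Proof. by rewrite /cusp_a addNr expr0n mul0r. Qed.
Lemma cusp_b_m1 : cusp_b (-1) = 0.
Proof. by rewrite /cusp_b addNr expr0n mul0r. Qed.

Lemma curve_chain1 : has_chain V 1.
Proof.
exists (fun i => if i == 0%N then pt_set (phi (-1)) else V); split=> [[|i] _|[|//] _|//] /=.
- by split; [apply: zclosed_point|apply: zirreducible_point].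
- by split; [apply: zclosed_zclosure|apply: curve_irreducible].
split; first by move=> _ ->; apply: param_in_curve.
move=> h; have e1 : cusp_param 1 = cusp_param (-1) := h _ (param_in_curve (oner_neq0 _)).
have := al_param (oner_neq0 _); rewrite e1 al_param // cusp_a_m1 /cusp_a divr1 => /esym/eqP.
by rewrite expf_eq0 /= -[1 + 1]/(2%:R) pnatr_eq0.
Qed.

(** A proper closed subset lies in the zero set of a nonzero Laurent polynomial, which is finite; if
    irreducible, it is a point and has no room for a smaller member of the chain. *)
Lemma curve_no_chain2 : ~ has_chain V 2.
Proof.
move=> [W [irr inc WV]].
have [i01 n01] := inc 0%N isT; have [i12 n12] := inc 1%N isT.
have [P v1 nP2] := not_incl (irr 1%N isT).1 n12.
have [N [r hr]] := Ord_mparam P.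
have nr : r != 0.
  apply/eqP => r0; apply: nP2 => x /WV/curve_point[s ns ->].
  have /eqP := hr s ns; rewrite r0 horner0 mulr0 mulf_eq0 expf_eq0 (negPf ns) andbF /=.
  by move/eqP.
have fin x : W 1%N x -> x \in [seq phi s | s <- poly_roots r].
  move=> W1x; have [s ns xs] := curve_point (WV _ (i12 _ W1x)).
  rewrite xs map_f //; have := poly_rootsP r => er.
  have : root r s.
    apply/rootP; have := hr s ns; rewrite expr0 mul1r => <-.
    by rewrite -xs (v1 x W1x) mulr0.
  by rewrite {1}er rootZ ?lead_coef_eq0 // root_prod_XsubC.
have [x Wx] := zirreducible_finite (irr 1%N isT).2 fin.
have [_ [[z W0z] _]] := irr 0%N isT.
by apply: n01 => y /Wx ->; rewrite -(Wx _ (i01 _ W0z)).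
Qed.

Lemma curve_dim : has_dim V 1.
Proof. by split; [apply: curve_chain1|apply: curve_no_chain2]. Qed.

Lemma curve_irreducible_of_dim : irreducible_of_dim 1 V.
Proof. by split; [apply: zclosed_zclosure|apply: curve_irreducible|apply: curve_dim]. Qed.

Let x0 := phi (-1).
Let dga i := ((gam i)^`M(0)).@[fun=> 0].
Let dgb i := ((gam i)^`M(1)).@[fun=> 0].

Lemma lin_part2 (w : 'I_2 -> algC) x (P : {mpoly algC[2]}) :
  lin_part x w P = (P^`M(0)).@[x] * w 0 + (P^`M(1)).@[x] * w 1.
Proof.
rewrite /lin_part !big_ord_recl big_ord0 addr0.
by congr (_ + (_^`M(_)).@[_] * w _); apply: val_inj.
Qed.

Lemma param_expansion i :
  Ord 4 (fun s => phi s ord0 i - x0 ord0 i - (dga i * cusp_a s + dgb i * cusp_b s)).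
Proof.
have h j : Ord 2 (fun s => cusp_ab s j - (fun=> 0) j).
  by apply: Ord_ext (Ord_cusp_ab j) => s _; rewrite subr0.
apply: Ord_ext (taylor_Ord (gam i) h) => s _.
rewrite lin_part2 /cusp_ab /= !subr0 /phi /x0 !mxE; congr (_ - _ - _).
by apply: meval_eq => j; rewrite /cusp_ab cusp_a_m1 cusp_b_m1; case: (j == 0).
Qed.

(** Along the curve the Taylor remainder has order 2 + 2, and modulo order 4 the functions [cusp_a]
    and [cusp_b] are still independent. So the expansion of [P] determines its derivatives in the
    directions [dga] and [dgb], the images of the [a] and [b] axes. *)
Lemma cusp_expansion P x y :
  Ord 4 (fun s => P.@[phi s ord0] - P.@[x0 ord0] - (x * cusp_a s + y * cusp_b s)) ->
  lin_part (x0 ord0) dga P = x /\ lin_part (x0 ord0) dgb P = y.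
Proof.
have h i : Ord 2 (fun s => phi s ord0 i - x0 ord0 i).
  apply: Ord_ext (OrdD (OrdW (isT : (2 <= 4)%N) (param_expansion i))
    (OrdD (OrdZ (dga i) Ord_cusp_a) (OrdZ (dgb i) Ord_cusp_b))) => s _.
  by rewrite subrK.
move=> oP; have o2 := taylor_Ord P h.
have o3 : Ord 4 (fun s => lin_part (x0 ord0) (fun i => phi s ord0 i - x0 ord0 i) P -
    (lin_part (x0 ord0) dga P * cusp_a s + lin_part (x0 ord0) dgb P * cusp_b s)).
  apply: Ord_ext (Ord_sum (fun i => OrdZ (P^`M(i)).@[x0 ord0] (param_expansion i))) => s _.
  rewrite /lin_part !mulr_suml -big_split -sumrB; apply: eq_bigr => i _ /=; ring.
have := @Ord4_cusp (lin_part (x0 ord0) dga P - x) (lin_part (x0 ord0) dgb P - y).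
case=> [|/eqP + /eqP]; last by rewrite !subr_eq0 => /eqP-> /eqP->.
apply: Ord_ext (OrdB oP (OrdD o2 o3)) => s _; ring.
Qed.

(** [dga] and [dgb] are tangent because a polynomial vanishing on the curve has zero expansion, and
    independent because the differentials of [al] and [be], the columns of [G], are dual to them. *)
Lemma curve_singular_cusp : singular_point V x0.
Proof.
apply/(singular_pointE _ curve_dim); split; first exact: param_in_curve.
pose W : 'M[algC]_(2, n) := \matrix_(j, i) if j == 0 then dga i else dgb i.
pose G : 'M[algC]_(n, 2) := \matrix_(i, j)
  ((if j == 0 then al else be)^`M(i)).@[x0 ord0].
have [aa ab] : lin_part (x0 ord0) dga al = 1 /\ lin_part (x0 ord0) dgb al = 0.
  apply: cusp_expansion; apply: Ord_ext (Ord0 4) => s ns.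
  by rewrite !al_param // cusp_a_m1; ring.
have [ba bb] : lin_part (x0 ord0) dga be = 0 /\ lin_part (x0 ord0) dgb be = 1.
  apply: cusp_expansion; apply: Ord_ext (Ord0 4) => s ns.
  by rewrite !be_param // cusp_b_m1; ring.
have WG (j k : 'I_2) : (W *m G) j k =
    lin_part (x0 ord0) (if j == 0 then dga else dgb) (if k == 0 then al else be).
  by rewrite mxE; apply: eq_bigr => i _; rewrite !mxE mulrC; case: (j == 0).
exists W.
  apply/row_freeP; exists G; apply: matrix2P; rewrite WG mxE /=; assumption.
move=> j; apply/tangentE => P vP.
have [ta tb] : lin_part (x0 ord0) dga P = 0 /\ lin_part (x0 ord0) dgb P = 0.
  apply: cusp_expansion; apply: Ord_ext (Ord0 4) => s ns.
  by rewrite !(vanishes_curve P).1 //; ring.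
have -> : lin_part (x0 ord0) (row j W ord0) P = lin_part (x0 ord0) (if j == 0 then dga else
  dgb) P.
  by apply: eq_bigr => i _; rewrite !mxE; case: (j == 0).
by case: (j == 0).
Qed.

Lemma lin_part_lincomb m (x : 'I_n -> algC) (c : 'rV[algC]_m) (W : 'M[algC]_(m, n)) P :
  lin_part x ((c *m W) ord0) P = \sum_j c ord0 j * lin_part x (row j W ord0) P.
Proof.
rewrite /lin_part; under [RHS]eq_bigr do rewrite mulr_sumr.
rewrite exchange_big; apply: eq_bigr => i _; rewrite mxE mulr_sumr.
by apply: eq_bigr => j _; rewrite mxE mulrCA.
Qed.

(** Away from the cusp the gradient of the plane cubic is nonzero, so two independent tangent
    vectors have dependent images under the differentials of [al] and [be]. Some nonzero combination
    [w] is killed by both, and the equations [curve_graph] then give [w = 0]. *)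
Lemma curve_smooth x : singular_point V x -> x = x0.
Proof.
case/(singular_pointE _ curve_dim) => Vx [W rW tW].
have vx P : vanishes_on V P -> P.@[x ord0] = 0 by move=> /(_ x Vx).
have := vx _ curve_eq_vanishes.
rewrite /curve_eq mevalB mevalM !rmorphXn /= mevalD => /eqP; rewrite subr_eq0 => /eqP AB.
set A := al.@[_] in AB; set B := be.@[_] in AB.
apply: NNPP => nx.
have nAB : (A != 0) || (B != 0).
  apply: contraT; rewrite negb_or !negbK => /andP[/eqP A0 /eqP B0]; case: nx.
  apply/rowP => i; have := vx _ (curve_graph_vanishes i).
  rewrite /curve_graph mevalB mevalXU meval_comp2 => /eqP; rewrite subr_eq0 => /eqP ->.
  rewrite mxE; apply: meval_eq => j; rewrite -/A -/B A0 B0 /cusp_ab cusp_a_m1 cusp_b_m1.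
  by case: (j == 0).
(* The partial derivatives of [a^2 b - (a + b)^2] at [(A, B)]. *)
pose p := 2 * A * B - 2 * (A + B); pose q := A ^+ 2 - 2 * (A + B).
have npq : (p != 0) || (q != 0).
  apply: contraTT nAB; rewrite !negb_or !negbK => /andP[/eqP p0 /eqP q0].
  have two : 2 != 0 :> algC by rewrite pnatr_eq0.
  have /eqP e1 : 2 * (A * B - (A + B)) = 0 by rewrite -[RHS]p0 /p; ring.
  have {}e1 : A + B = A * B by move: e1;
    rewrite mulf_eq0 (negPf two) subr_eq0 /= eq_sym => /eqP.
  have /eqP e2 : A * (A - 2 * B) = 0 by rewrite -[RHS]q0 /q e1; ring.
  have {AB} /eqP AB : A ^+ 2 * B * (1 - B) = 0.
    by transitivity (A ^+ 2 * B - (A * B) ^+ 2); [ring|rewrite -e1 AB subrr].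
  move: e2 AB e1; rewrite !mulf_eq0 orbb.
  have [-> _ _|nA /=] := eqVneq A 0; first by rewrite mul0r add0r => ->; rewrite eqxx.
  rewrite subr_eq0 => /eqP A2; have [-> _|nB /=] := eqVneq B 0.
    by rewrite addr0 mulr0 => A0; rewrite A0 eqxx in nA.
  rewrite subr_eq0 => /eqP B1; rewrite A2 -B1 !mulr1 => /eqP.
  by rewrite -subr_eq0 addrAC subrr add0r oner_eq0.
pose T : 'M[algC]_2 := \matrix_(k, j) lin_part (x ord0) (row j W ord0) (if k == 0 then al else
  be).
have Dcurve j : p * T 0 j + q * T 1 j = 0.
  have /tangentE/(_ _ curve_eq_vanishes) := tW j.
  rewrite /curve_eq lin_partB !expr2 !lin_partM !lin_partD mevalM mevalD -/A -/B => <-.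
  by rewrite !mxE /= /p /q; ring.
have /det0P[c nc cT] : \det T^T == 0.
  rewrite det_tr; apply/det0P; exists (\row_j if j == 0 then p else q).
    apply: contraTneq npq => /rowP r0; move: (r0 0) (r0 1); rewrite !mxE /= => -> ->.
    by rewrite eqxx.
  apply/rowP => j; rewrite mxE !big_ord_recl big_ord0 addr0 [RHS]mxE -(Dcurve j).
  by congr (_ * _ + _ * T _ _); rewrite ?mxE //; apply: val_inj.
pose w := c *m W.
have nw : w != 0 by rewrite /w; apply: contraNneq nc => /eqP; rewrite mulmx_free_eq0.
have Dw P : lin_part (x ord0) (w ord0) P = \sum_j c ord0 j * lin_part (x ord0) (row j W ord0)
  P.
  exact: lin_part_lincomb.
have Dab k : lin_part (x ord0) (w ord0) (if k == 0 :> 'I_2 then al else be) = 0.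
  transitivity ((c *m T^T) 0 k); last by rewrite cT mxE.
  by rewrite Dw [RHS]mxE; apply: eq_bigr => j _; rewrite !mxE.
have Dcomp P : lin_part (x ord0) (w ord0) (P \mPo [tuple al; be]) = 0.
  elim/mpoly_ring_ind: P => [d|j|P Q hP hQ|P Q hP hQ].
  - by rewrite comp_mpolyC lin_partC.
  - by rewrite comp_mpolyXU; have := Dab j; case: j => [[|[|]]].
  - by rewrite comp_mpolyD lin_partD hP hQ addr0.
  by rewrite rmorphM /= lin_partM hP hQ !mulr0 addr0.
case/eqP: nw; apply/rowP => i.
have : lin_part (x ord0) (w ord0) (curve_graph i) = 0.
  rewrite Dw big1 // => j _; have /tangentE-> := tW j; rewrite ?mulr0 //.
  exact: curve_graph_vanishes.
by rewrite lin_partB lin_partX Dcomp subr0 => ->; rewrite mxE.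
Qed.

Lemma curve_unique_singular : exists! x, singular_point V x.
Proof. by exists x0; split; [apply: curve_singular_cusp|move=> x /curve_smooth ->]. Qed.

End CuspidalCurve.

(** * Genus of the rational function field *)

Local Notation "x %:F" := (@FracField.tofrac _ x).

Lemma frac_repr (R : idomainType) (x : {fraction R}) :
  x = (frac (generic_quotient.repr x)).1%:F / (frac (generic_quotient.repr x)).2%:F.
Proof.
rewrite -{1}(reprK x); move: (generic_quotient.repr x) => y.
have nd : (frac y).2%:F != 0 :> {fraction R} by rewrite tofrac_eq0 denom_ratioP.
apply: (mulIf nd); rewrite divfK //; unlock FracField.tofrac.
rewrite -[_ * _]/(FracField.mul _ _) !piE; apply/eqmodP.
rewrite /= FracField.equivfE /FracField.mulf !numden_Ratio ?mulf_neq0 ?denom_ratioP ?oner_eq0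
  //.
by rewrite !mulr1 mulrC.
Qed.

Lemma fracP (R : idomainType) (x : {fraction R}) : exists n d : R, d != 0 /\ x = n%:F / d%:F.
Proof. by exists (frac (generic_quotient.repr x)).1, (frac (generic_quotient.repr x)).2;
  rewrite denom_ratioP -frac_repr. Qed.

Lemma divf_cancel (F : fieldType) (a b c : F) : c != 0 -> (a * c) / (b * c) = a / b.
Proof. by move=> nc; rewrite -mulf_div divff ?mulr1. Qed.

Lemma frac_cross (F : fieldType) (p q n d : F) : p != 0 -> q != 0 -> d != 0 ->
  p / q = n / d -> n != 0 /\ p * d = n * q.
Proof.
move=> np nq nd e; have e' : p * d = n * q by rewrite -[p](divfK nq) e; field.
by split=> //; apply: contraNneq (mulf_neq0 np nd) => n0; rewrite e' n0 mul0r.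
Qed.

Lemma div_neq0 (F : fieldType) (p q : F) : p != 0 -> q != 0 -> p / q != 0.
Proof. by move=> np nq; rewrite mulf_neq0 ?invr_eq0. Qed.

Definition ratfun : fieldType := {fraction {poly algC}}.
Definition rconst : {rmorphism algC -> ratfun} :=
  (@FracField.tofrac {poly algC} \o polyC : {rmorphism algC -> ratfun}).

Lemma rconstE c : rconst c = c%:P%:F. Proof. by []. Qed.

Lemma ratfunP (x : ratfun) : x != 0 -> exists p q : {poly algC},
  [/\ p != 0, q != 0, coprimep p q & x = p%:F / q%:F].
Proof.
have [n [d [nd ->]]] := fracP x => nx.
have nn : n != 0 by apply: contraNneq nx => ->; rewrite tofrac0 mul0r.
have ng : gcdp n d != 0 by rewrite gcdp_eq0 negb_and nn.
have en := divpK (dvdp_gcdl n d); have ed := divpK (dvdp_gcdr n d).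
exists (n %/ gcdp n d), (d %/ gcdp n d); split.
- by apply: contraNneq nn => e; rewrite -en e mul0r.
- by apply: contraNneq nd => e; rewrite -ed e mul0r.
- by apply: coprimep_div_gcd; rewrite nn.
have -> : n%:F = (n %/ gcdp n d)%:F * (gcdp n d)%:F :> ratfun by rewrite -tofracM en.
have -> : d%:F = (d %/ gcdp n d)%:F * (gcdp n d)%:F :> ratfun by rewrite -tofracM ed.
by apply/divf_cancel; rewrite tofrac_eq0.
Qed.

Definition point_order (Q : option algC) (c : algC) : int :=
  if Q is Some a then (c == a)%:Z else -1.

Section Place.
Variable v : ratfun -> int.
Hypothesis pv : place rconst v.

Lemma place0 : v 0 = 0. Proof. by case: pv. Qed.
Lemma placeM x y : x != 0 -> y != 0 -> v (x * y) = v x + v y.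
Proof. by case: pv => _ + _ _ _; apply. Qed.
Lemma placeD x y : x != 0 -> y != 0 -> x + y != 0 -> Num.min (v x) (v y) <= v (x + y).
Proof. by case: pv => _ _ + _ _; apply. Qed.
Lemma placeC c : c != 0 -> v c%:P%:F = 0.
Proof. by case: pv => _ _ _ + _; apply. Qed.

Lemma placeC0 c : v c%:P%:F = 0.
Proof. by have [->|/placeC//] := eqVneq c 0; rewrite polyC0 tofrac0 place0. Qed.

Lemma place1 : v 1 = 0.
Proof. by rewrite -tofrac1 -polyC1 placeC0. Qed.

Lemma placeV x : v x^-1 = - v x.
Proof.
have [->|nx] := eqVneq x 0; first by rewrite invr0 place0 oppr0.
by apply/eqP; rewrite -addr_eq0 -placeM ?invr_eq0 // mulVf // place1.
Qed.

Lemma placeX x n : x != 0 -> v (x ^+ n) = v x *+ n.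
Proof.
move=> nx; elim: n => [|n IH]; first by rewrite expr0 place1.
by rewrite exprS placeM ?expf_neq0 // IH mulrS.
Qed.

Lemma XsubC_neq0 a : ('X - a%:P)%:F != 0 :> ratfun.
Proof. by rewrite tofrac_eq0 polyXsubC_eq0. Qed.

Lemma place_poly (p : {poly algC}) : p != 0 ->
  v p%:F = \sum_(z <- poly_roots p) v ('X - z%:P)%:F.
Proof.
move=> np; rewrite {1}(poly_rootsP p) -mul_polyC tofracM placeM; first last.
- by rewrite tofrac_eq0 prodf_seq_neq0; apply/allP => z _; rewrite polyXsubC_eq0.
- by rewrite tofrac_eq0 polyC_eq0 lead_coef_eq0.
rewrite placeC0 add0r; elim: (poly_roots p) => [|z s IH].
  by rewrite !big_nil tofrac1 place1.
rewrite !big_cons tofracM placeM ?IH ?XsubC_neq0 //.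
by rewrite tofrac_eq0 prodf_seq_neq0; apply/allP => y _; rewrite polyXsubC_eq0.
Qed.

(** The two linear factors differ by a nonzero constant, of valuation 0, so they cannot both have
    positive valuation. *)
Lemma place_shift a b : a != b -> v ('X - a%:P)%:F > 0 -> v ('X - b%:P)%:F <= 0.
Proof.
move=> nab va; rewrite leNgt; apply/negP => vb.
have e : ('X - a%:P)%:F + (-1)%:P%:F * ('X - b%:P)%:F = (b - a)%:P%:F :> ratfun.
  rewrite -tofracM -tofracD; congr (_%:F).
  by rewrite polyCN polyC1 polyCB; ring.
have n1 : (-1)%:P%:F != 0 :> ratfun by rewrite tofrac_eq0 polyC_eq0 oppr_eq0 oner_eq0.
have := placeD (XsubC_neq0 a) (mulf_neq0 n1 (XsubC_neq0 b)).
rewrite e tofrac_eq0 polyC_eq0 subr_eq0 eq_sym => /(_ nab).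
by rewrite placeC0 placeM ?XsubC_neq0 // placeC0 add0r leNgt lt_min va vb.
Qed.

Lemma place_shift_ge a b : Num.min (v ('X - a%:P)%:F) 0 <= v ('X - b%:P)%:F.
Proof.
have [->|nab] := eqVneq a b; first by rewrite ge_min lexx.
have e : ('X - a%:P)%:F + (a - b)%:P%:F = ('X - b%:P)%:F :> ratfun.
  by rewrite -tofracD; congr (_%:F); rewrite polyCB; ring.
have n1 : (a - b)%:P%:F != 0 :> ratfun by rewrite tofrac_eq0 polyC_eq0 subr_eq0.
by have := placeD (XsubC_neq0 a) n1; rewrite e XsubC_neq0 placeC0; apply.
Qed.

(* Normalization: some element has valuation 1, so the common absolute value of
   the nonzero valuations of linear factors divides 1. *)
Lemma place_unit (d : int) (k : algC -> int) :
  (forall c, v ('X - c%:P)%:F = d * k c) -> exists e : int, d * e = 1.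
Proof.
move=> h; have [_ _ _ _ [x nx vx]] := pv.
have [p [q [np nq _ ex]]] := ratfunP nx.
exists ((\sum_(z <- poly_roots p) k z) - (\sum_(z <- poly_roots q) k z)).
rewrite mulrBr !mulr_sumr -vx ex placeM ?invr_eq0 ?tofrac_eq0 // placeV !place_poly //.
by congr (_ - _); apply: eq_bigr => z _; rewrite h.
Qed.

(** The places are the points of the projective line. If some ['X - a] has positive valuation, all
    other linear factors have valuation 0; otherwise all share one nonpositive valuation, as for a
    pole at infinity. By [place_unit] the nonzero value is 1 or -1. *)
Lemma place_point : exists Q, forall c, v ('X - c%:P)%:F = point_order Q c.
Proof.
have [[a va]|none] := Classical_Prop.classic (exists a, v ('X - a%:P)%:F > 0).
  have h c : v ('X - c%:P)%:F = v ('X - a%:P)%:F * (c == a)%:Z.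
    have [->|nca] := eqVneq c a; first by rewrite mulr1.
    rewrite mulr0; apply/eqP; rewrite eq_le (place_shift _ va) 1?eq_sym //=.
    by apply: le_trans (place_shift_ge a c); rewrite le_min (ltW va) lexx.
  have [e he] := place_unit h.
  exists (Some a) => c; rewrite h /=.
  suff -> : v ('X - a%:P)%:F = 1 by rewrite mul1r.
  have : `|v ('X - a%:P)%:F|%N = 1%N.
    by apply/eqP; have := congr1 absz he; rewrite abszM => /eqP; rewrite muln_eq1 => /andP[].
  by move=> e1; rewrite -(gtz0_abs va) e1.
have le0 c : v ('X - c%:P)%:F <= 0 by rewrite leNgt; apply/negP => h; apply: none; exists c.
have h c : v ('X - c%:P)%:F = v ('X - 0%:P)%:F * 1.
  rewrite mulr1; apply/eqP; rewrite eq_le.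
  have := place_shift_ge 0 c; have := place_shift_ge c 0.
  by rewrite !min_l // => -> ->.
have [e he] := place_unit h; exists None => c; rewrite h mulr1 /=.
have : `|v ('X - 0%:P)%:F|%N = 1%N.
  by apply/eqP; have := congr1 absz he; rewrite abszM => /eqP; rewrite muln_eq1 => /andP[].
by move=> e1; rewrite -[LHS]opprK -(lez0_abs (le0 0)) e1.
Qed.

End Place.

Lemma place_ext v w Q : place rconst v -> place rconst w ->
  (forall c, v ('X - c%:P)%:F = point_order Q c) ->
  (forall c, w ('X - c%:P)%:F = point_order Q c) -> v =1 w.
Proof.
move=> pv pw hv hw x; have [->|nx] := eqVneq x 0; first by rewrite !place0.
have [p [q [np nq _ ->]]] := ratfunP nx.
rewrite !placeM ?invr_eq0 ?tofrac_eq0 // !placeV // !place_poly //.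
by congr (_ - _); apply: eq_bigr => z _; rewrite hv hw.
Qed.

(** The order at infinity is minus the degree, and [size] is the degree plus one. *)
Definition pord (Q : option algC) (p : {poly algC}) : int :=
  if Q is Some a then (mup a p)%:Z else 1 - (size p)%:Z.

Lemma pordM Q p q : p != 0 -> q != 0 -> pord Q (p * q) = pord Q p + pord Q q.
Proof.
move=> np nq; case: Q => [a|] /=; first by rewrite mupM // PoszD.
have := size_mul np nq; have : (0 < size p)%N by rewrite size_poly_gt0.
have : (0 < size q)%N by rewrite size_poly_gt0.
by move=> + + ->; case: (size p) (size q) => [|m] [|n] // _ _; rewrite addSn addnS /=; lia.
Qed.

Lemma pordD Q p q : p != 0 -> q != 0 -> p + q != 0 ->
  Num.min (pord Q p) (pord Q q) <= pord Q (p + q).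
Proof.
move=> np nq npq; rewrite ge_min; case: Q => [a|] /=.
  rewrite !lez_nat !mup_geq //.
  case: (leqP (mup a p) (mup a q)) => [l|/ltnW l]; apply/orP; [left|right]; apply: dvdp_add;
    by rewrite -mup_geq.
rewrite !lerD2l !lerN2 !lez_nat.
have := size_polyD p q; rewrite leq_max.
by case: (_ <= _)%N => //= ->; rewrite orbT.
Qed.

Lemma pordC Q c : c != 0 -> pord Q c%:P = 0.
Proof.
case: Q => [a|] nc /=; first by rewrite mupNroot // rootC.
by rewrite size_polyC nc.
Qed.

Definition ford Q (x : ratfun) : int :=
  if x == 0 then 0 else pord Q (frac (generic_quotient.repr x)).1 - pord Q (frac
    (generic_quotient.repr x)).2.

Lemma ford_frac Q p q : p != 0 -> q != 0 -> ford Q (p%:F / q%:F) = pord Q p - pord Q q.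
Proof.
move=> np nq; rewrite /ford; have npF : p%:F != 0 :> ratfun by rewrite tofrac_eq0.
have nqF : q%:F != 0 :> ratfun by rewrite tofrac_eq0.
rewrite mulf_eq0 invr_eq0 (negPf npF) (negPf nqF) /=.
set x := p%:F / q%:F; set n := (frac (generic_quotient.repr x)).1;
  set d := (frac (generic_quotient.repr x)).2.
have ex : x = n%:F / d%:F by apply: frac_repr.
have nd : d != 0 by apply: denom_ratioP.
have ndF : d%:F != 0 :> ratfun by rewrite tofrac_eq0.
have [nn e] : n != 0 /\ p * d = n * q.
  have [nnF eF] := frac_cross npF nqF ndF ex.
  split; first by rewrite -(tofrac_eq0 n).
  by apply/eqP; rewrite -tofrac_eq !tofracM; apply/eqP.
have := congr1 (pord Q) e; rewrite !pordM // => e'.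
by apply/eqP; rewrite subr_eq addrAC e' addrK.
Qed.

Lemma ford_place Q : place rconst (ford Q).
Proof.
have nF (p : {poly algC}) : p != 0 -> p%:F != 0 :> ratfun by rewrite tofrac_eq0.
split.
- by rewrite /ford eqxx.
- move=> x y /ratfunP[p [q [np nq _ ->]]] /ratfunP[p' [q' [np' nq' _ ->]]].
  by rewrite mulf_div -!tofracM !ford_frac ?mulf_neq0 // !pordM //; ring.
- move=> x y /ratfunP[p [q [np nq _ ->]]] /ratfunP[p' [q' [np' nq' _ ->]]].
  rewrite addf_div ?nF // -!tofracM -tofracD => nxy.
  have nn : p * q' + p' * q != 0.
    by apply: contraNneq nxy => ->; rewrite tofrac0 mul0r.
  rewrite !ford_frac ?mulf_neq0 //.
  have := pordD Q (mulf_neq0 np nq') (mulf_neq0 np' nq) nn.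
  rewrite !pordM // => h; rewrite lerBrDr; apply: le_trans h.
  move: (pord Q p) (pord Q q) (pord Q p') (pord Q q') => a b c d.
  by case: (leP (a - b) (c - d)); case: (leP (a + d) (c + b)); lia.
- move=> c nc; rewrite rconstE -[X in ford Q X]divr1 -tofrac1 ford_frac ?polyC_eq0 ?oner_eq0
  //.
  by rewrite pordC // -polyC1 pordC ?oner_eq0 // subrr.
have nX a : 'X - a%:P != 0 :> {poly algC} by rewrite polyXsubC_eq0.
case: Q => [a|].
  exists ('X - a%:P)%:F; first by rewrite nF.
  rewrite -[X in ford _ X]divr1 -tofrac1 ford_frac ?oner_eq0 //.
  by rewrite -polyC1 pordC ?oner_eq0 // subr0 /= -['X - _]expr1 mup_XsubCX eqxx.
exists (1%:F / ('X - 0%:P)%:F); first by rewrite mulf_neq0 ?invr_eq0 ?nF ?oner_eq0.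
rewrite ford_frac ?oner_eq0 // -polyC1 pordC ?oner_eq0 // sub0r /= size_XsubC //.
Qed.

Lemma placeXz v (n : int) (x : ratfun) : place rconst v -> x != 0 -> v (x ^ n) = v x * n.
Proof.
move=> pv nx; case: n => n.
  by rewrite -exprnP (placeX pv) // -mulr_natr natz.
by rewrite NegzE -exprnN (placeV pv) (placeX pv) // -mulr_natr natz mulrN.
Qed.

Lemma place_prod v (I : eqType) (s : seq I) (F : I -> ratfun) : place rconst v ->
  (forall i, F i != 0) -> v (\prod_(i <- s) F i) = \sum_(i <- s) v (F i).
Proof.
move=> pv nF; elim: s => [|i s IH]; first by rewrite !big_nil (place1 pv).
by rewrite !big_cons (placeM pv) ?IH // prodf_seq_neq0; apply/allP => k _; rewrite nF.
Qed.

Lemma has_Kdim_leq (S : ratfun -> Prop) l d (x : 'I_d -> ratfun) :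
  has_Kdim rconst S l -> (forall j, S (x j)) ->
  (forall c : 'I_d -> algC, \sum_j rconst (c j) * x j = 0 -> forall j, c j = 0) ->
  (d <= l)%N.
Proof.
move=> [e [_ _ gen]] Sx free; rewrite leqNgt; apply/negP => ld.
have [c cx] := fin_all_exists (fun j => gen (x j) (Sx j)).
have [|cc [j0 nj0] cc0] := @lin_dep 'I_d 'I_l (fun j k => c j k).
  by rewrite !card_ord.
case/eqP: nj0; apply: free.
transitivity (\sum_j \sum_k rconst (cc j * c j k) * e k).
  by apply: eq_bigr => j _; rewrite cx mulr_sumr; apply: eq_bigr => k _; rewrite rmorphM mulrA.
rewrite exchange_big big1 // => k _; rewrite -mulr_suml -rmorph_sum cc0 rmorph0 mul0r //.
Qed.

(** * Riemann-Roch spaces on the projective line *)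

Section RiemannRoch.
Variables (m : nat) (v : 'I_m -> ratfun -> int) (D : 'I_m -> int) (Q : 'I_m -> option algC).
Hypothesis pv : forall i, place rconst (v i).
Hypothesis vQ : forall i c, v i ('X - c%:P)%:F = point_order (Q i) c.
Hypothesis injQ : injective Q.

(** The product of these factors has order exactly [- D i] at the finite points. Multiplying it by
    [X^j] uses up [j] of the order left at infinity, which is allowed for [j] up to the degree of
    [D]. *)
Definition rr_factor i : ratfun := if Q i is Some a then (('X - a%:P)%:F) ^ (- D i) else 1.
Definition rr_elt (j : nat) : ratfun := (\prod_i rr_factor i) * (('X - 0%:P)%:F) ^+ j.

Lemma rr_factor_neq0 i : rr_factor i != 0.
Proof.
rewrite /rr_factor; case: (Q i) => [a|]; last exact: oner_neq0.
by rewrite expfz_neq0 // XsubC_neq0.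
Qed.

Lemma rr_prod_neq0 : \prod_i rr_factor i != 0.
Proof. by rewrite prodf_seq_neq0; apply/allP => i _; rewrite rr_factor_neq0. Qed.

Lemma place_rr_elt w P j : place rconst w ->
  (forall c, w ('X - c%:P)%:F = point_order P c) ->
  w (rr_elt j) = \sum_i (if Q i is Some a then - D i * point_order P a else 0)
                 + point_order P 0 *+ j.
Proof.
move=> pw wP; rewrite /rr_elt (placeM pw) ?rr_prod_neq0 ?expf_neq0 ?XsubC_neq0 //.
rewrite (placeX pw) ?XsubC_neq0 // wP (place_prod _ pw) //; last exact: rr_factor_neq0.
congr (_ + _); apply: eq_bigr => i _; rewrite /rr_factor.
case: (Q i) => [a|]; last by rewrite (place1 pw).
by rewrite (placeXz _ pw) ?XsubC_neq0 // wP mulrC.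
Qed.

Lemma rr_elt_finite w b j : place rconst w ->
  (forall c, w ('X - c%:P)%:F = point_order (Some b) c) ->
  \sum_(i | Q i == Some b) - D i <= w (rr_elt j).
Proof.
move=> pw wP; rewrite (place_rr_elt _ pw wP) big_mkcond /=.
rewrite [X in X + _](_ : _ = \sum_i (if Q i == Some b then - D i else 0)).
  by rewrite lerDl mulrn_wge0 // /point_order; case: eqP.
apply: eq_bigr => i _; case: (Q i) => [a|] //=.
by rewrite (_ : (Some a == Some b) = (a == b)) //; case: (a == b); rewrite ?mulr1 ?mulr0.
Qed.

Lemma rr_elt_infinite w j : place rconst w ->
  (forall c, w ('X - c%:P)%:F = point_order None c) ->
  w (rr_elt j) = ddeg D - (\sum_(i | Q i == None) D i) - j%:Z.
Proof.
move=> pw wP; rewrite (place_rr_elt _ pw wP) /ddeg (bigID (fun i => Q i == None) predT) /=.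
rewrite [X in _ = X - _ - _](bigID (fun i => Q i == None) predT) /=.
rewrite (addrC (\sum_(i | Q i == None) D i)) addrK.
rewrite [X in X + _ + _ = _]big1 ?add0r; last by move=> i /eqP ->.
congr (_ + _); last by rewrite mulNrn natz.
by apply: eq_bigr => i; case: (Q i) => [a|] //= _; rewrite mulrN mulr1 opprK.
Qed.

Lemma rr_elt_mem (j : nat) : j%:Z <= ddeg D -> RRspace rconst v D (rr_elt j).
Proof.
move=> jd; right.
have sum1 (f : 'I_m -> int) i : \sum_(k | Q k == Q i) f k = f i.
  rewrite (bigD1 i) //= big1 ?addr0 // => k /andP[/eqP/injQ ->]; by rewrite eqxx.
split=> [i|w pw nw].
  case E: (Q i) => [b|].
    have := rr_elt_finite j (pv i) (fun c => etrans (vQ i c) (congr1 (point_order^~ c) E)).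
    by rewrite -E sum1.
  rewrite (rr_elt_infinite j (pv i) (fun c => etrans (vQ i c) (congr1 (point_order^~ c) E))).
  by rewrite -E sum1 addrAC lerDr subr_ge0.
have [P wP] := place_point pw.
have nP i : Q i != P.
  apply/eqP => e; apply: (nw i); apply: (place_ext pw (pv i) wP) => c.
  by rewrite vQ e.
case: P wP nP => [b|] wP nP.
  have := rr_elt_finite j pw wP; rewrite big1 // => i /eqP e.
  by have := nP i; rewrite e eqxx.
rewrite (rr_elt_infinite j pw wP) big1 ?subr0 ?subr_ge0 // => i /eqP e.
by have := nP i; rewrite e eqxx.
Qed.

(** The elements [rr_elt j], for [j] from 0 to the degree of [D], are independent, so [l] is at
    least that degree plus 1; in negative degree [0 <= l] is enough. *)
Lemma rr_bound l : has_Kdim rconst (RRspace rconst v D) l -> ddeg D - l%:Z + 1 <= 0.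
Proof.
move=> hl; have [d0|d0] := leP 0 (ddeg D); last by lia.
have [d ed] : exists d : nat, ddeg D = d%:Z by exists `|ddeg D|%N; rewrite gez0_abs.
suff : (d.+1 <= l)%N by rewrite ed; lia.
apply: (has_Kdim_leq (x := fun j : 'I_d.+1 => rr_elt j) hl).
  by move=> j; apply: rr_elt_mem; rewrite ed lez_nat -ltnS.
move=> c; under eq_bigr do rewrite /rr_elt mulrCA.
rewrite -mulr_sumr => /eqP; rewrite mulf_eq0 (negPf rr_prod_neq0) /= => /eqP h j.
have : (\poly_(i < d.+1) c (inord i))%:F = 0 :> ratfun.
  rewrite -[RHS]h poly_def rmorph_sum; apply: eq_bigr => i _.
  by rewrite /= -mul_polyC rmorphM rmorphXn /= inord_val polyC0 subr0.
move/eqP; rewrite tofrac_eq0 => /eqP/(congr1 (fun p : {poly algC} => p`_j)).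
by rewrite /= coef_poly ltn_ord inord_val coef0.
Qed.

End RiemannRoch.

(** A root of the reduced denominator would be a pole; once the denominator is constant, the place
    at infinity bounds the degree of the numerator by 0. *)
Lemma regular_const (x : ratfun) : (forall w, place rconst w -> 0 <= w x) ->
  exists c, x = rconst c.
Proof.
have [->|nx] := eqVneq x 0; first by exists 0; rewrite rmorph0.
have [p [q [np nq co ->]]] := ratfunP nx => h.
have sq : size q = 1%N.
  apply/eqP/negPn/negP => /closed_rootP[a ra].
  have := h _ (ford_place (Some a)); rewrite ford_frac //= mupNroot.
    by rewrite sub0r oppr_ge0 lez_nat leqn0 -leqn0 leqNgt -XsubC_dvd // dvdp_XsubCl ra.
  apply/negP => rp; have : root (gcdp p q) a by rewrite root_gcd rp ra.
  by move: co; rewrite /coprimep size_poly_eq1 => /eqp_root ->; rewrite /root hornerC oner_eq0.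
have sp : (size p <= 1)%N.
  by have := h _ (ford_place None); rewrite ford_frac //= sq; lia.
have [c nc ec] := size_poly1P q (introT eqP sq).
by exists (p`_0 / c); rewrite fmorph_div [in LHS](size1_polyC sp) ec.
Qed.

Lemma ratfun_genus0 : field_genus rconst 0.
Proof.
split=> [m v D l [pv inj] hl|].
  have [Q vQ] := fin_all_exists (fun i => place_point (pv i)).
  apply: (rr_bound pv vQ) hl => i j e; apply: inj.
  by apply: (place_ext (pv i) (pv j) (vQ i)) => c; rewrite vQ e.
(* The bound is attained by the empty divisor, whose space consists of the constants:
   [0 - 1 + 1 = 0]. *)
exists 0%N, (fun _ _ => 0), (fun=> 0), 1%N; split; first by split=> [[]|[]].
  exists (fun=> 1); split=> [_|c|x Sx].
  - by right; split=> [[]//|w pw _]; rewrite (place1 pw).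
  - rewrite big_ord1 mulr1 => /eqP; rewrite fmorph_eq0 => /eqP c0 i.
    by rewrite ord1.
  have [c ->] : exists c, x = rconst c.
    case: Sx => [->|[_ h]]; first by exists 0; rewrite rmorph0.
    by apply: regular_const => w pw; apply: h => // -[].
  by exists (fun=> c); rewrite big_ord1 mulr1.
by rewrite /ddeg big_ord0.
Qed.

(** * Function field of a cuspidal curve *)

(* [f] is the evaluation at [s <> 0] of the Laurent polynomial [x]. *)
Definition evaluates (x : ratfun) (f : algC -> algC) : Prop :=
  exists N (r : {poly algC}), ('X%:F) ^+ N * x = r%:F /\ forall s, s != 0 -> s ^+ N * f s =
    r.[s].

Lemma X_neq0 : 'X%:F != 0 :> ratfun.
Proof. by rewrite tofrac_eq0 polyX_eq0. Qed.

Lemma evaluates_ext x f g : (forall s, s != 0 -> f s = g s) -> evaluates x f -> evaluates x g.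
Proof. by move=> e [N [r [h1 h2]]]; exists N, r; split=> // s ns; rewrite -e // h2. Qed.

Lemma evaluates_const c : evaluates (rconst c) (fun=> c).
Proof. by exists 0%N, c%:P; split=> [|s _]; rewrite ?hornerC expr0 mul1r. Qed.

Lemma add_common (R : comNzRingType) (a b x y : R) : a * b * (x + y) = b * (a * x) + a * (b *
  y).
Proof. by ring. Qed.

Lemma evaluatesD x y f g : evaluates x f -> evaluates y g ->
  evaluates (x + y) (fun s => f s + g s).
Proof.
move=> [N [r [h1 h2]]] [M [q [k1 k2]]]; exists (N + M)%N, ('X^M * r + 'X^N * q).
split=> [|s ns]; rewrite exprD add_common ?h1 ?k1 ?h2 ?k2 //.
  by rewrite tofracD !tofracM !tofracXn.
by rewrite hornerD !hornerM !hornerXn.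
Qed.

Lemma evaluatesM x y f g : evaluates x f -> evaluates y g ->
  evaluates (x * y) (fun s => f s * g s).
Proof.
move=> [N [r [h1 h2]]] [M [q [k1 k2]]]; exists (N + M)%N, (r * q).
by split=> [|s ns]; rewrite exprD mulrACA ?h1 ?k1 ?h2 ?k2 ?tofracM ?hornerM.
Qed.

Lemma evaluates_mmap n (t : 'I_n -> ratfun) (F : algC -> 'I_n -> algC) P :
  (forall i, evaluates (t i) (fun s => F s i)) ->
  evaluates (mmap rconst t P) (fun s => P.@[F s]).
Proof.
move=> h; elim/mpoly_ring_ind: P => [c|i|p q hp hq|p q hp hq].
- rewrite mmapC; apply: evaluates_ext (evaluates_const c) => s _; by rewrite mevalC.
- rewrite mmapX mmap1U; apply: evaluates_ext (h i) => s _; by rewrite mevalXU.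
- rewrite mmapD; apply: evaluates_ext (evaluatesD hp hq) => s _; by rewrite mevalD.
rewrite rmorphM; apply: evaluates_ext (evaluatesM hp hq) => s _; by rewrite mevalM.
Qed.

Lemma evaluates_eq0 x f : evaluates x f -> x = 0 <-> forall s, s != 0 -> f s = 0.
Proof.
move=> [N [r [h1 h2]]]; split=> [x0 s ns|f0].
  have r0 : r = 0 by apply/eqP; rewrite -tofrac_eq0 -h1 x0 mulr0.
  by apply: (mulfI (expf_neq0 N ns)); rewrite h2 // r0 horner0 mulr0.
have r0 : r = 0 by apply: poly_eq0_nonzero => s ns; rewrite -h2 // f0 // mulr0.
by apply: (mulfI (expf_neq0 N X_neq0)); rewrite h1 r0 tofrac0 mulr0.
Qed.

Lemma evaluates_inj x y f : evaluates x f -> evaluates y f -> x = y.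
Proof.
move=> hx hy; apply/eqP; rewrite -subr_eq0 -mulN1r; apply/eqP.
have hN := evaluatesM (evaluates_const (-1)) hy; rewrite rmorphN1 in hN.
by apply/(evaluates_eq0 (evaluatesD hx hN)) => s _; rewrite mulN1r subrr.
Qed.

Lemma evaluates_div (p : {poly algC}) N : evaluates (p%:F / 'X%:F ^+ N) (fun s => p.[s] / s ^+
  N).
Proof.
exists N, p; split=> [|s ns]; rewrite mulrCA mulfV ?mulr1 ?expf_neq0 //; exact: X_neq0.
Qed.

Definition cusp_aF : ratfun := (('X + 1) ^+ 2)%:F / 'X%:F ^+ 1.
Definition cusp_bF : ratfun := (('X + 1) ^+ 2)%:F / 'X%:F ^+ 2.

Lemma evaluates_aF : evaluates cusp_aF cusp_a.
Proof.
apply: evaluates_ext (evaluates_div _ _) => s _.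
by rewrite horner_exp hornerD hornerX hornerC expr1.
Qed.

Lemma evaluates_bF : evaluates cusp_bF cusp_b.
Proof.
apply: evaluates_ext (evaluates_div _ _) => s _.
by rewrite horner_exp hornerD hornerX hornerC.
Qed.

Lemma cusp_bF_neq0 : cusp_bF != 0.
Proof.
apply: div_neq0; last by rewrite expf_neq0 // X_neq0.
by rewrite tofrac_eq0 expf_neq0 // -size_poly_eq0 -polyC1 size_XaddC.
Qed.

Lemma cusp_bFX : cusp_bF * 'X%:F = cusp_aF.
Proof.
apply: (evaluates_inj _ evaluates_aF).
have hX : evaluates 'X%:F id.
  by exists 0%N, 'X; split=> [|s _]; rewrite ?hornerX expr0 mul1r.
apply: evaluates_ext (evaluatesM evaluates_bF hX) => s ns.
by rewrite /cusp_a /cusp_b; field.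
Qed.

Lemma homog_rearrange (R : comNzRingType) (a b c d : R) : d * (a * c * b) = a * b * (d * c).
Proof. by ring. Qed.

Lemma divf_cancell (F : fieldType) (a b c : F) : c != 0 -> (c * a) / (c * b) = a / b.
Proof. by move=> nc; rewrite -mulf_div divff ?mul1r. Qed.

Section CuspidalCurveField.
Variables (n : nat) (gam : 'I_n -> {mpoly algC[2]}) (al be : {mpoly algC[n]}).
Variable (S : algC -> Prop) (e : {poly algC}).
Hypothesis al_param : forall s, s != 0 -> al.@[cusp_param gam s ord0] = cusp_a s.
Hypothesis be_param : forall s, s != 0 -> be.@[cusp_param gam s ord0] = cusp_b s.
Hypothesis ne : e != 0.
Hypothesis S_neq0 : forall s, S s -> s != 0.
Hypothesis S_generic : forall s, s != 0 -> e.[s] != 0 -> S s.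

Definition curve_coord i : ratfun :=
  mmap rconst (fun j : 'I_2 => if j == 0 then cusp_aF else cusp_bF) (gam i).

Lemma evaluates_coord P : evaluates (mmap rconst curve_coord P) (fun s => P.@[cusp_param gam s
  ord0]).
Proof.
apply: evaluates_mmap => i; apply: (@evaluates_ext _ (fun s => (gam i).@[cusp_ab s])).
  by move=> s _; rewrite mxE.
apply: evaluates_mmap => j; rewrite /cusp_ab.
by case: (j == 0); [apply: evaluates_aF|apply: evaluates_bF].
Qed.

Lemma mmap_al : mmap rconst curve_coord al = cusp_aF.
Proof.
by apply: (evaluates_inj _ evaluates_aF); apply: evaluates_ext (evaluates_coord al).
Qed.

Lemma mmap_be : mmap rconst curve_coord be = cusp_bF.
Proof.
by apply: (evaluates_inj _ evaluates_bF); apply: evaluates_ext (evaluates_coord be).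
Qed.

(* [s = a / b] generates the function field, so [p] is homogenized in [al], [be]. *)
Definition curve_homog (N : nat) (p : {poly algC}) : {mpoly algC[n]} :=
  \sum_(i < N.+1) (p`_i)%:MP * (al ^+ i * be ^+ (N - i)).

Lemma mmap_homog N (p : {poly algC}) : (size p <= N.+1)%N ->
  mmap rconst curve_coord (curve_homog N p) = cusp_bF ^+ N * p%:F.
Proof.
move=> sp; have {2}-> : p = \poly_(i < N.+1) p`_i.
  by apply/polyP => i; rewrite coef_poly; case: ltnP => // l;
    rewrite nth_default // (leq_trans sp).
rewrite /curve_homog poly_def !rmorph_sum mulr_sumr.
apply: eq_bigr => i _; have li : (i <= N)%N by rewrite -ltnS.
rewrite !rmorphM !rmorphXn /= mmapC mmap_al mmap_be -cusp_bFX.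
rewrite -[X in X * _]/((p`_i)%:P%:F).
have -> : (p`_i *: 'X^i)%:F = (p`_i)%:P%:F * 'X%:F ^+ i :> ratfun.
  by rewrite -mul_polyC tofracM tofracXn.
have -> : cusp_bF ^+ N = cusp_bF ^+ i * cusp_bF ^+ (N - i) by rewrite -exprD subnKC.
rewrite exprMn; move: (cusp_bF ^+ i) (cusp_bF ^+ (N - i)) ('X%:F ^+ i) ((p`_i)%:P%:F) => A B C
  E.
exact: homog_rearrange.
Qed.

Lemma curve_function_field : is_function_field (cusp_curve gam S) rconst curve_coord.
Proof.
split=> [P|y].
  rewrite (vanishes_curve gam ne S_neq0 S_generic P).
  exact: evaluates_eq0 (evaluates_coord P).
have [p [q [nq ->]]] := fracP y.
pose N := maxn (size p) (size q).
have sp : (size p <= N.+1)%N by rewrite leqW // leq_maxl.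
have sq : (size q <= N.+1)%N by rewrite leqW // leq_maxr.
have nqF : q%:F != 0 :> ratfun by rewrite tofrac_eq0.
have nb := expf_neq0 N cusp_bF_neq0.
exists (curve_homog N p), (curve_homog N q); rewrite (mmap_homog sp) (mmap_homog sq).
split; first exact: (mulf_neq0 nb nqF).
exact: (esym (divf_cancell _ _ nb)).
Qed.

Lemma curve_genus0 : has_genus (cusp_curve gam S) 0.
Proof. by exists ratfun, rconst, curve_coord; split;
  [apply: curve_function_field|apply: ratfun_genus0]. Qed.

End CuspidalCurveField.

(** * The curves of invariants *)

Lemma sigma_vec_conj n f g : (n <= 5)%N -> Rat4 f -> Rat4 g -> conjugate f g ->
  sigma_vec n f = sigma_vec n g.
Proof.
move=> ln Rf Rg [A uA fg]; have p := perm_multipliers Rf Rg uA fg.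
apply/rowP => i; rewrite !mxE.
have li : (i.+1 <= 5)%N by apply: leq_trans ln.
have sg : size (multipliers f) = 5%N by rewrite size_map size_fixed_points.
by rewrite (sigma1_perm sg (perm_refl _) li) (sigma1_perm sg p li).
Qed.

Lemma zclosure_ext n (S S' : 'rV[algC]_n -> Prop) : (forall x, S x <-> S' x) ->
  zclosure S = zclosure S'.
Proof.
move=> e; congr zclosure; apply: functional_extensionality => x.
exact: propositional_extensionality.
Qed.

Lemma locus_varietyE gT n (T : Type) (D : T -> Prop) (F : T -> ratmap) :
  (n <= 5)%N -> (forall k, D k -> autlocus gT (F k)) ->
  (forall f, autlocus gT f -> exists2 k, D k & conjugate f (F k)) ->
  locus_variety gT n = zclosure (fun x => exists2 k, D k & x = sigma_vec n (F k)).
Proof.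
move=> ln h1 h2; apply: zclosure_ext => x; split=> [[f Af ->]|[k Dk ->]].
  have [k Dk fk] := h2 f Af; exists k => //.
  by apply: sigma_vec_conj fk => //; [case: Af|case: (h1 k Dk)].
by exists (F k) => //; apply: h1.
Qed.

(* With [k = 4 s] the multipliers of [fam1 k] are [4 s] and, four times,
   [1 / s - 3]; with [k = 3 s - 1] those of [fam3 k k] are [3 s - 1], twice, and
   [2 / s - 2], three times.  Their elementary symmetric functions are polynomials
   in [a = (s + 1)^2 / s] and [b = a / s]. *)
Definition gamC4 (i : 'I_4) : {mpoly algC[2]} :=
  let a := 'X_0 in let b := 'X_1 in
  [:: 4%:MP * a - 20%:MP;
      6%:MP * b - 48%:MP * a + 160%:MP;
      4%:MP * (a * b) - 52%:MP * b + 212%:MP * a - 640%:MP;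
      b * b - 16%:MP * (a * b) + 128%:MP * b - 416%:MP * a + 1280%:MP]`_i.

Definition gamD3 (i : 'I_4) : {mpoly algC[2]} :=
  let a := 'X_0 in let b := 'X_1 in
  [:: 6%:MP * a - 20%:MP;
      9%:MP * (a * a) + 3%:MP * b - 78%:MP * a + 160%:MP;
      8%:MP * (a * b) - 54%:MP * (a * a) - 26%:MP * b + 370%:MP * a - 640%:MP;
      108%:MP * (a * a) - 16%:MP * (a * b) + 64%:MP * b - 752%:MP * a + 1280%:MP]`_i.

(** The first two coordinates of each parametrization are triangular in [a] and [b]; solving them in
    turn gives [al] and [be]. *)
Definition alC4 : {mpoly algC[4]} := (1 / 4)%:MP * ('X_0 + 20%:MP).
Definition beC4 : {mpoly algC[4]} := (1 / 6)%:MP * ('X_1 + 48%:MP * alC4 - 160%:MP).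
Definition alD3 : {mpoly algC[4]} := (1 / 6)%:MP * ('X_0 + 20%:MP).
Definition beD3 : {mpoly algC[4]} :=
  (1 / 3)%:MP * ('X_1 - 9%:MP * (alD3 * alD3) + 78%:MP * alD3 - 160%:MP).

Lemma meval2_a s : ('X_0 : {mpoly algC[2]}).@[cusp_ab s] = cusp_a s.
Proof. by rewrite mevalXU. Qed.
Lemma meval2_b s : ('X_1 : {mpoly algC[2]}).@[cusp_ab s] = cusp_b s.
Proof. by rewrite mevalXU. Qed.

Local Definition meval_cusp := (mevalM, mevalD, mevalB, mevalC, mevalN, meval2_a, meval2_b).

Lemma gamC4_sigma s : s != 0 -> cusp_param gamC4 s = sigma_vec 4 (fam1 (4 * s)).
Proof.
move=> ns; have nk : 4 * s != 0 by rewrite mulf_neq0 // pnatr_eq0.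
have p := multipliers_fam1 nk.
have em : mult1 (4 * s) = 1 / s - 3 by rewrite /mult1; field.
apply/rowP => i; rewrite !mxE (sigma1_esym5 p); last by case: i => i /= /ltnW.
rewrite em /esym5 /gamC4; case: i => [[|[|[|[|]]]] //= li];
  rewrite !meval_cusp /cusp_a /cusp_b; by field.
Qed.

Lemma gamD3_sigma s : s != 0 -> 3 * s - 1 != 1 ->
  cusp_param gamD3 s = sigma_vec 4 (fam3 (3 * s - 1) (3 * s - 1)).
Proof.
move=> ns n1; have nm1 : 3 * s - 1 != -1 by rewrite -subr_eq0 opprK subrK mulf_neq0 //
  pnatr_eq0.
have p := multipliers_fam3 (sq_neq1 n1 nm1).
have n2 : 3 * s - 2 != 0.
  by apply: contraNneq n1 => e; rewrite -subr_eq0 -e; apply/eqP; ring.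
have em : mult3 (3 * s - 1) (3 * s - 1) = 2 / s - 2.
  rewrite /mult3 (_ : 1 - (3 * s - 1) * (3 * s - 1) = - (3 * s) * (3 * s - 2)); last by ring.
  by field; rewrite ns n2.
apply/rowP => i; rewrite !mxE (sigma1_esym5 p); last by case: i => i /= /ltnW.
rewrite em /esym5 /gamD3; case: i => [[|[|[|[|]]]] //= li];
  rewrite !meval_cusp /cusp_a /cusp_b; by field.
Qed.

Lemma alC4_param s : s != 0 -> alC4.@[cusp_param gamC4 s ord0] = cusp_a s.
Proof.
by move=> ns; rewrite /alC4 !(meval_cusp, mevalXU) mxE /gamC4 /= !meval_cusp; field.
Qed.

Lemma beC4_param s : s != 0 -> beC4.@[cusp_param gamC4 s ord0] = cusp_b s.
Proof.
move=> ns; rewrite /beC4; move: alC4 (alC4_param ns) => A hA.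
by rewrite !meval_cusp hA mevalXU mxE /gamC4 /= !meval_cusp; field.
Qed.

Lemma alD3_param s : s != 0 -> alD3.@[cusp_param gamD3 s ord0] = cusp_a s.
Proof.
by move=> ns; rewrite /alD3 !(meval_cusp, mevalXU) mxE /gamD3 /= !meval_cusp; field.
Qed.

Lemma beD3_param s : s != 0 -> beD3.@[cusp_param gamD3 s ord0] = cusp_b s.
Proof.
move=> ns; rewrite /beD3; move: alD3 (alD3_param ns) => A hA.
by rewrite !meval_cusp hA mevalXU mxE /gamD3 /= !meval_cusp; field.
Qed.

Lemma locus_C4E : locus_variety 'Z_4 4 = cusp_curve gamC4 (fun s => s != 0).
Proof.
rewrite (locus_varietyE (n := 4) (D := fun k => k != 0) (F := fam1)) //.
- apply: zclosure_ext => x; split=> [[k nk ->]|[s ns ->]].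
    have e : k = 4 * (k / 4) by field.
    have n4 : k / 4 != 0 by rewrite mulf_neq0 // invr_eq0 pnatr_eq0.
    by exists (k / 4) => //; rewrite {1}e gamC4_sigma.
  by exists (4 * s); rewrite ?gamC4_sigma // mulf_neq0 // pnatr_eq0.
- exact: fam1_autlocus.
exact: autlocus_C4.
Qed.

Lemma locus_D3E :
  locus_variety D3 4 = cusp_curve gamD3 (fun s => s != 0 /\ 3 * s - 1 != 1).
Proof.
rewrite (locus_varietyE (n := 4) (D := fun k => k != 1 /\ k != -1) (F := fun k => fam3 k k))
  //.
- apply: zclosure_ext => x; split=> [[k [n1 nm1] ->]|[s [ns n1] ->]].
    have e : k = 3 * ((k + 1) / 3) - 1 by field.
    have n3 : (k + 1) / 3 != 0.
      by rewrite mulf_neq0 ?invr_eq0 ?pnatr_eq0 // -[1]opprK subr_eq0.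
    by exists ((k + 1) / 3); [split=> //; rewrite -e|rewrite {1 2}e gamD3_sigma // -e].
  exists (3 * s - 1); last by rewrite gamD3_sigma.
  by split=> //; rewrite -subr_eq0 opprK subrK mulf_neq0 // pnatr_eq0.
- by move=> k [n1 nm1]; apply: fam2_autlocus.
by move=> f /autlocus_D3[k [n1 nm1 c]]; exists k.
Qed.

Lemma curve_C4 : [/\ irreducible_of_dim 1 (locus_variety 'Z_4 4),
  has_genus (locus_variety 'Z_4 4) 0 & exists! x, singular_point (locus_variety 'Z_4 4) x].
Proof.
rewrite locus_C4E; have ne : (1 : {poly algC}) != 0 by rewrite oner_eq0.
have hS s : s != 0 -> (1 : {poly algC}).[s] != 0 -> s != 0 by [].
split.
- exact: (curve_irreducible_of_dim alC4_param beC4_param ne (fun s h => h) hS).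
- exact: (curve_genus0 alC4_param beC4_param ne (fun s h => h) hS).
exact: (curve_unique_singular alC4_param beC4_param ne (fun s h => h) hS).
Qed.

Lemma curve_D3 : [/\ irreducible_of_dim 1 (locus_variety D3 4),
  has_genus (locus_variety D3 4) 0 & exists! x, singular_point (locus_variety D3 4) x].
Proof.
(* The root [s = 2 / 3] of [e] is the excluded value [k = 1]; the other excluded value [k = -1] is
   [s = 0]. *)
rewrite locus_D3E; pose e : {poly algC} := 3%:P * 'X - 2%:P.
have eE s : e.[s] = 3 * s - 2 by rewrite /e !hornerE.
have ne : e != 0.
  apply/eqP => e0; have := eE 0; rewrite e0 horner0 mulr0 sub0r => /esym/eqP.
  by rewrite oppr_eq0 pnatr_eq0.
set S := fun s => _.
have hS0 s : S s -> s != 0 by case.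
have hS s : s != 0 -> e.[s] != 0 -> S s.
  move=> ns; rewrite eE => n2; split=> //; apply: contraNneq n2 => h.
  by apply/eqP; transitivity (3 * s - 1 - 1); [ring|rewrite h subrr].
split.
- exact: (curve_irreducible_of_dim alD3_param beD3_param ne hS0 hS).
- exact: (curve_genus0 alD3_param beD3_param ne hS0 hS).
exact: (curve_unique_singular alD3_param beD3_param ne hS0 hS).
Qed.

(** * The surface of invariants *)

(* The invariants of [fam3 k1 k2] depend on [p = k1 * k2] and the triple multiplier
   [m]: the relation defining [m] gives [k1 + k2] as a polynomial in [m] and [p]. *)
Definition surf_s (m p : algC) : algC := (4 + 2 * p - m + m * p) / 3.
Definition surf_coord (m p : algC) (i : nat) : algC :=
  [:: surf_s m p + 3 * m;
      p + 3 * m * surf_s m p + 3 * m ^+ 2;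
      3 * m * p + 3 * m ^+ 2 * surf_s m p + m ^+ 3]`_i.
Definition surf (m p : algC) : 'rV[algC]_3 := \row_i surf_coord m p i.

Lemma surf_sigma k1 k2 : k1 * k2 != 1 ->
  sigma_vec 3 (fam3 k1 k2) = surf (mult3 k1 k2) (k1 * k2).
Proof.
move=> nk; have p := multipliers_fam3 nk.
have nk' : 1 - k1 * k2 != 0 by rewrite subr_eq0 eq_sym.
have es : surf_s (mult3 k1 k2) (k1 * k2) = k1 + k2.
  by rewrite /surf_s /mult3; field.
apply/rowP => i; rewrite !mxE (sigma1_esym5 p); last by case: i => [[|[|[|]]]].
by rewrite /surf_coord es /esym5; case: i => [[|[|[|]]] //= li]; ring.
Qed.

(** [k1] and [k2] are the roots of [T^2 - s T + p] with [s = surf_s m p]; for [p != 1] the relation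
    defining [surf_s] can be solved back for [m]. *)
Lemma surf_params m p : p != 1 -> exists k1 k2, k1 * k2 = p /\ mult3 k1 k2 = m.
Proof.
move=> np; pose s := surf_s m p; pose d := sqrtC (s ^+ 2 - 4 * p).
have d2 : d ^+ 2 = s ^+ 2 - 4 * p by rewrite sqrtCK.
have np' : 1 - p != 0 by rewrite subr_eq0 eq_sym.
have ep : (s + d) / 2 * ((s - d) / 2) = p.
  by transitivity ((s ^+ 2 - d ^+ 2) / 4); [field|rewrite d2; field].
exists ((s + d) / 2), ((s - d) / 2); split=> //.
rewrite /mult3 ep -(mulrA 3) (_ : (1 - (s + d) / 2) * (1 - (s - d) / 2) = 1 - s + p).
  by rewrite /s /surf_s; field.
by rewrite -ep; field.
Qed.

Definition PolyFun (f : algC -> algC) : Prop := exists r : {poly algC}, forall t, f t = r.[t].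

Lemma PolyFunC c : PolyFun (fun=> c).
Proof. by exists c%:P => t; rewrite hornerC. Qed.
Lemma PolyFunX : PolyFun id.
Proof. by exists 'X => t; rewrite hornerX. Qed.
Lemma PolyFunD f g : PolyFun f -> PolyFun g -> PolyFun (fun t => f t + g t).
Proof. by move=> [r hr] [q hq]; exists (r + q) => t; rewrite hornerD hr hq. Qed.
Lemma PolyFunM f g : PolyFun f -> PolyFun g -> PolyFun (fun t => f t * g t).
Proof. by move=> [r hr] [q hq]; exists (r * q) => t; rewrite hornerM hr hq. Qed.

Lemma PolyFun_meval n (F : algC -> 'I_n -> algC) (P : {mpoly algC[n]}) :
  (forall i, PolyFun (fun t => F t i)) -> PolyFun (fun t => P.@[F t]).
Proof.
move=> hF; elim/mpoly_ring_ind: P => [c|i|p q [r hr] [r' hr']|p q [r hr] [r' hr']].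
- by exists c%:P => t; rewrite mevalC hornerC.
- by have [r hr] := hF i; exists r => t; rewrite mevalXU hr.
- by exists (r + r') => t; rewrite mevalD hornerD hr hr'.
by exists (r * r') => t; rewrite mevalM hornerM hr hr'.
Qed.

Lemma PolyFun_surf (f g : algC -> algC) (P : {mpoly algC[3]}) : PolyFun f -> PolyFun g ->
  PolyFun (fun t => P.@[surf (f t) (g t) ord0]).
Proof.
move=> [r hr] [q hq].
pose s := 3^-1 *: (4%:P + 2%:P * q - r + r * q).
have hs t : s.[t] = surf_s (f t) (g t).
  by rewrite /s hornerZ !(hornerD, hornerM, hornerN, hornerC) -hr -hq /surf_s mulrC.
apply: PolyFun_meval => i.
exists [:: s + 3%:P * r; q + 3%:P * r * s + 3%:P * r ^+ 2;
           3%:P * r * q + 3%:P * r ^+ 2 * s + r ^+ 3]`_i => t.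
rewrite mxE /surf_coord; case: i => [[|[|[|]]] //= li];
  by rewrite !(hornerD, hornerM, horner_exp, hornerC) hs -hr -?hq.
Qed.

Definition surface : 'rV[algC]_3 -> Prop := zclosure (fun x => exists m p, x = surf m p).

Lemma locus_C3E : locus_variety 'Z_3 3 = surface.
Proof.
rewrite (locus_varietyE (n := 3) (D := fun k : algC * algC => k.1 * k.2 != 1)
          (F := fun k => fam3 k.1 k.2)) //.
- apply: functional_extensionality => x; apply: propositional_extensionality.
  split=> h P vP; apply: h => y.
    by move=> [k nk ->]; apply: vP; rewrite surf_sigma //; exists (mult3 k.1 k.2), (k.1 * k.2).
  move=> [m [p0 ->]].
  (* The line [p = 1] is missing from the family. Along the line of constant [m] through [(m, p0)],
     the pullback of [P] is a polynomial that vanishes off one parameter, hence everywhere. *)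
  have [r hr] := PolyFun_surf P (PolyFunC m) (PolyFunD (PolyFunC p0) PolyFunX).
  suff r0 : r = 0 by have := hr 0; rewrite addr0 => ->; rewrite r0 horner0.
  have /eqP : r * ('X + (p0 - 1)%:P) = 0.
    apply: poly_eq0_horner => t; rewrite hornerM hornerD hornerX hornerC -hr.
    have [e|ne] := eqVneq (p0 + t) 1.
      have -> : t + (p0 - 1) = p0 + t - 1 by ring.
      by rewrite e subrr mulr0.
    have [k1 [k2 [e1 e2]]] := surf_params m ne.
    rewrite vP ?mul0r //; exists (k1, k2); rewrite /= ?e1 //.
    by rewrite surf_sigma ?e1 // e2.
  by rewrite mulf_eq0 -[_ + _ == 0]size_poly_eq0 size_XaddC orbF => /eqP.
- by move=> k; apply: fam3_autlocus.
by move=> f /autlocus_C3[k1 [k2 [nk c]]]; exists (k1, k2).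
Qed.

Lemma PolyFun_prime n (F : algC -> 'rV[algC]_n) (P Q : {mpoly algC[n]}) :
  (forall R : {mpoly algC[n]}, PolyFun (fun t => R.@[F t ord0])) ->
  (forall t, (P * Q).@[F t ord0] = 0) ->
  (forall t, P.@[F t ord0] = 0) \/ (forall t, Q.@[F t ord0] = 0).
Proof.
move=> h PQ; have [r hr] := h P; have [q hq] := h Q.
have /eqP : r * q = 0.
  by apply: poly_eq0_horner => t; rewrite hornerM -hr -hq -mevalM PQ.
by rewrite mulf_eq0 => /orP[]/eqP e; [left|right] => t; rewrite ?hr ?hq e horner0.
Qed.

Lemma surface_irreducible : zirreducible surface.
Proof.
apply: zclosure_irreducible; first by exists (surf 0 0), 0, 0.
move=> P Q PQ; apply: NNPP => /not_or_and[nP nQ].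
apply: nP => _ [m [p ->]]; apply: NNPP => nP; apply: nQ => _ [m' [p' ->]].
have lin (a b : algC) : PolyFun (fun t => a + t * b).
  exact: PolyFunD (PolyFunC a) (PolyFunM PolyFunX (PolyFunC b)).
(* A point where [P] does not vanish and one where [Q] does not are joined by a line in the
   parameter plane, where primality reduces to polynomials in one variable. *)
have [|h|h] := @PolyFun_prime _ (fun t => surf (m + t * (m' - m)) (p + t * (p' - p))) P Q
  (fun R => PolyFun_surf R (lin m (m' - m)) (lin p (p' - p))).
- by move=> t; apply: PQ; exists (m + t * (m' - m)), (p + t * (p' - p)).
- by case: nP; have := h 0; rewrite !mul0r !addr0.
have e (a b : algC) : a + (b - a) = b by ring.
by have := h 1; rewrite !mul1r !e.
Qed.

Definition surf_line : 'rV[algC]_3 -> Prop := zclosure (fun x => exists p, x = surf 0 p).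

Lemma surface_chain2 : has_chain surface 2.
Proof.
exists (fun i => match i with 0%N => pt_set (surf 0 0) | 1%N => surf_line | _ => surface end).
split=> [[|[|i]] _|[|[|i]] //|x]; last exact.
- by split; [apply: zclosed_point|apply: zirreducible_point].
- split; first exact: zclosed_zclosure.
  apply: zclosure_irreducible; first by exists (surf 0 0), 0.
  move=> P Q PQ; have [|h|h] := @PolyFun_prime _ (fun t => surf 0 t) P Q
    (fun R => PolyFun_surf R (PolyFunC 0) PolyFunX).
  + by move=> t; apply: PQ; exists t.
  + by left => _ [t ->].
  by right => _ [t ->].
- by split; [apply: zclosed_zclosure|apply: surface_irreducible].
- split; first by move=> _ ->; apply: incl_zclosure; exists 0.
  move=> h; have e : surf 0 1 = surf 0 0 by apply: h; apply: incl_zclosure; exists 1.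
  have /rowP/(_ (inord 1)) := e; rewrite !mxE /surf_coord inordK //= => /eqP.
  by rewrite !(mulr0, mul0r, addr0, expr0n) /= ?addr0 oner_eq0.
split.
  by apply: zclosure_min (@zclosed_zclosure _ _) _ => _ [p ->]; apply: incl_zclosure;
    exists 0, p.
(* For [m = 0] the third coordinate vanishes identically, while at [(m, p) = (1, 0)] it is 4. *)
move=> h; have : surf_line (surf 1 0) by apply: h; apply: incl_zclosure; exists 1, 0.
move/(_ 'X_(inord 2)); rewrite mevalXU mxE /surf_coord inordK //= /surf_s => hh.
have : 3 * 1 * 0 + 3 * 1 ^+ 2 * ((4 + 2 * 0 - 1 + 1 * 0) / 3) + 1 ^+ 3 = 0 :> algC.
  by apply: hh => _ [p ->]; rewrite mevalXU mxE /surf_coord inordK //=; ring.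
move=> e4; have /eqP : 4%:R = 0 :> algC by rewrite -[RHS]e4; field.
by rewrite pnatr_eq0.
Qed.

(** With [e = s + 1], modulo order 4 one has [e^2 = -(2 a + b)] and [e^3 = a + b], which reduces the
    claim to [Ord4_cusp]. *)
Lemma Ord4_e2e3 x y : Ord 4 (fun s => x * (s + 1) ^+ 2 + y * (s + 1) ^+ 3) -> x = 0 /\ y = 0.
Proof.
move=> h; have h1 : Ord 4 (fun s => (s + 1) ^+ 2 + (2 * cusp_a s + cusp_b s)).
  by exists 2%N, 1 => s ns; rewrite hornerC /cusp_a /cusp_b; field.
have h2 : Ord 4 (fun s => (s + 1) ^+ 3 - (cusp_a s + cusp_b s)).
  by exists 2%N, ('X - 1) => s ns; rewrite hornerD hornerN hornerX hornerC /cusp_a /cusp_b;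
    field.
have [] := @Ord4_cusp (y - 2 * x) (y - x).
  apply: Ord_ext (OrdB h (OrdD (OrdZ x h1) (OrdZ y h2))) => s _; ring.
move=> /eqP + /eqP; rewrite !subr_eq0 => /eqP e1 /eqP e2.
have x0 : x = 0.
  by transitivity (2 * x - x); [ring|rewrite -e1 e2 subrr].
by rewrite e2 x0.
Qed.

(* The tangent vectors at the image of [(m, p) = (-1, -2)]: the derivative of the
   parametrization along [p], and the coefficients of [e^2] and [e^3] along
   [(-1 + e, -2 - 6 e)], whose linear term vanishes. *)
Definition sing_rows (i j : nat) : algC :=
  (nth [::] [:: [:: 3^-1; 0; -2]; [:: -2; 0; -6]; [:: 0; -6; 4]] i)`_j.

Lemma Ord_e k : Ord k (fun s => (s + 1) ^+ k).
Proof. by exists 0%N, 1 => s _; rewrite hornerC expr0 mul1r mulr1. Qed.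

(** Along an arc whose displacement has order [k], the differential of [P] kills all coefficients of
    order below [2 k]. The arc in direction [p] has [k = 1] and gives the first row; the arc without
    linear term has [k = 2] and gives its [e^2] and [e^3] coefficients separately. *)
Lemma surface_tangent P : vanishes_on surface P ->
  forall i : 'I_3, lin_part (surf (-1) (-2) ord0) (fun j => sing_rows i j) P = 0.
Proof.
move=> vP; have v m p : P.@[surf m p ord0] = 0 by apply: vP; apply: incl_zclosure; exists m, p.
set x := surf (-1) (-2) ord0.
have c1 (s : algC) : surf_s (-1) (-2 + (s + 1)) = 1 + (s + 1) / 3 by rewrite /surf_s; field.
have c2 (s : algC) : surf_s (-1 + (s + 1)) (-2 - 6 * (s + 1)) = 1 - 3 * (s + 1) - 2 * (s + 1)
  ^+ 2.
  by rewrite /surf_s; field.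
have c3 : surf_s (-1) (-2) = 1 by rewrite /surf_s; field.
have h1 (j : 'I_3) (s : algC) :
    surf (-1) (-2 + (s + 1)) ord0 j - x j = (s + 1) * sing_rows 0 j.
  rewrite /x !mxE /surf_coord /sing_rows c1 c3.
  by case: j => [[|[|[|]]] //= lj]; field.
have h2 (j : 'I_3) (s : algC) :
    surf (-1 + (s + 1)) (-2 - 6 * (s + 1)) ord0 j - x j =
    (s + 1) ^+ 2 * sing_rows 1 j + (s + 1) ^+ 3 * sing_rows 2 j
    + (s + 1) ^+ 4 * [:: 0; 0; -6]`_j.
  rewrite /x !mxE /surf_coord /sing_rows c2 c3.
  by case: j => [[|[|[|]]] //= lj]; ring.
have t1 := @taylor_Ord 3 1 (fun s => surf (-1) (-2 + (s + 1)) ord0) x P.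
have t2 := @taylor_Ord 3 2 (fun s => surf (-1 + (s + 1)) (-2 - 6 * (s + 1)) ord0) x P.
have L0 : lin_part x (fun j => sing_rows 0 j) P = 0.
  have {}t1 : Ord 2 (fun s => lin_part x (fun j => sing_rows 0 j) P * (s + 1)).
    apply: Ord_ext (OrdN (t1 _)) => [s _|j].
      rewrite !v subrr sub0r opprK /lin_part mulr_suml; apply: eq_bigr => j _.
      by rewrite h1; ring.
    by apply: Ord_ext (OrdZ (sing_rows 0 j) (Ord_e 1)) => s _; rewrite h1 expr1 mulrC.
  (* Multiplying the order 2 statement by [e^2] brings it to the form of [Ord4_e2e3] with
     [x = 0]. *)
  have [] // := @Ord4_e2e3 0 (lin_part x (fun j => sing_rows 0 j) P).
  by apply: Ord_ext (OrdM t1 (Ord_e 2)) => s _; ring.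
have [L1 L2] : lin_part x (fun j => sing_rows 1 j) P = 0 /\ lin_part x (fun j => sing_rows 2
  j) P = 0.
  apply: Ord4_e2e3.
  (* The [e^4] coefficient [(0, 0, -6)] of the arc joins the remainder. *)
  have o4 : Ord 4 (fun s => lin_part x (fun j => [:: 0; 0; -6]`_j) P * (s + 1) ^+ 4).
    exact: OrdZ (Ord_e 4).
  apply: Ord_ext (OrdN (OrdD (t2 _) o4)) => [s _|j].
    rewrite !v subrr sub0r /lin_part !mulr_suml opprD opprK -sumrN -!big_split.
    by apply: eq_bigr => j _; rewrite h2 /=; ring.
  apply: Ord_ext (OrdD (OrdD (OrdZ (sing_rows 1 j) (Ord_e 2))
     (OrdZ (sing_rows 2 j) (OrdW (isT : (2 <= 3)%N) (Ord_e 3))))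
     (OrdZ [:: 0; 0; -6]`_j (OrdW (isT : (2 <= 4)%N) (Ord_e 4)))) => s _.
  by rewrite h2; ring.
by case=> [[|[|[|]]] //= li].
Qed.

(** * Upper bound for the dimension of the surface *)

Local Notation bipoly := {poly {poly algC}}.

Definition biconst : {rmorphism algC -> bipoly} := (polyC \o polyC : {rmorphism algC ->
  bipoly}).

(** The generic point of the surface, with [m] as outer and [p] as inner variable. *)
Definition bisurf (i : 'I_3) : bipoly :=
  let m := 'X in let p := 'X%:P in
  let s := biconst 3^-1 * (4 + 2 * p - m + m * p) in
  [:: s + 3 * m; p + 3 * m * s + 3 * m ^+ 2; 3 * m * p + 3 * m ^+ 2 * s + m ^+ 3]`_i.

Lemma mmap_bisurf (P : {mpoly algC[3]}) m p :
  (mmap biconst bisurf P).[m%:P].[p] = P.@[surf m p ord0].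
Proof.
elim/mpoly_ring_ind: P => [c|i|P Q hP hQ|P Q hP hQ].
- by rewrite mmapC mevalC /= !hornerC.
- rewrite mmapX mmap1U mevalXU mxE /bisurf /surf_coord /surf_s.
  case: i => [[|[|[|]]] //= li];
  by rewrite /biconst /= -!(natrE, polyC_natr) !(hornerD, hornerM, hornerN, hornerC, hornerX,
    horner_exp, hornerMn) ; field.
- by rewrite mmapD !hornerD hP hQ mevalD.
by rewrite rmorphM !hornerM hP hQ mevalM.
Qed.

Definition bidegree (b : nat) (q : bipoly) : Prop :=
  (size q <= b.+1)%N /\ forall i, (size (q`_i)%R <= b.+1)%N.

Lemma bidegreeW b c q : (b <= c)%N -> bidegree b q -> bidegree c q.
Proof. by move=> bc [h1 h2]; split=> [|i];
  [apply: leq_trans h1 _|apply: leq_trans (h2 i) _]. Qed.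

Lemma bidegree_ex q : exists b, bidegree b q.
Proof.
exists (maxn (size q) (\max_(i < size q) size (q`_i)%R)); split=> [|i].
  by rewrite leqW // leq_maxl.
have [l|l] := ltnP i (size q); last by rewrite nth_default // size_poly0.
by rewrite leqW // leq_max (leq_bigmax (Ordinal l)) orbT.
Qed.

Lemma bidegreeM b c q r : bidegree b q -> bidegree c r -> bidegree (b + c) (q * r).
Proof.
move=> [q1 q2] [r1 r2]; split=> [|i].
  by apply: leq_trans (size_polyMleq _ _) _; lia.
rewrite coefM; apply: (leq_trans (size_sum _ _ _)); apply/bigmax_leqP => j _.
by apply: leq_trans (size_polyMleq _ _) _; have := q2 j; have := r2 (i - j)%N; lia.
Qed.

Lemma bidegree1 : bidegree 0 1.
Proof.
split=> [|i]; first by rewrite size_poly1.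
by rewrite coef1; case: (i == 0%N); rewrite ?size_poly1 ?size_poly0.
Qed.

Lemma bidegreeX b q n : bidegree b q -> bidegree (b * n) (q ^+ n).
Proof.
move=> h; elim: n => [|n IH]; first by rewrite muln0 expr0; apply: bidegree1.
by rewrite exprS mulnS; apply: bidegreeM.
Qed.

(* Counting monomials: the [N^3] products of powers of three polynomials of
   bidegree at most [B] have only [(3 B N + 1)^2] coefficients. *)
Lemma bipoly_dep (q1 q2 q3 : bipoly) : exists N (c : 'I_N * 'I_N * 'I_N -> algC),
  (exists e, c e != 0) /\
  \sum_e biconst (c e) * (q1 ^+ e.1.1 * q2 ^+ e.1.2 * q3 ^+ e.2) = 0.
Proof.
have [b1 h1] := bidegree_ex q1; have [b2 h2] := bidegree_ex q2; have [b3 h3] := bidegree_ex q3.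
(* [N] is chosen so that [N^3] exceeds [9 (B + 1)^2 N^2], a bound for the number [K^2] of
   coefficients. *)
pose B := (b1 + b2 + b3)%N; pose N := (9 * (B.+1 * B.+1)).+1; pose K := (3 * B * N).+1.
pose mon (e : 'I_N * 'I_N * 'I_N) := q1 ^+ e.1.1 * q2 ^+ e.1.2 * q3 ^+ e.2.
have dmon e : bidegree (3 * B * N) (mon e).
  have B1 : bidegree B q1 by apply: bidegreeW h1; rewrite /B; lia.
  have B2 : bidegree B q2 by apply: bidegreeW h2; rewrite /B; lia.
  have B3 : bidegree B q3 by apply: bidegreeW h3; rewrite /B; lia.
  apply: bidegreeW (bidegreeM (bidegreeM (bidegreeX e.1.1 B1) (bidegreeX e.1.2 B2)) (bidegreeX
    e.2 B3)).
  rewrite -!mulnDr (mulnC 3%N) -mulnA leq_mul2l; apply/orP; right.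
  by have := ltn_ord e.1.1; have := ltn_ord e.1.2; have := ltn_ord e.2; lia.
have [|c nc cF] := @lin_dep ('I_N * 'I_N * 'I_N)%type ('I_K * 'I_K)%type (fun e d => (mon
  e)`_d.1`_d.2).
  rewrite !card_prod !card_ord.
  have KN : (K <= 3 * B.+1 * N)%N by rewrite /K -addn1 mulnS mulnDl addnC leq_add2r muln_gt0.
  apply: leq_ltn_trans (leq_mul KN KN) _.
  rewrite (_ : 3 * B.+1 * N * (3 * B.+1 * N) = (9 * (B.+1 * B.+1)) * (N * N))%N; last by ring.
  by rewrite mulnC ltn_pmul2l ?muln_gt0.
exists N, c; split=> //; apply/polyP => x; apply/polyP => y; rewrite coef_sum coef_sum !coef0.
have [lx|lx] := ltnP x K; last first.
  rewrite big1 // => e _; rewrite coefCM coefCM -/(mon e).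
  by rewrite [(mon e)`_x]nth_default ?coef0 ?mulr0 // (leq_trans (dmon e).1).
have [ly|ly] := ltnP y K; last first.
  rewrite big1 // => e _; rewrite coefCM coefCM -/(mon e).
  by rewrite [(mon e)`_x`_y]nth_default ?mulr0 // (leq_trans ((dmon e).2 x)).
rewrite -[RHS](cF (Ordinal lx, Ordinal ly)) /=; apply: eq_bigr => e _.
by rewrite coefCM coefCM.
Qed.

Lemma ev_next_poly n (A : comNzRingType) (ev : {rmorphism A -> {mpoly algC[n]}}) P N (E : nat
  -> A) :
  ev_next ev P (\poly_(k < N) E k) = \sum_(k < N) ev (E k) * P ^+ k.
Proof.
rewrite poly_def rmorph_sum; apply: eq_bigr => k _.
by rewrite ev_nextE -mul_polyC rmorphM rmorphXn /= map_polyX map_polyC hornerM hornerC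
  hornerXn.
Qed.

Lemma sum_triple (R : nmodType) N (T : 'I_N * 'I_N * 'I_N -> R) :
  \sum_e T e = \sum_k \sum_j \sum_i T (i, j, k).
Proof.
rewrite (eq_bigr (fun e => T (e.1, e.2))); last by case.
rewrite -(pair_bigA _ (fun p k => T (p, k))) exchange_big; apply: eq_bigr => k _.
rewrite (eq_bigr (fun p => T (p.1, p.2, k))); last by case.
by rewrite -(pair_bigA _ (fun i j => T (i, j, k))) exchange_big.
Qed.

Lemma insubd_ord N (i0 i : 'I_N) : insubd i0 (i : nat) = i.
Proof. exact: valKd. Qed.

(** A chain of length 3 would give three polynomials independent on the surface; pulled back along
    [bisurf] they have only two variables, and [bipoly_dep] provides a relation. *)
Lemma surface_no_chain3 : ~ has_chain surface 3.
Proof.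
move=> /chain3_indep[P1 [P2 [P3 ind]]].
have [N [c [[e ne] dep]]] := bipoly_dep (mmap biconst bisurf P1) (mmap biconst bisurf P2)
  (mmap biconst bisurf P3).
pose g i j k := c (insubd e.1.1 i, insubd e.1.2 j, insubd e.2 k).
(* The relation as a nested polynomial, with the variable of [P3] outermost to match the iterated
   [ev_next]. *)
pose R := \poly_(k < N) \poly_(j < N) \poly_(i < N) g i j k.
have R0 : R = 0.
  apply: ind; apply/vanishes_zclosure => _ [m [p ->]].
  rewrite -mmap_bisurf (_ : mmap _ _ _ = 0) ?horner0 //.
  rewrite -[RHS]dep sum_triple ev_next_poly rmorph_sum; apply: eq_bigr => k _.
  rewrite rmorphM rmorphXn ev_next_poly rmorph_sum mulr_suml; apply: eq_bigr => j _.
  rewrite rmorphM rmorphXn ev_next_poly rmorph_sum !mulr_suml; apply: eq_bigr => i _.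
  by rewrite rmorphM rmorphXn /= mmapC /g !insubd_ord !mulrA.
case/eqP: ne; have := congr1 (fun r : {poly {poly {poly algC}}} => r`_(e.2)`_(e.1.2)`_(e.1.1))
  R0.
rewrite /R /= !coef0 !coef_poly ltn_ord coef_poly ltn_ord coef_poly ltn_ord /g !insubd_ord.
by case: (e) => [[i j] k].
Qed.

(** The inverse of the matrix [sing_rows], certifying that its rows are independent. *)
Definition sing_inv (i j : nat) : algC :=
  (nth [::] [:: [:: 1; - 3^-1; 0]; [:: - (2 / 9); - 27^-1; - 6^-1]; [:: - 3^-1; - 18^-1;
    0]] i)`_j.

Lemma surface_dim : has_dim surface 2.
Proof. by split; [apply: surface_chain2|apply: surface_no_chain3]. Qed.

(** Here [m = -1], [k1 + k2 = 1] and [k1 k2 = -2], so the multipliers are 2 and four times -1. This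
    is a point of the cuspidal edge, where some [k_i] equals [m]: changing [k_i] and [m] at rates -3
    and 1 leaves the invariants fixed to first order. The tangent space there is all of 3-space. *)
Lemma surface_singular : exists x, singular_point surface x.
Proof.
exists (surf (-1) (-2)); apply/(singular_pointE _ surface_dim).
split; first by apply: incl_zclosure; exists (-1), (-2).
exists (\matrix_(i, j) sing_rows i j).
  apply/row_freeP; exists (\matrix_(i, j) sing_inv i j); apply: mulmx1C.
  apply/matrixP => i j; rewrite !mxE !big_ord_recl big_ord0 !mxE /=.
  case: i => [[|[|[|]]] //= li]; case: j => [[|[|[|]]] //= lj];
    by rewrite /sing_inv /sing_rows /=; field.
move=> i; apply/tangentE => P vP; rewrite -[RHS](surface_tangent vP i).
by apply: eq_bigr => j _; rewrite !mxE.
Qed.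

Lemma surface_irreducible_of_dim : irreducible_of_dim 2 surface.
Proof. by split; [apply: zclosed_zclosure|apply: surface_irreducible|apply: surface_dim]. Qed.

Theorem theorem1p6 :
  (* (1) *)
  (one_to_one (fun k : algC => k != 0)
              (fun k : algC => ('X^4 + 1, k *: 'X^3)) /\
   irreducible_of_dim 1 (locus_variety 'Z_4 4) /\
   has_genus (locus_variety 'Z_4 4) 0 /\
   exists! x, singular_point (locus_variety 'Z_4 4) x) /\
  (* (2) *)
  (one_to_one (fun k : algC => k != 1 /\ k != -1)
              (fun k : algC => ('X^4 + k *: 'X, k *: 'X^3 + 1)) /\
   irreducible_of_dim 1 (locus_variety D3 4) /\
   has_genus (locus_variety D3 4) 0 /\
   exists! x, singular_point (locus_variety D3 4) x) /\
  (* (3) *)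
  (two_to_one (fun k : 'rV[algC]_2 => k 0 0 * k 0 1 != 1)
              (fun k : 'rV[algC]_2 =>
                 ('X^4 + k 0 0 *: 'X, k 0 1 *: 'X^3 + 1)) /\
   irreducible_of_dim 2 (locus_variety 'Z_3 3) /\
   exists x, singular_point (locus_variety 'Z_3 3) x) /\
  (* (4) *)
  two_to_one (fun k : 'rV[algC]_3 =>
                k 0 1 ^+ 2 + k 0 2 ^+ 2 != k 0 0 * k 0 1 * k 0 2)
             (fun k : 'rV[algC]_3 =>
                ('X^4 + k 0 0 *: 'X^2 + 1, k 0 1 *: 'X^3 + k 0 2 *: 'X)).
Proof.
have [C1 C2 C3] := curve_C4; have [D1 D2 D3'] := curve_D3.
split; first by split; [apply: fam1_one_to_one|].
split; first by split; [apply: fam2_one_to_one|].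
split; last exact: fam4_two_to_one.
split; first exact: fam3_two_to_one.
rewrite locus_C3E; split; [exact: surface_irreducible_of_dim|exact: surface_singular].
Qed.
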